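(* Let $N\ge1$ be an integer, $A>-1/2$, $B\in(-A,A+1)$, $C<-A-N+1$. Let $\mathcal T=(-A-B,\infty)$, $\widetilde{\mathcal T}=(A+N-C,\infty)$, and let $\Theta$, $(\zeta_t)_{t\in\mathcal T}$, $(\zeta'_t)_{t\in\widetilde{\mathcal T}}$ be as follows: $\Theta$ has law $\Pr(\Theta=k)=\Pi_k(A+C,A-B+1;N)$, $k=0,\dots,N$; $(\zeta_t)$ and $(\zeta'_t)$ are conditionally independent given $\Theta$; and conditionally on $\Theta=K$ they have the laws of the Markov chains $(\xi_t^{(K)})$ (on $\{0,\dots,K\}$) and $(\widetilde\xi_t^{(K)})$ (on $\{K,\dots,N\}$) respectively, all described in the context. Put $$Y_t=(A+t+\zeta_t)(A+\zeta_t),\quad X_t=Y_t-E(Y_t)\ (t\in\mathcal T);\qquad Y'_t=(t-A-\zeta'_t)(A+\zeta'_t),\quad X'_t=Y'_t-E(Y'_t)\ (t\in\widetilde{\mathcal T}),$$ $$v=\frac{\sqrt{N(N+A-B)(A+C)(B+C)}}{\sqrt{N-1-B-C}},\qquad \varphi(t)=\frac{t(A-C+N)-A-B}{1-t},\qquad \varphi'(t)=-\varphi(t),$$ and define $$Z_t=\begin{cases}\dfrac{1-t}{v}\,X_{\varphi(t)},&0<t<1,\\[4pt] \dfrac{(A+C)N+\Theta(N-B-C)}{v},&t=1,\\[4pt] \dfrac{t-1}{v}\,X'_{\varphi'(t)},&t>1.\end{cases}$$ Then the Markov process $(Z_t)_{t>0}$ extends the Case 1 process, in the sense that $(Z_t)_{0<t<1}$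 has the same finite-dimensional distributions as the process $\left(\frac{1-t}{v}\big(Y^{\circ}_{\varphi(t)}-E(Y^{\circ}_{\varphi(t)})\big)\right)_{0<t<1}$ with $Y^{\circ}_t=(A+t+\xi_t)(A+\xi_t)$, where $(\xi_t)_{t\in\mathcal T}$ is the Case 1 Markov chain with parameters $N,A,B,C$ described in the context; and $(Z_t)_{t>0}$ is a quadratic harness on $(0,\infty)$ with parameters $$\eta=-\frac{A(B+C+N)+C(B+C)+N(N-B)}{\sqrt{N(A+C)(B+C)(A-B+N)(N-1-B-C)}},\qquad \theta=-\frac{A(B+C+N)-B(B+C-N)+2CN}{\sqrt{N(A+C)(B+C)(A-B+N)(N-1-B-C)}},$$ $$\sigma=\tau=\frac1{N-1-B-C},\qquad \gamma=1+2\sqrt{\sigma\tau}=\frac{B+C-N-1}{B+C-N+1}.$$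
   Context: Pochhammer symbol: $(\alpha)_0=1$, $(\alpha)_k=\alpha(\alpha+1)\cdots(\alpha+k-1)$. Law of $\Theta$: $\Pi_k(a,c;N)=\dfrac{(c)_N(a)_k(-N)_k}{(c-a)_N\,k!\,(c)_k}$, $k=0,\dots,N$. Weights: for integers $0\le j\le K$, $\pi_{j,K}(a,b)=\binom Kj\dfrac{(a-b+j+1)_{K-j}}{(a+2j+1)_{K-j}}\cdot\dfrac{(b)_j}{(a+j)_j}$. For $K\in\{0,\dots,N\}$, $(\xi^{(K)}_t)_{t\ge -A-B}$ is the Markov chain on $\{0,\dots,K\}$ with $\xi^{(K)}_{-A-B}=0$ and, for $s<t$, $\Pr(\xi_t^{(K)}=j\mid\xi_s^{(K)}=m)=\pi_{j-m,K-m}(2A+2m+t,\,t-s)$ for $m\le j\le K$, and $0$ for $j<m$. For $K\in\{0,\dots,N\}$, $(\widetilde\xi^{(K)}_t)_{t\ge A+N-C}$ is the (dual) Markov chain on $\{K,\dots,N\}$ with $\widetilde\xi^{(K)}_{A+N-C}=N$ and, for $s<t$, $\Pr(\widetilde\xi_t^{(K)}=j\mid\widetilde\xi_s^{(K)}=i)=\pi_{j-K,i-K}(2A+2K-t,\,2A+i+K-s)$ for $K\le j\le i$, and $0$ for $j>i$. Case 1 chain: for integers $0\le k\le N$, $$p_{k,N}(a,b,c)=C_N(a,b,c)\,\frac{(2a)_k(a+1)_k(a+b)_k(a+c)_k(-N)_k}{k!\,(a)_k(a-b+1)_k(a-c+1)_k(2a+N+1)_k},\qquad C_N(a,b,c)=\frac{(a-b+1)_N(a-c+1)_N}{(2a+1)_N(-b-c+1)_N},$$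 where $(2a)_k(a+1)_k/(a)_k$ is read as $1$ if $k=0$ and $2(2a+1)_{k-1}(a+k)$ if $k\ge1$. $(\xi_t)_{t\in\mathcal T}$ is the Markov chain on $\{0,\dots,N\}$ with $\Pr(\xi_t=j)=p_{j,N}(A+\tfrac t2,B+\tfrac t2,C-\tfrac t2)$ and, for $s<t$, $\Pr(\xi_t=n\mid\xi_s=k)=p_{n-k,N-k}(A+\tfrac t2+k,-A-s+\tfrac t2-k,C-\tfrac t2)$ for $0\le k\le n\le N$, and $0$ for $n<k$. Quadratic harness: let $T\subset(0,\infty)$ be an open interval. A square-integrable process $(Z_t)_{t\in T}$ is a quadratic harness on $T$ with parameters $(\eta,\theta,\sigma,\tau,\gamma)$ if, with $\mathcal F_{s,u}=\sigma(Z_r:r\in T,\ r\le s\text{ or }r\ge u)$, $\mathcal F_{\le s}=\sigma(Z_r:r\in T, r\le s)$, $\mathcal F_{\ge u}=\sigma(Z_r: r\in T, r\ge u)$: (i) $E(Z_t)=0$ and $E(Z_sZ_t)=\min\{s,t\}$ for $s,t\in T$; (ii) for $s<t<u$ in $T$, $E(Z_t\mid\mathcal F_{s,u})=\frac{u-t}{u-s}Z_s+\frac{t-s}{u-s}Z_u$; (iii) for $s<t<u$ in $T$, $$\mathrm{Var}(Z_t\mid\mathcal F_{s,u})=\frac{(u-t)(t-s)}{u(1+\sigma s)+\tau-\gamma s}\Big(1+\eta\tfrac{uZ_s-sZ_u}{u-s}+\theta\tfrac{Z_u-Z_s}{u-s}+\sigma\tfrac{(uZ_s-sZ_u)^2}{(u-s)^2}+\tau\tfrac{(Z_u-Z_s)^2}{(u-s)^2}-(1-\gamma)\tfrac{(Z_u-Z_s)(uZ_s-sZ_u)}{(u-s)^2}\Big);$$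 (iv) for $s\le t\le u$ in $T$: $E(Z_t\mid\mathcal F_{\ge u})=\frac tuZ_u$, $E(Z_t\mid\mathcal F_{\le s})=Z_s$, $\mathrm{Var}(Z_t\mid\mathcal F_{\le s})=\frac{t-s}{1+\sigma s}(\sigma Z_s^2+\eta Z_s+1)$, $\mathrm{Var}(Z_t\mid\mathcal F_{\ge u})=\frac{t(u-t)}{u+\tau}\left(\tau\frac{Z_u^2}{u^2}+\theta\frac{Z_u}{u}+1\right)$.
   Formalization: The condition N-1-B-C>0 is added; it is automatic for N≥2 and for N=1 excludes only 0≤B+C<1, where v is not a defined real number and the two displayed expressions for γ disagree or are undefined. *)

(* Defs.v *)
(* Processes are functions [X : R -> Omega -> T]; only the values [X t] for [t]
   in the stated time set are meaningful. *)
From mathcomp Require Import all_boot all_order all_algebra.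
From mathcomp Require Import all_classical all_reals all_analysis.

Set Implicit Arguments.
Unset Strict Implicit.
Unset Printing Implicit Defensive.

Import Order.TTheory GRing.Theory Num.Theory.
Import numFieldNormedType.Exports.

Local Open Scope classical_set_scope.
Local Open Scope ring_scope.

Definition poch (R : realType) (a : R) (k : nat) : R :=
  \prod_(i < k) (a + i%:R).

Definition Pi_law (R : realType) (N : nat) (a c : R) (k : nat) : R :=
  (poch c N * poch a k * poch (- N%:R) k) /
  (poch (c - a) N * k`!%:R * poch c k).

Definition pi_weight (R : realType) (j K : nat) (a b : R) : R :=
  'C(K, j)%:R *
  (poch (a - b + j%:R + 1) (K - j) / poch (a + 2 * j%:R + 1) (K - j)) *
  (poch b j / poch (a + j%:R) j).

Definition xi_trans (R : realType) (A : R) (K : nat) (s t : R) (m j : nat) : R :=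
  if (m <= j)%N then
    pi_weight (j - m) (K - m) (2 * A + 2 * m%:R + t) (t - s)
  else 0.

Definition xi_dual_trans (R : realType) (A : R) (K : nat) (s t : R)
    (i j : nat) : R :=
  if (j <= i)%N then
    pi_weight (j - K) (i - K) (2 * A + 2 * K%:R - t) (2 * A + i%:R + K%:R - s)
  else 0.

(* The quotient (2a)_k (a+1)_k / (a)_k after cancelling the common factor a,
   so that it also makes sense when (a)_k vanishes. *)
Definition poch_ratio (R : realType) (a : R) (k : nat) : R :=
  if k is k'.+1 then 2 * poch (2 * a + 1) k' * (a + k%:R) else 1.

Definition case1_const (R : realType) (N : nat) (a b c : R) : R :=
  (poch (a - b + 1) N * poch (a - c + 1) N) /
  (poch (2 * a + 1) N * poch (- b - c + 1) N).

Definition case1_weight (R : realType) (k N : nat) (a b c : R) : R :=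
  case1_const N a b c *
  ((poch_ratio a k * poch (a + b) k * poch (a + c) k * poch (- N%:R) k) /
   (k`!%:R * poch (a - b + 1) k * poch (a - c + 1) k *
    poch (2 * a + N%:R + 1) k)).

Definition case1_marginal (R : realType) (N : nat) (A B C : R) (t : R)
    (j : nat) : R :=
  case1_weight j N (A + t / 2) (B + t / 2) (C - t / 2).

Definition case1_trans (R : realType) (N : nat) (A C : R) (s t : R)
    (k n : nat) : R :=
  if (k <= n)%N then
    case1_weight (n - k) (N - k)
      (A + t / 2 + k%:R) (- A - s + t / 2 - k%:R) (C - t / 2)
  else 0.

Definition process (R : realType) d (Omega : measurableType d)
    d' (T : measurableType d') (D : set R) (X : R -> Omega -> T) : Prop :=
  forall t, D t -> measurable_fun setT (X t).

(* The sigma-algebra generated by (X_t), t in D. *)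
Definition sigma_process (R : realType) d (Omega : measurableType d)
    d' (T : measurableType d') (D : set R) (X : R -> Omega -> T) :
    set (set Omega) :=
  <<s \bigcup_(t in D) preimage_set_system setT (X t) measurable >>.

Definition prob (R : realType) d (Omega : measurableType d)
    (P : probability Omega R) (E : set Omega) : R := fine (P E).

Definition cond_prob (R : realType) d (Omega : measurableType d)
    (P : probability Omega R) (H E : set Omega) : R :=
  prob P (E `&` H) / prob P H.

(* Under Q, (X_t), t in D, is a Markov chain on the state space S with
   marginals q and transition probabilities p.  The last clause is the Markov
   property with respect to the natural filtration, multiplied out so that
   events of probability zero need no separate treatment. *)
Definition markov_chain (R : realType) d (Omega : measurableType d)
    (Q : set Omega -> R) (D : set R) (S : set nat)
    (q : R -> nat -> R) (p : R -> R -> nat -> nat -> R)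
    (X : R -> Omega -> nat) : Prop :=
  [/\ forall t, D t -> Q (X t @^-1` S) = 1,
      forall t j, D t -> S j -> Q (X t @^-1` [set j]) = q t j
    & forall s t m j (E : set Omega), D s -> D t -> s < t -> S m -> S j ->
        sigma_process [set r | D r /\ r <= s] X E ->
        Q (E `&` X s @^-1` [set m] `&` X t @^-1` [set j]) =
        Q (E `&` X s @^-1` [set m]) * p s t m j ].

Definition cond_independent (R : realType) d (Omega : measurableType d)
    (P : probability Omega R) (N : nat) (Theta : Omega -> nat)
    (D D' : set R) (X X' : R -> Omega -> nat) : Prop :=
  forall (K : nat) (E E' : set Omega), (K <= N)%N ->
    sigma_process D X E -> sigma_process D' X' E' ->
    cond_prob P (Theta @^-1` [set K]) (E `&` E') =
    cond_prob P (Theta @^-1` [set K]) E * cond_prob P (Theta @^-1` [set K]) E'.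

Definition T_dom (R : realType) (A B : R) : set R := [set t | - A - B < t].

Definition T'_dom (R : realType) (N : nat) (A C : R) : set R :=
  [set t | A + N%:R - C < t].

(* Laws given Theta = K: the chain started from 0 at time -A-B, restricted to
   the open half-line, so that its marginal at t is the transition probability
   from that starting point. *)
Definition xi_chain (R : realType) d (Omega : measurableType d)
    (Q : set Omega -> R) (A B : R) (K : nat) (X : R -> Omega -> nat) : Prop :=
  markov_chain Q (T_dom A B) [set j | (j <= K)%N]
    (fun t j => xi_trans A K (- A - B) t 0 j) (xi_trans A K) X.

(* Likewise for the dual chain, started from N at time A+N-C. *)
Definition xi_dual_chain (R : realType) d (Omega : measurableType d)
    (Q : set Omega -> R) (N : nat) (A C : R) (K : nat)
    (X : R -> Omega -> nat) : Prop :=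
  markov_chain Q (T'_dom N A C) [set j | (K <= j <= N)%N]
    (fun t j => xi_dual_trans A K (A + N%:R - C) t N j) (xi_dual_trans A K) X.

Definition case1_chain (R : realType) d (Omega : measurableType d)
    (Q : set Omega -> R) (N : nat) (A B C : R) (X : R -> Omega -> nat) : Prop :=
  markov_chain Q (T_dom A B) [set j | (j <= N)%N]
    (case1_marginal N A B C) (case1_trans N A C) X.

Definition Y_process (R : realType) (Omega : Type) (A : R)
    (zeta : R -> Omega -> nat) (t : R) (w : Omega) : R :=
  (A + t + (zeta t w)%:R) * (A + (zeta t w)%:R).

Definition Y'_process (R : realType) (Omega : Type) (A : R)
    (zeta' : R -> Omega -> nat) (t : R) (w : Omega) : R :=
  (t - A - (zeta' t w)%:R) * (A + (zeta' t w)%:R).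

Definition centered (R : realType) d (Omega : measurableType d)
    (P : probability Omega R) (Y : R -> Omega -> R) (t : R) (w : Omega) : R :=
  Y t w - fine ('E_P[Y t])%E.

Definition v_const (R : realType) (N : nat) (A B C : R) : R :=
  Num.sqrt (N%:R * (N%:R + A - B) * (A + C) * (B + C)) /
  Num.sqrt (N%:R - 1 - B - C).

Definition phi (R : realType) (N : nat) (A B C : R) (t : R) : R :=
  (t * (A - C + N%:R) - A - B) / (1 - t).

Definition phi' (R : realType) (N : nat) (A B C : R) (t : R) : R :=
  - phi N A B C t.

Definition Z_process (R : realType) d (Omega : measurableType d)
    (P : probability Omega R) (N : nat) (A B C : R) (Theta : Omega -> nat)
    (zeta zeta' : R -> Omega -> nat) (t : R) (w : Omega) : R :=
  if t < 1 then
    (1 - t) / v_const N A B C *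
      centered P (Y_process A zeta) (phi N A B C t) w
  else if t == 1 then
    ((A + C) * N%:R + (Theta w)%:R * (N%:R - B - C)) / v_const N A B C
  else
    (t - 1) / v_const N A B C *
      centered P (Y'_process A zeta') (phi' N A B C t) w.

Definition Z_case1 (R : realType) d (Omega : measurableType d)
    (P : probability Omega R) (N : nat) (A B C : R)
    (xi : R -> Omega -> nat) (t : R) (w : Omega) : R :=
  (1 - t) / v_const N A B C *
    centered P (Y_process A xi) (phi N A B C t) w.

Definition same_fdd (R : realType) d (Omega : measurableType d)
    d' (Omega' : measurableType d')
    (P : probability Omega R) (P' : probability Omega' R) (D : set R)
    (X : R -> Omega -> R) (X' : R -> Omega' -> R) : Prop :=
  forall (n : nat) (t : n.-tuple R) (U : set (n.-tuple R)),
    (forall i, D (tnth t i)) -> measurable U ->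
    P [set w | U [tuple X (tnth t i) w | i < n]] =
    P' [set w | U [tuple X' (tnth t i) w | i < n]].

(* Y is a version of E(X | G). *)
Definition is_cond_exp (R : realType) d (Omega : measurableType d)
    (P : probability Omega R) (G : set (set Omega)) (X Y : Omega -> R) : Prop :=
  [/\ P.-integrable setT (EFin \o X), P.-integrable setT (EFin \o Y),
      preimage_set_system setT Y measurable `<=` G
    & forall E, G E ->
        (\int[P]_(w in E) (Y w)%:E = \int[P]_(w in E) (X w)%:E)%E ].

(* V is a version of Var(X | G). *)
Definition is_cond_var (R : realType) d (Omega : measurableType d)
    (P : probability Omega R) (G : set (set Omega)) (X V : Omega -> R) : Prop :=
  exists2 M : Omega -> R, is_cond_exp P G X M &
    is_cond_exp P G (fun w => (X w - M w) ^+ 2) V.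

(* P(X_t in V | F_{<= s}) = P(X_t in V | X_s) almost surely. *)
Definition markov_process (R : realType) d (Omega : measurableType d)
    (P : probability Omega R) (D : set R) (X : R -> Omega -> R) : Prop :=
  forall (s t : R) (V : set R), D s -> D t -> s < t -> measurable V ->
    exists2 f : Omega -> R,
      is_cond_exp P (sigma_process [set r | D r /\ r <= s] X)
        (\1_(X t @^-1` V)) f &
      is_cond_exp P (sigma_process [set s] X) (\1_(X t @^-1` V)) f.

Definition harness_var (R : realType) (eta theta sigma tau gamma s t u x y : R)
    : R :=
  ((u - t) * (t - s)) / (u * (1 + sigma * s) + tau - gamma * s) *
  (1 + eta * ((u * x - s * y) / (u - s))
     + theta * ((y - x) / (u - s))
     + sigma * ((u * x - s * y) ^+ 2 / (u - s) ^+ 2)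
     + tau * ((y - x) ^+ 2 / (u - s) ^+ 2)
     - (1 - gamma) * (((y - x) * (u * x - s * y)) / (u - s) ^+ 2)).

Definition quadratic_harness (R : realType) d (Omega : measurableType d)
    (P : probability Omega R) (T : set R) (Z : R -> Omega -> R)
    (eta theta sigma tau gamma : R) : Prop :=
  let F_out s u := sigma_process [set r | T r /\ (r <= s \/ u <= r)] Z in
  let F_le s := sigma_process [set r | T r /\ r <= s] Z in
  let F_ge u := sigma_process [set r | T r /\ u <= r] Z in
  [/\ [/\ open T, is_interval T & T `<=` [set t | 0 < t]],
      process T Z /\
        (forall t, T t -> P.-integrable setT (EFin \o (fun w => Z t w ^+ 2))),
      (forall t, T t -> ('E_P[Z t])%E = 0%:E) /\
        (forall s t, T s -> T t ->
          ('E_P[(fun w => Z s w * Z t w)%R])%E = (Num.min s t)%:E),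
      (forall s t u, T s -> T t -> T u -> s < t -> t < u ->
        is_cond_exp P (F_out s u) (Z t)
          (fun w => (u - t) / (u - s) * Z s w + (t - s) / (u - s) * Z u w) /\
        is_cond_var P (F_out s u) (Z t)
          (fun w => harness_var eta theta sigma tau gamma s t u
                      (Z s w) (Z u w)))
    & (forall s t u, T s -> T t -> T u -> s <= t -> t <= u ->
        [/\ is_cond_exp P (F_ge u) (Z t) (fun w => t / u * Z u w),
            is_cond_exp P (F_le s) (Z t) (Z s),
            is_cond_var P (F_le s) (Z t)
              (fun w => (t - s) / (1 + sigma * s) *
                        (sigma * Z s w ^+ 2 + eta * Z s w + 1))
          & is_cond_var P (F_ge u) (Z t)
              (fun w => (t * (u - t)) / (u + tau) *
                 (tau * (Z u w ^+ 2 / u ^+ 2) + theta * (Z u w / u) + 1))]) ].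

Definition eta_par (R : realType) (N : nat) (A B C : R) : R :=
  - ((A * (B + C + N%:R) + C * (B + C) + N%:R * (N%:R - B)) /
     Num.sqrt (N%:R * (A + C) * (B + C) * (A - B + N%:R)
               * (N%:R - 1 - B - C))).

Definition theta_par (R : realType) (N : nat) (A B C : R) : R :=
  - ((A * (B + C + N%:R) - B * (B + C - N%:R) + 2 * C * N%:R) /
     Num.sqrt (N%:R * (A + C) * (B + C) * (A - B + N%:R)
               * (N%:R - 1 - B - C))).

Definition sigma_par (R : realType) (N : nat) (B C : R) : R :=
  (N%:R - 1 - B - C)^-1.

(* Main.v *)
(** The chains [zeta], [Theta] and [zeta'] form a single pure birth process [W] on
    [{0, ..., N}], going from 0 at time 0 to [N] at time infinity.  In homogeneous
    time coordinates the law of [Theta] and the forward, dual and Case 1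
    transition probabilities are all instances of one family, the bridge laws of
    [W_t] given [W_s = m] and [W_u = n].  Up to centring and scaling [Z_t] is
    [h_t(W_t)] with [h_t] quadratic, and weighting a bridge by [h_t(W_t) - h_t(m)]
    gives a multiple of a bridge started from [m + 1] at a shifted time.  By
    induction the bridge weights have total mass 1, which is the Chapman-Kolmogorov
    equation and identifies the law before time 1 with that of Case 1; used once
    and twice, the same identity gives the conditional mean and variance.  A
    pi-lambda argument passes from finitely many times to the sigma-algebras. *)

Require Import Defs.
From mathcomp Require Import all_boot all_order all_algebra.
From mathcomp Require Import all_classical all_reals all_analysis.
From mathcomp Require Import measurable_realfun.
From mathcomp Require Import ring lra zify.

Set Implicit Arguments.
Unset Strict Implicit.
Unset Printing Implicit Defensive.

Import Order.TTheory GRing.Theory Num.Theory.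
Import numFieldNormedType.Exports.

Local Open Scope classical_set_scope.
Local Open Scope ring_scope.

(** * Bridge weights *)

(** The obstacle is harness time 1, which lies at infinite chain time: the forward chains reach it
    from one side and the dual chains from the other, so formulas in affine time break there. In
    homogeneous coordinates a difference of times becomes a determinant and a Pochhammer symbol
    becomes a product with step [e], which at [e = 0] is simply a power, so the middle is an
    ordinary point. The price is the positivity of factors whose two times straddle the middle; this
    is where the bounds on the parameters enter. Finite-dimensional laws are written as products of
    unnormalised kernels divided by the single kernel that joins the two pinned ends: in this form
    the factors of successive conditionings telescope, and fixing the process on both sides of a
    time amounts to cancelling factors. *)

Section SteppedProducts.
Variable F : numFieldType.
Implicit Types (a h c : F) (n m : nat).

(** The Pochhammer symbol with step [h]. It is homogeneous of degree [n] in [(a, h)] and becomes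
    [a ^+ n] at step 0, so one formula covers finite and infinite times. *)
Definition sprod a h n : F := \prod_(i < n) (a + h * i%:R).

Lemma sprod0 a h : sprod a h 0 = 1.
Proof. by rewrite /sprod big_ord0. Qed.

Lemma sprodSl a h n : sprod a h n.+1 = a * sprod (a + h) h n.
Proof.
rewrite /sprod big_ord_recl mulr0 addr0; congr (_ * _).
by apply: eq_bigr => i _; rewrite /= /bump /= add1n -natr1; ring.
Qed.

Lemma sprodSr a h n : sprod a h n.+1 = sprod a h n * (a + h * n%:R).
Proof. by rewrite /sprod big_ord_recr. Qed.

Lemma sprodD a h m n : sprod a h (m + n) = sprod a h m * sprod (a + h * m%:R) h n.
Proof.
rewrite /sprod big_split_ord /=; congr (_ * _).
by apply: eq_bigr => i _; rewrite /= natrD; ring.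
Qed.

Lemma sprodZ c a h n : sprod (c * a) (c * h) n = c ^+ n * sprod a h n.
Proof.
elim: n => [|n IHn]; first by rewrite !sprod0 expr0 mulr1.
by rewrite !sprodSr IHn exprS; ring.
Qed.

Lemma sprod_step0 a n : sprod a 0 n = a ^+ n.
Proof. by rewrite /sprod (eq_bigr (fun=> a)) ?prodr_const ?card_ord // => i _; ring. Qed.

Lemma sprod_rev a h n : sprod a h n.+1 = sprod (a + h * n%:R) (- h) n.+1.
Proof.
rewrite /sprod (reindex_inj rev_ord_inj) /=; apply: eq_bigr => i _.
rewrite subSS natrB; first by ring.
by rewrite -ltnS.
Qed.

Lemma sprod_neq0 a h n :
  (forall i, (i < n)%N -> a + h * i%:R != 0) -> sprod a h n != 0.
Proof. by move=> H; apply/prodf_neq0 => i _; apply: H. Qed.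

Lemma sprod_gt0 a h n :
  (forall i, (i < n)%N -> 0 < a + h * i%:R) -> 0 < sprod a h n.
Proof. by move=> H; apply: prodr_gt0 => i _; apply: H. Qed.

End SteppedProducts.

Section BridgeWeights.
Variable F : numFieldType.
Implicit Types (p q r : F * F) (k l M : nat).

(* A point [p = (b, e)] is a time [b / e] in homogeneous coordinates, so that
   [e = 0] is the instant where the forward and the dual chains meet. *)
Definition pdet p q : F := q.1 * p.2 - p.1 * q.2.

Definition pshift (a : nat) p : F * F := (p.1 + p.2 * a%:R, p.2).

(* The conditional probability of being in state [l] at time [q], given state [0]
   at time [p] and state [l + k] at time [r]. *)
Definition bridge_weight l k p q r : F :=
  'C(l + k, l)%:R *
  (sprod (pdet p q) (p.2 * q.2) l * sprod (pdet q r) (q.2 * r.2) k /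
   sprod (pdet p r) (p.2 * r.2) (l + k)) *
  (sprod (p.1 + p.2 * l.+1%:R) p.2 k * sprod (r.1 + r.2 * (l + k)%:R) r.2 l /
   (sprod (q.1 + q.2 * l%:R) q.2 l * sprod (q.1 + q.2 * (l.*2.+1)%:R) q.2 k)).

(** Nonvanishing of the denominators. In the second clause the index 0 is missing because the
    product of length [l] is empty for [l = 0], and [M.*2] is missing because the index [l.*2] is
    always skipped. *)
Definition bridge_weight_ok M p q r :=
  (forall i, (i < M)%N -> pdet p r + p.2 * r.2 * i%:R != 0) /\
  (forall i, (0 < i < M.*2)%N -> q.1 + q.2 * i%:R != 0).

Lemma bridge_weight_okl M p q r : bridge_weight_ok M.+1 p q r ->
  bridge_weight_ok M (pshift 1 p) (pshift 2 q) (pshift 2 r).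
Proof.
move=> [h1 h2]; split=> i hi.
  have := h1 i.+1 hi; rewrite /pdet /= -natr1; congr (_ != 0); ring.
have := h2 i.+2; rewrite doubleS; move/(_ ltac:(lia)).
by rewrite /= -addn2 natrD; congr (_ != 0); ring.
Qed.

Lemma bridge_weight_okr M p q r : bridge_weight_ok M.+1 p q r -> bridge_weight_ok M p q
  (pshift 1 r).
Proof.
move=> [h1 h2]; split=> i hi.
  have := h1 i.+1 hi; rewrite /pdet /= -natr1; congr (_ != 0); ring.
by apply: h2; rewrite doubleS; lia.
Qed.

(* Weighting a bridge by [l (q.1 + q.2 l)] gives a multiple of the bridge that
   starts one state higher from a shifted time; [bridge_weight_recr] is the same at the
   other end.  Both the total mass and the moments follow by induction. *)
Lemma bridge_weight_recl l k p q r : bridge_weight_ok (l.+1 + k) p q r ->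
  bridge_weight l.+1 k p q r * (l.+1%:R * (q.1 + q.2 * l.+1%:R)) =
  (l.+1 + k)%:R * pdet p q * (r.1 + r.2 * (l.+1 + k)%:R) / pdet p r *
  bridge_weight l k (pshift 1 p) (pshift 2 q) (pshift 2 r).
Proof.
move=> ok; have [h1 h2] := ok.
have dpr0 : pdet p r != 0 by have := h1 0%N isT; rewrite mulr0 addr0.
have q0 : q.1 + q.2 * l.+1%:R != 0 by apply: h2; lia.
have [h3 h4] := bridge_weight_okl ok.
rewrite /bridge_weight addSn.
have -> : pdet (pshift 1 p) (pshift 2 q) = pdet p q + p.2 * q.2.
  by rewrite /pdet /=; ring.
have -> : pdet (pshift 1 p) (pshift 2 r) = pdet p r + p.2 * r.2.
  by rewrite /pdet /=; ring.
have -> : pdet (pshift 2 q) (pshift 2 r) = pdet q r by rewrite /pdet /=; ring.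
rewrite /= !(sprodSl _ _ l) (sprodSl _ _ (l + k)).
have -> : p.1 + p.2 * 1 + p.2 * l.+1%:R = p.1 + p.2 * l.+2%:R.
  by rewrite -(natr1 l.+1); ring.
have -> : r.1 + r.2 * 2 + r.2 * (l + k)%:R = r.1 + r.2 * (l + k).+1%:R + r.2.
  by rewrite -(natr1 (l + k)); ring.
have -> : q.1 + q.2 * 2 + q.2 * l%:R = q.1 + q.2 * l.+1%:R + q.2.
  by rewrite -(natr1 l); ring.
have -> : q.1 + q.2 * 2 + q.2 * (l.*2.+1)%:R = q.1 + q.2 * (l.+1.*2.+1)%:R.
  by rewrite doubleS -!natr1; ring.
have : sprod (pdet p r + p.2 * r.2) (p.2 * r.2) (l + k) != 0.
  apply: sprod_neq0 => i hi.
  have := h1 i.+1 hi; rewrite -natr1; congr (_ != 0); ring.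
have : sprod (q.1 + q.2 * l.+1%:R + q.2) q.2 l != 0.
  apply: sprod_neq0 => i hi; have := h2 (l.+1 + i.+1)%N.
  by move/(_ ltac:(lia)); rewrite natrD -natr1; congr (_ != 0); ring.
have : sprod (q.1 + q.2 * (l.+1.*2.+1)%:R) q.2 k != 0.
  apply: sprod_neq0 => i hi; have := h2 (l.+1.*2.+1 + i)%N.
  by move/(_ ltac:(lia)); rewrite natrD; congr (_ != 0); ring.
have := mul_bin_diag (l + k).+1 l; move/(congr1 (fun n => n%:R : F)).
rewrite !natrM.
set s1 := sprod _ _ _; set s2 := sprod _ _ _; set s3 := sprod _ _ _.
move=> hbin n1 n2 n3.
have -> : 'C((l + k).+1, l.+1)%:R = (l + k).+1%:R * 'C(l + k, l)%:R / l.+1%:R :> F.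
  by rewrite hbin mulrAC mulfV ?mul1r // pnatr_eq0.
have: l.+1%:R != 0 :> F by rewrite pnatr_eq0.
move: q0; move: (q.1 + q.2 * l.+1%:R) => Q q0.
move: (l.+1%:R : F) => L L0.
by field; rewrite n1 n2 n3 dpr0 q0 L0.
Qed.

Lemma bridge_weight_recr l k p q r : bridge_weight_ok (l + k.+1) p q r ->
  bridge_weight l k.+1 p q r * (k.+1%:R * (q.1 + q.2 * (l.*2 + k.+1)%:R)) =
  (l + k.+1)%:R * pdet q r * (p.1 + p.2 * (l + k.+1)%:R) / pdet p r *
  bridge_weight l k p q (pshift 1 r).
Proof.
rewrite addnS => ok; have [h1 h2] := ok.
have dpr0 : pdet p r != 0 by have := h1 0%N isT; rewrite mulr0 addr0.
have q0 : q.1 + q.2 * (l.*2 + k.+1)%:R != 0 by apply: h2; lia.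
rewrite /bridge_weight addnS.
have -> : pdet q (pshift 1 r) = pdet q r + q.2 * r.2 by rewrite /pdet /=; ring.
have -> : pdet p (pshift 1 r) = pdet p r + p.2 * r.2 by rewrite /pdet /=; ring.
rewrite /= (sprodSl (pdet q r)) (sprodSl _ _ (l + k)) !(sprodSr _ _ k).
have -> : p.1 + p.2 * l.+1%:R + p.2 * k%:R = p.1 + p.2 * (l + k).+1%:R.
  by rewrite -!natr1 natrD; ring.
have -> : r.1 + r.2 * 1 + r.2 * (l + k)%:R = r.1 + r.2 * (l + k).+1%:R.
  by rewrite -natr1; ring.
have -> : q.1 + q.2 * (l.*2.+1)%:R + q.2 * k%:R = q.1 + q.2 * (l.*2 + k.+1)%:R.
  by rewrite natrD -!natr1; ring.
have : sprod (pdet p r + p.2 * r.2) (p.2 * r.2) (l + k) != 0.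
  apply: sprod_neq0 => i hi.
  have := h1 i.+1 hi; rewrite -natr1; congr (_ != 0); ring.
have : sprod (q.1 + q.2 * l%:R) q.2 l != 0.
  apply: sprod_neq0 => i hi; have := h2 (l + i)%N.
  by move/(_ ltac:(lia)); rewrite natrD; congr (_ != 0); ring.
have : sprod (q.1 + q.2 * (l.*2.+1)%:R) q.2 k != 0.
  apply: sprod_neq0 => i hi; have := h2 (l.*2.+1 + i)%N.
  by move/(_ ltac:(lia)); rewrite natrD; congr (_ != 0); ring.
have : k.+1%:R * 'C((l + k).+1, l)%:R = (l + k).+1%:R * 'C(l + k, l)%:R :> F.
  rewrite -!natrM; congr _%:R.
  rewrite -[in LHS]bin_sub; last by lia.
  rewrite -(bin_sub (m := l)); last by lia.
  by rewrite subSn ?leq_addr// addKn mul_bin_diag.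
set s1 := sprod _ _ _; set s2 := sprod _ _ _; set s3 := sprod _ _ _.
move=> hbin n1 n2 n3.
have -> : 'C((l + k).+1, l)%:R = (l + k).+1%:R * 'C(l + k, l)%:R / k.+1%:R :> F.
  by rewrite -hbin mulrAC mulfV ?mul1r // pnatr_eq0.
have: k.+1%:R != 0 :> F by rewrite pnatr_eq0.
move: q0; move: (q.1 + q.2 * (l.*2 + k.+1)%:R) => Q q0.
move: (k.+1%:R : F) => L L0.
by field; rewrite n1 n2 n3 dpr0 q0 L0.
Qed.

(** In affine coordinates this is Dougall's terminating very-well-poised 5F4 summation. The
    induction multiplies the sum by a constant that splits into the two factors absorbed by the
    recurrences at the lower and upper ends. *)
Lemma bridge_weight_sum M p q r : bridge_weight_ok M p q r -> \sum_(l < M.+1) bridge_weight l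
  (M - l) p q r = 1.
Proof.
elim: M p q r => [|M IHM] p q r ok.
  by rewrite big_ord1 /bridge_weight /= !sprod0 !(mulr1, divr1).
have [h1 h2] := ok.
have dpr0 : pdet p r != 0 by have := h1 0%N isT; rewrite mulr0 addr0.
have q0 : q.1 + q.2 * M.+1%:R != 0 by apply: h2; lia.
set X := M.+1%:R * (q.1 + q.2 * M.+1%:R).
have X0 : X != 0 by rewrite mulf_neq0 // pnatr_eq0.
apply: (mulIf X0); rewrite mul1r mulr_suml.
(* With [k = M.+1 - l], the product of [l + k] and [q.1 + q.2 (l + k)] is [l (q.1 + q.2 l)] plus
   [k (q.1 + q.2 (2 l + k))], the factors of [bridge_weight_recl] and [bridge_weight_recr]. *)
rewrite (eq_bigr (fun l : 'I_M.+2 =>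
    bridge_weight l (M.+1 - l) p q r * (l%:R * (q.1 + q.2 * l%:R)) +
    bridge_weight l (M.+1 - l) p q r * ((M.+1 - l)%:R * (q.1 + q.2 * (l.*2 + (M.+1 - l))%:R))));
  last first.
  move=> l _; rewrite -mulrDr /X; congr (_ * _).
  have -> : M.+1%:R = l%:R + (M.+1 - l)%:R :> F.
    by rewrite -natrD subnKC // -ltnS.
  by rewrite -muln2 natrD natrM; ring.
rewrite big_split /= big_ord_recl mul0r mulr0 add0r.
rewrite [X in _ + X]big_ord_recr /= subnn mul0r mulr0 addr0.
rewrite (eq_bigr (fun l : 'I_M.+1 =>
  M.+1%:R * pdet p q * (r.1 + r.2 * M.+1%:R) / pdet p r *
  bridge_weight l (M - l) (pshift 1 p) (pshift 2 q) (pshift 2 r))); last first.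
  move=> l _; rewrite /bump /= add1n subSS.
  have e : (l.+1 + (M - l) = M.+1)%N by have := ltn_ord l; lia.
  by rewrite bridge_weight_recl e.
rewrite [X in _ + X](eq_bigr (fun l : 'I_M.+1 =>
  M.+1%:R * pdet q r * (p.1 + p.2 * M.+1%:R) / pdet p r *
  bridge_weight l (M - l) p q (pshift 1 r))); last first.
  move=> l _; have e : (l + (M - l).+1 = M.+1)%N by have := ltn_ord l; lia.
  rewrite subSn; last by have := ltn_ord l; lia.
  by rewrite bridge_weight_recr e.
rewrite -!mulr_sumr (IHM _ _ _ (bridge_weight_okl ok)) (IHM _ _ _ (bridge_weight_okr ok))
  !mulr1.
(* What remains is the linear relation between three vectors of the plane: [pdet p q] times [r] plus
   [pdet q r] times [p] is [pdet p r] times [q]. *)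
by move: dpr0; rewrite /X /pdet => ?; field.
Qed.

Lemma bridge_weight_moment1 M p q r : bridge_weight_ok M p q r ->
  \sum_(l < M.+1) bridge_weight l (M - l) p q r * (l%:R * (q.1 + q.2 * l%:R)) =
  M%:R * pdet p q * (r.1 + r.2 * M%:R) / pdet p r.
Proof.
case: M => [|M] ok; first by rewrite big_ord1 !mul0r mulr0.
rewrite big_ord_recl mul0r mulr0 add0r.
rewrite (eq_bigr (fun l : 'I_M.+1 =>
  M.+1%:R * pdet p q * (r.1 + r.2 * M.+1%:R) / pdet p r *
  bridge_weight l (M - l) (pshift 1 p) (pshift 2 q) (pshift 2 r))); last first.
  move=> l _; rewrite lift0 subSS.
  have e : (l.+1 + (M - l) = M.+1)%N by have := ltn_ord l; lia.
  by rewrite bridge_weight_recl e.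
by rewrite -mulr_sumr bridge_weight_sum ?mulr1 //; apply: bridge_weight_okl.
Qed.

(** The second factor is the quadratic [l (q.1 + q.2 l)] read after [l] drops by one and [q] is
    shifted by 2. The product is thus a second factorial moment on a quadratic lattice, and one
    recurrence reduces it to the first moment. *)
Lemma bridge_weight_moment2 M p q r : bridge_weight_ok M p q r ->
  \sum_(l < M.+1) bridge_weight l (M - l) p q r *
     (l%:R * (q.1 + q.2 * l%:R) * ((l%:R - 1) * (q.1 + q.2 * (l%:R + 1)))) =
  M%:R * pdet p q * (r.1 + r.2 * M%:R) / pdet p r *
  ((M%:R - 1) * (pdet p q + p.2 * q.2) * (r.1 + r.2 * (M%:R + 1)) /
   (pdet p r + p.2 * r.2)).
Proof.
case: M => [|M] ok; first by rewrite big_ord1 !(mul0r, mulr0).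
rewrite big_ord_recl !(mul0r, mulr0) add0r.
rewrite (eq_bigr (fun l : 'I_M.+1 =>
  M.+1%:R * pdet p q * (r.1 + r.2 * M.+1%:R) / pdet p r *
  (bridge_weight l (M - l) (pshift 1 p) (pshift 2 q) (pshift 2 r) *
   (l%:R * ((pshift 2 q).1 + (pshift 2 q).2 * l%:R))))); last first.
  move=> l _; rewrite lift0 subSS mulrA.
  have e : (l.+1 + (M - l) = M.+1)%N by have := ltn_ord l; lia.
  by rewrite bridge_weight_recl e // -[LHS]mulrA -natr1 /=; congr (_ * (_ * _)); ring.
rewrite -mulr_sumr bridge_weight_moment1; last exact: bridge_weight_okl.
congr (_ * (_ / _)).
  by rewrite /pdet /= -natr1; ring.
by rewrite /pdet /=; ring.
Qed.

End BridgeWeights.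

(** * The kernel underlying the bridges *)

Section Kernel.
Variable F : numFieldType.
Implicit Types (p q r : F * F) (k l m : nat).

(* An unnormalised kernel of which every bridge law is an h-transform. *)
Definition qker p m q j : F :=
  if (m <= j)%N then
    sprod (pdet p q) (p.2 * q.2) (j - m) / (j - m)`!%:R *
    (sprod (q.1 + q.2 * j%:R) q.2 m /
     (sprod (p.1 + p.2 * m%:R) p.2 m *
      sprod (p.1 + p.2 * (m.*2.+1)%:R) p.2 (j - m)))
  else 0.

(* Recentring at the initial state [m] amounts to adding [2 m e] to [b]. *)
Lemma qker_bridge_weight p q r m l k :
  (forall i, (i < l + k)%N -> pdet p r + p.2 * r.2 * i%:R != 0) ->
  (forall p', p' \in [:: p; q; r] ->
     forall i, (0 < i < (m + l + k).*2)%N -> p'.1 + p'.2 * i%:R != 0) ->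
  qker p m q (m + l) * qker q (m + l) r (m + l + k) / qker p m r (m + l + k) =
  bridge_weight l k (pshift m.*2 p) (pshift m.*2 q) (pshift m.*2 r).
Proof.
move=> h1 h2.
have sp0 p' s n : p' \in [:: p; q; r] -> (0 < n -> 0 < s /\ s + n <= (m + l + k).*2)%N ->
    sprod (p'.1 + p'.2 * s%:R) p'.2 n != 0.
  move=> hp hs; apply: sprod_neq0 => i hi; have := h2 p' hp (s + i)%N.
  by move/(_ ltac:(lia)); rewrite natrD; congr (_ != 0); ring.
rewrite /qker !leq_addr -addnA leq_addr !addKn addnA addKn /bridge_weight.
have pdS (p' q' : F * F) : pdet (pshift m.*2 p') (pshift m.*2 q') = pdet p' q'.
  by rewrite /pdet /=; ring.
rewrite !pdS /=.
have hl (p' : F * F) b : p'.1 + p'.2 * m.*2%:R + p'.2 * b%:R = p'.1 + p'.2 * (m.*2 + b)%:R.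
  by rewrite natrD; ring.
rewrite !hl.
(* Cutting the ranges of lengths [m + l] and [l + k] in two makes the parts below the recentred
   range cancel between the three kernels; the other parts are the products of [bridge_weight]. *)
have sD (p' : F * F) s n n' : sprod (p'.1 + p'.2 * s%:R) p'.2 (n + n') =
    sprod (p'.1 + p'.2 * s%:R) p'.2 n * sprod (p'.1 + p'.2 * (s + n)%:R) p'.2 n'.
  by rewrite sprodD natrD; congr (_ * sprod _ _ _); ring.
rewrite !sD.
have -> : (m + l + k + m = m.*2 + (l + k))%N by lia.
have -> : (m + l + m = m.*2 + l)%N by lia.
have -> : (m.*2.+1 + l = m.*2 + l.+1)%N by lia.
have -> : ((m + l).*2.+1 = m.*2 + l.*2.+1)%N by lia.
have pP : p \in [:: p; q; r] by rewrite !inE eqxx.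
have qP : q \in [:: p; q; r] by rewrite !inE eqxx orbT.
have rP : r \in [:: p; q; r] by rewrite !inE eqxx !orbT.
have := sp0 p m m pP ltac:(lia).
have := sp0 p m.*2.+1 l pP ltac:(lia).
have := sp0 p (m.*2 + l.+1)%N k pP ltac:(lia).
have := sp0 q (m + l)%N m qP ltac:(lia).
have := sp0 q (m.*2 + l)%N l qP ltac:(lia).
have := sp0 q (m.*2 + l.*2.+1)%N k qP ltac:(lia).
have := sp0 r (m + l + k)%N m rP ltac:(lia).
have : sprod (pdet p r) (p.2 * r.2) (l + k) != 0 by apply: sprod_neq0.
have := bin_fact (leq_addr k l); move/(congr1 (fun n => n%:R : F)).
rewrite addKn !natrM.
have : l`!%:R != 0 :> F by rewrite pnatr_eq0 -lt0n fact_gt0.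
have : k`!%:R != 0 :> F by rewrite pnatr_eq0 -lt0n fact_gt0.
have : (l + k)`!%:R != 0 :> F by rewrite pnatr_eq0 -lt0n fact_gt0.
move: (l`!%:R : F) (k`!%:R : F) ((l + k)`!%:R : F) ('C(l + k, l)%:R : F).
move=> fl fk flk bi flk0 fk0 fl0 hbi.
have -> : bi = flk / (fl * fk) by rewrite -hbi mulfK // mulf_neq0.
move=> n1 n2 n3 n4 n5 n6 n7 n8.
by field; rewrite n1 n2 n3 n4 n5 n6 n7 n8 flk0 fk0 fl0.
Qed.

Lemma pdet_shift a p q : pdet (pshift a p) (pshift a q) = pdet p q.
Proof. by rewrite /pdet /=; ring. Qed.

End Kernel.

(** * Positivity and moments of bridges on the compactified time line *)

Section Times.
Variables (F : realFieldType) (N : nat) (a c : F).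
Hypotheses (a_gt : -1 < a) (c_gt : N.*2%:R - 1 < c) (ac_gt : 1 < a + c).
Implicit Types (x y z : F) (m j n : nat).

(* [x = t / (1 + t)] compactifies the time [t] of the harness: [pt 0] and [pt 1]
   are its two ends and [pt (1 / 2)] is [t = 1]. *)
Definition pt x : F * F := ((1 - x) * a + x * c, 1 - x *+ 2).

(** In the coordinates of [pt x] this is [k] times [(pt x).1 + (pt x).2 k], the quadratic of the
    moment identities, minus [x] times [N (c - N)]. The subtracted term makes it vanish at both
    pinned ends: state 0 at [x = 0] and state [N] at [x = 1]. *)
Definition height x k : F := (1 - x) * (k%:R * (k%:R + a)) +
  x * (k%:R * (c - k%:R) - N%:R * (c - N%:R)).

Lemma pdet_pt x y : pdet (pt x) (pt y) = (a + c) * (y - x).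
Proof. by rewrite /pdet /=; ring. Qed.

(** A convex combination of [a + i] and [c - i], both positive in this range of [i] by the bounds on
    [a] and [c]. *)
Lemma pt_gt0 x i : 0 <= x <= 1 -> (0 < i < N.*2)%N ->
  0 < (pt x).1 + (pt x).2 * i%:R.
Proof.
move=> /andP[x0 x1] /andP[i0 iN]; rewrite /=.
have i1 : 1 <= i%:R :> F by rewrite ler1n.
have i2 : i%:R + 1 <= N.*2%:R :> F by rewrite natr1 ler_nat.
have -> : (1 - x) * a + x * c + (1 - x *+ 2) * i%:R =
  (1 - x) * (a + i%:R) + x * (c - i%:R) by ring.
have ha := a_gt; have hc := c_gt.
have h1 : 0 < a + i%:R by lra.
have h2 : 0 < c - i%:R by lra.
have [->|xn] := eqVneq x 0; first by rewrite mul0r addr0 subr0 mul1r.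
by apply: ltr_wpDl; [apply: mulr_ge0; lra | apply: mulr_gt0 => //; rewrite lt0r xn].
Qed.

(** The product [(pt x).2 * (pt y).2] is negative when the two times straddle the middle. Since
    [i < a + c], it suffices that [y - x + (1 - x *+ 2) * (1 - y *+ 2)] is nonnegative. *)
Lemma pdet_gt0 x y i : 0 <= x -> x < y -> y <= 1 -> (i < N)%N ->
  0 < pdet (pt x) (pt y) + (pt x).2 * (pt y).2 * i%:R.
Proof.
move=> x0 xy y1 iN; rewrite pdet_pt /=.
have iac : i%:R < a + c.
  have hac := ac_gt; have ha := a_gt.
  case: i iN => [|i] iN; first by lra.
  have : i.+1%:R + 1 <= N%:R :> F by rewrite natr1 ler_nat.
  have := c_gt; rewrite -muln2 natrM.
  have : (1 : F) <= i.+1%:R by rewrite ler1n.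
  by move: (i.+1%:R : F) => ii; lra.
have i0 : 0 <= i%:R :> F by rewrite ler0n.
have h : 0 <= y - x + (1 - x *+ 2) * (1 - y *+ 2).
  have x1 : 0 < 1 - x by lra.
  rewrite -(pmulr_rge0 _ x1).
  have -> : (1 - x) * (y - x + (1 - x *+ 2) * (1 - y *+ 2)) =
    (1 - y) * (1 - x *+ 2) ^+ 2 + (y - x) * x by ring.
  by apply: addr_ge0; apply: mulr_ge0; rewrite ?sqr_ge0//; lra.
have -> : (a + c) * (y - x) + (1 - x *+ 2) * (1 - y *+ 2) * i%:R =
  (a + c - i%:R) * (y - x) + i%:R * (y - x + (1 - x *+ 2) * (1 - y *+ 2)) by ring.
apply: ltr_wpDr; first exact: mulr_ge0.
by apply: mulr_gt0; lra.
Qed.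

Definition qk x m y j : F := qker (pt x) m (pt y) j.

Definition bridge x m y j z n : F := qk x m y j * qk y j z n / qk x m z n.

Lemma bridgeE x m y j z n : bridge x m y j z n = qk x m y j * qk y j z n / qk x m z n.
Proof. by []. Qed.

Lemma qk_gt0 x m y j : 0 <= x -> x < y -> y <= 1 -> (m <= j <= N)%N ->
  0 < qk x m y j.
Proof.
move=> x0 xy y1 /andP[mj jN].
have xP : 0 <= x <= 1 by lra.
have yP : 0 <= y <= 1 by lra.
have spos z s n : 0 <= z <= 1 -> (0 < n -> 0 < s /\ s + n <= N.*2)%N ->
    0 < sprod ((pt z).1 + (pt z).2 * s%:R) (pt z).2 n.
  move=> zP hs; apply: sprod_gt0 => i hi; have := @pt_gt0 z (s + i) zP.
  by move/(_ ltac:(lia)); rewrite natrD; congr (0 < _); ring.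
rewrite /qk /qker mj; apply: mulr_gt0; apply: divr_gt0.
- by apply: sprod_gt0 => i hi; apply: pdet_gt0 => //; lia.
- by rewrite ltr0n fact_gt0.
- by apply: spos => //; lia.
- by apply: mulr_gt0; apply: spos => //; lia.
Qed.

Lemma qk_lt0 x m y j : (j < m)%N -> qk x m y j = 0.
Proof. by move=> jm; rewrite /qk /qker leqNgt jm. Qed.

Lemma bridge_weightE x m y z l k : 0 <= x -> x < y -> y < z -> z <= 1 -> (m + l + k <= N)%N ->
  bridge x m y (m + l) z (m + l + k) =
  bridge_weight l k (pshift m.*2 (pt x)) (pshift m.*2 (pt y)) (pshift m.*2 (pt z)).
Proof.
move=> x0 xy yz z1 hN; rewrite /bridge /qk qker_bridge_weight // => [i hi|p].
  by rewrite gt_eqF // pdet_gt0 //; [lra | lia].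
rewrite !inE => /or3P[] /eqP -> i hi; rewrite gt_eqF // pt_gt0 //; try lra; lia.
Qed.

Lemma bridge_out x m y j z n : ~~ (m <= j <= n)%N -> bridge x m y j z n = 0.
Proof.
rewrite negb_and -!ltnNge => /orP[h|h].
  by rewrite /bridge qk_lt0 // !mul0r.
by rewrite /bridge (qk_lt0 _ _ h) mulr0 mul0r.
Qed.

Lemma bridge_weight_ok_pt x m y z k : 0 <= x -> x < y -> y < z -> z <= 1 -> (m + k <= N)%N ->
  bridge_weight_ok k (pshift m.*2 (pt x)) (pshift m.*2 (pt y)) (pshift m.*2 (pt z)).
Proof.
move=> x0 xy yz z1 hN; split=> i hi.
  have := @pdet_gt0 x z i x0 ltac:(lra) z1 ltac:(lia).
  by move/lt0r_neq0; congr (_ != 0); rewrite /pdet /=; ring.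
have := @pt_gt0 y (m.*2 + i) ltac:(lra) ltac:(lia).
by move/lt0r_neq0; congr (_ != 0); rewrite /= natrD; ring.
Qed.

(** Only the states from [m] to [n] are reachable for a pure birth path; the sum is restricted to
    them and recentred at [m], where the moment identities apply. *)
Lemma bridge_expect x m y z n (f : nat -> F) : 0 <= x -> x < y -> y < z -> z <= 1 ->
  (m <= n <= N)%N ->
  \sum_(j < N.+1) bridge x m y j z n * f j =
  \sum_(l < (n - m).+1)
    bridge_weight l (n - m - l) (pshift m.*2 (pt x)) (pshift m.*2 (pt y)) (pshift m.*2 (pt z)) *
    f (m + l)%N.
Proof.
move=> x0 xy yz z1 /andP[mn nN].
rewrite -(big_mkord xpredT (fun j => bridge x m y j z n * f j)).
rewrite (big_cat_nat (n := m)) //=; last by lia.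
rewrite big_nat_cond big1 ?add0r; last first.
  by move=> j hj; rewrite bridge_out ?mul0r //; lia.
rewrite (big_cat_nat (n := n.+1)) /=; [|lia|lia].
rewrite [X in _ + X]big_nat_cond [X in _ + X]big1 ?addr0; last first.
  by move=> j hj; rewrite bridge_out ?mul0r //; lia.
rewrite -{1}[m]add0n big_addn subSn // big_mkord; apply: eq_bigr => l _.
rewrite [(l + m)%N]addnC; congr (_ * _).
have hl : (m + l + (n - m - l) = n)%N by have := ltn_ord l; lia.
by have := @bridge_weightE x m y z l (n - m - l) x0 xy yz z1; rewrite hl; apply.
Qed.

Lemma bridge_sum x m y z n : 0 <= x -> x < y -> y < z -> z <= 1 -> (m <= n <= N)%N ->
  \sum_(j < N.+1) bridge x m y j z n = 1.
Proof.
move=> x0 xy yz z1 mnN.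
rewrite (eq_bigr (fun j : 'I_N.+1 => bridge x m y j z n * 1)); last by move=> j _;
  rewrite mulr1.
rewrite (@bridge_expect x m y z n (fun=> 1)) //.
rewrite (eq_bigr (fun l : 'I_(n - m).+1 => bridge_weight l (n - m - l) (pshift m.*2 (pt x))
  (pshift m.*2 (pt y)) (pshift m.*2 (pt z)))); last by move=> j _; rewrite mulr1.
by rewrite bridge_weight_sum //; apply: bridge_weight_ok_pt => //; lia.
Qed.

(** The division-free form of [bridge], which holds also for [n < m], where both sides vanish. It
    drives every telescoping argument below. *)
Lemma qk_bridgeE x m y j z n : 0 <= x -> x < y -> y < z -> z <= 1 -> (n <= N)%N ->
  qk x m y j * qk y j z n = qk x m z n * bridge x m y j z n.
Proof.
move=> x0 xy yz z1 nN; have [mn|nm] := leqP m n; last first.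
  rewrite (qk_lt0 _ _ nm) mul0r; have [mj|jm] := leqP m j.
    by rewrite (@qk_lt0 y) ?mulr0 //; lia.
  by rewrite qk_lt0 ?mul0r.
rewrite /bridge mulrCA mulfV ?mulr1 // lt0r_neq0 // qk_gt0 //; last by lia.
exact: lt_trans yz.
Qed.

Lemma qk_CK x m y z n : 0 <= x -> x < y -> y < z -> z <= 1 -> (n <= N)%N ->
  \sum_(j < N.+1) qk x m y j * qk y j z n = qk x m z n.
Proof.
move=> x0 xy yz z1 nN.
rewrite (eq_bigr (fun j : 'I_N.+1 => qk x m z n * bridge x m y j z n)); last first.
  by move=> j _; rewrite qk_bridgeE.
rewrite -mulr_sumr; have [mn|nm] := leqP m n; last by rewrite qk_lt0 // mul0r.
by rewrite bridge_sum ?mulr1 // mn.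
Qed.

(** Moving from state [m] to [m + l] raises the height by exactly [l (b + e l)], with [(b, e)] the
    coordinates of [pt y] recentred at [m], so the first moment gives the mean. *)
Lemma bridge_mean x m y z n : 0 <= x -> x < y -> y < z -> z <= 1 -> (m <= n <= N)%N ->
  \sum_(j < N.+1) bridge x m y j z n * height y j =
  ((z - y) * height x m + (y - x) * height z n) / (z - x).
Proof.
move=> x0 xy yz z1 mnN; have ok := @bridge_weight_ok_pt x m y z (n - m) x0 xy yz z1 ltac:(lia).
rewrite (@bridge_expect x m y z n (height y)) //.
rewrite (eq_bigr (fun l : 'I_(n - m).+1 => height y m *
  bridge_weight l (n - m - l) (pshift m.*2 (pt x)) (pshift m.*2 (pt y)) (pshift m.*2 (pt z)) +
  bridge_weight l (n - m - l) (pshift m.*2 (pt x)) (pshift m.*2 (pt y)) (pshift m.*2 (pt z)) *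
  (l%:R * ((pshift m.*2 (pt y)).1 + (pshift m.*2 (pt y)).2 * l%:R)))); last first.
  move=> l _; rewrite [height y m * _]mulrC -mulrDr; congr (_ * _).
  by rewrite /height /= -muln2 natrM !natrD; ring.
rewrite big_split /= -mulr_sumr bridge_weight_sum // bridge_weight_moment1 // !pdet_shift
  !pdet_pt /height /=.
have -> : n%:R = m%:R + (n - m)%:R :> F by rewrite -natrD subnKC //; lia.
rewrite -muln2 natrM.
move: (m%:R : F) ((n - m)%:R : F) => M L.
have zx : z - x != 0 by rewrite gt_eqF //; lra.
have ac : a + c != 0 by have hac := ac_gt; rewrite gt_eqF //; lra.
by field; rewrite zx ac.
Qed.

(** The factor that the second moment brings into the denominator. For [N = 1] the index 1 is
    outside the range of [pdet_gt0], so the bound [1 < a + c] is used directly. *)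
Lemma den_gt0 x z : 0 <= x -> x < z -> z <= 1 ->
  0 < (a + c) * (z - x) + (1 - x *+ 2) * (1 - z *+ 2).
Proof.
move=> x0 xz z1; have hac := ac_gt.
have x1 : 0 < 1 - x by lra.
rewrite -(pmulr_rgt0 _ x1).
have -> : (1 - x) * ((a + c) * (z - x) + (1 - x *+ 2) * (1 - z *+ 2)) =
  (1 - x) * (z - x) * (a + c - 1) + ((1 - z) * (1 - x *+ 2) ^+ 2 + (z - x) * x) by ring.
apply: ltr_wpDr.
  by apply: addr_ge0; apply: mulr_ge0; rewrite ?sqr_ge0//; lra.
by apply: mulr_gt0; [apply: mulr_gt0; lra | lra].
Qed.

(* [I] and [S] are the intercept at time 0 and the slope of the segment joining
   the two end values, in the projective time [x = t / (1 + t)]. *)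
Definition var_form (I S : F) : F :=
  N%:R * (N%:R + a) * (N%:R - c) * (N%:R - a - c)
  - ((N%:R - c) * (N%:R - a - c) + N%:R * (N%:R + a)) * I
  - (a * (N%:R - a - c) + N%:R * (N%:R *+ 2 - a - c *+ 2)) * S
  + (I + S) ^+ 2.

Lemma bridge_var x m y z n : 0 <= x -> x < y -> y < z -> z <= 1 -> (m <= n <= N)%N ->
  \sum_(j < N.+1) bridge x m y j z n *
     (height y j - ((z - y) * height x m + (y - x) * height z n) / (z - x)) ^+ 2 =
  (z - y) * (y - x) / ((a + c) * (z - x) + (1 - x *+ 2) * (1 - z *+ 2)) *
  var_form ((z * height x m - x * height z n) / (z - x))
           (((1 - x) * height z n - (1 - z) * height x m) / (z - x)).
Proof.
move=> x0 xy yz z1 mnN; have ok := @bridge_weight_ok_pt x m y z (n - m) x0 xy yz z1 ltac:(lia).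
set mu := ((z - y) * height x m + (y - x) * height z n) / (z - x).
rewrite (@bridge_expect x m y z n (fun j => (height y j - mu) ^+ 2)) //.
pose w l := bridge_weight l (n - m - l) (pshift m.*2 (pt x)) (pshift m.*2 (pt y)) (pshift
  m.*2 (pt z)).
pose b := (pshift m.*2 (pt y)).1; pose e := (pshift m.*2 (pt y)).2.
(* With [X = l (b + e l)], the factor [(l - 1) (b + e (l + 1))] equals [X - (b + e)]; hence the
   square of [X] is the second factorial term plus [b + e] times [X]. *)
rewrite (eq_bigr (fun l : 'I_(n - m).+1 => (height y m - mu) ^+ 2 * w l +
  ((b + e + (height y m - mu) *+ 2) * (w l * (l%:R * (b + e * l%:R))) +
   w l * (l%:R * (b + e * l%:R) * ((l%:R - 1) * (b + e * (l%:R + 1))))))); last first.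
  move=> l _; rewrite /b /e /w; move: (bridge_weight _ _ _ _ _) => W.
  by rewrite /height /= -muln2 natrM !natrD; ring.
rewrite !big_split /= -!mulr_sumr bridge_weight_sum // bridge_weight_moment1 //
  bridge_weight_moment2 //.
rewrite !pdet_shift !pdet_pt /mu /var_form /height /b /e /=.
have nE : n%:R = m%:R + (n - m)%:R :> F by rewrite -natrD subnKC //; lia.
rewrite nE -muln2 natrM.
have zx : z - x != 0 by rewrite gt_eqF //; lra.
have ac : a + c != 0 by have hac := ac_gt; rewrite gt_eqF //; lra.
have := lt0r_neq0 (den_gt0 x0 (lt_trans xy yz) z1).
move: (m%:R : F) ((n - m)%:R : F) (N%:R : F) => M L NN den.
field; do ![apply/andP; split] => //; last by move: den; congr (_ != 0); ring.
Qed.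

End Times.

(** * The weights of the paper as bridge weights *)

Section AffineWeights.
Variable F : numFieldType.
Implicit Types (e u b : F) (l k : nat).

Lemma sprodZ1 e u n : sprod (e * u) e n = e ^+ n * sprod u 1 n.
Proof. by rewrite -[in LHS](mulr1 e) -mulrA mul1r sprodZ. Qed.

Lemma sprod_refl u k : sprod (1 - u - k%:R) 1 k = (-1) ^+ k * sprod u 1 k.
Proof.
case: k => [|k]; first by rewrite !sprod0 expr0 mulr1.
rewrite [in LHS]sprod_rev -sprodZ; congr sprod; last by ring.
by rewrite -natr1; ring.
Qed.

Lemma sprodN_nat n k : sprod (- (k + n)%:R) 1 k * n`!%:R =
  (-1) ^+ k * (k + n)`!%:R :> F.
Proof.
elim: k => [|k IHk]; first by rewrite sprod0 expr0.
rewrite sprodSl addSn factS natrM exprS.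
have -> : - (k + n).+1%:R + 1 = - (k + n)%:R :> F by rewrite -natr1; ring.
rewrite -mulrA IHk; ring.
Qed.

(** By homogeneity the powers of the scales cancel: at finite times the weight depends on the affine
    times [u = b / e] only. *)
Lemma bridge_weight_affine e1 e2 e3 u1 u2 u3 l k : e1 != 0 -> e2 != 0 -> e3 != 0 ->
  bridge_weight l k (e1 * u1, e1) (e2 * u2, e2) (e3 * u3, e3) =
  'C(l + k, l)%:R *
  (sprod (u2 - u1) 1 l * sprod (u3 - u2) 1 k / sprod (u3 - u1) 1 (l + k)) *
  (sprod (u1 + l.+1%:R) 1 k * sprod (u3 + (l + k)%:R) 1 l /
   (sprod (u2 + l%:R) 1 l * sprod (u2 + (l.*2.+1)%:R) 1 k)).
Proof.
move=> e10 e20 e30; rewrite /bridge_weight /pdet /=.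
have h e u (n : nat) : e * u + e * n%:R = e * (u + n%:R) by ring.
have hd e u e' u' : e' * u' * e - e * u * e' = e * e' * (u' - u) by ring.
rewrite !h !hd !sprodZ1 !invfM !exprMn !exprD !invfM.
move: (sprod (u3 - u1) 1 (l + k))^-1 (sprod (u2 + l%:R) 1 l)^-1 => X Y.
move: (sprod (u2 + (l.*2.+1)%:R) 1 k)^-1 => Z.
have := expf_neq0 l e10; have := expf_neq0 k e10.
have := expf_neq0 l e20; have := expf_neq0 k e20.
have := expf_neq0 l e30; have := expf_neq0 k e30.
move: (e1 ^+ l) (e1 ^+ k) (e2 ^+ l) (e2 ^+ k) (e3 ^+ l) (e3 ^+ k).
move=> ? ? ? ? ? ? n1 n2 n3 n4 n5 n6.
by field; rewrite n1 n2 n3 n4 n5 n6.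
Qed.

(** With the end at infinite time, the products that involve it are powers of [b] and cancel. This
    is the shape of the forward weights. *)
Lemma bridge_weight_affine_right e1 e2 b u1 u2 l k : e1 != 0 -> e2 != 0 -> b != 0 ->
  bridge_weight l k (e1 * u1, e1) (e2 * u2, e2) (b, 0) =
  'C(l + k, l)%:R * (sprod (u1 + l.+1%:R) 1 k / sprod (u2 + (l.*2.+1)%:R) 1 k) *
  (sprod (u2 - u1) 1 l / sprod (u2 + l%:R) 1 l).
Proof.
move=> e10 e20 b0; rewrite /bridge_weight /pdet /= !mulr0 ?sub0r ?subr0.
have h e u (n : nat) : e * u + e * n%:R = e * (u + n%:R) by ring.
have hd e u e' u' : e' * u' * e - e * u * e' = e * e' * (u' - u) by ring.
rewrite !mul0r !addr0 !h !hd !sprodZ1 !sprod_step0 !invfM !exprMn !exprD !invfM.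
move: (sprod (u2 + l%:R) 1 l)^-1 (sprod (u2 + (l.*2.+1)%:R) 1 k)^-1 => Y Z.
have := expf_neq0 l e10; have := expf_neq0 k e10.
have := expf_neq0 l e20; have := expf_neq0 k e20.
have := expf_neq0 l b0; have := expf_neq0 k b0.
move: (e1 ^+ l) (e1 ^+ k) (e2 ^+ l) (e2 ^+ k) (b ^+ l) (b ^+ k).
move=> ? ? ? ? ? ? n1 n2 n3 n4 n5 n6.
by field; rewrite n1 n2 n3 n4 n5 n6.
Qed.

(** With the start at infinite time, the reflection [sprod_refl] turns the product in [u3 - u2] into
    the one with parameter [a - b] that [pi_weight] displays. *)
Lemma bridge_weight_affine_left e2 e3 b u2 u3 l k : e2 != 0 -> e3 != 0 -> b != 0 ->
  bridge_weight l k (b, 0) (e2 * u2, e2) (e3 * u3, e3) =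
  'C(l + k, l)%:R *
  (sprod (u2 - (u3 + (l + k)%:R) + l%:R + 1) 1 k / sprod (u2 + (l.*2.+1)%:R) 1 k) *
  (sprod (u3 + (l + k)%:R) 1 l / sprod (u2 + l%:R) 1 l).
Proof.
move=> e20 e30 b0; rewrite /bridge_weight /pdet /= !mulr0 ?sub0r ?subr0.
have -> : u2 - (u3 + (l + k)%:R) + l%:R + 1 = 1 - (u3 - u2) - k%:R.
  by rewrite natrD; ring.
have h e u (n : nat) : e * u + e * n%:R = e * (u + n%:R) by ring.
have hd e u e' u' : e' * u' * e - e * u * e' = e * e' * (u' - u) by ring.
rewrite sprod_refl !mul0r !addr0 !h !hd !sprodZ1 !sprod_step0 !invfM -!mulNr.
rewrite !exprMn !exprD !invfM.
move: (sprod (u2 + l%:R) 1 l)^-1 (sprod (u2 + (l.*2.+1)%:R) 1 k)^-1 => Y Z.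
have s1 : (-1) ^+ k * (-1) ^+ k = 1 :> F by rewrite -expr2 sqrr_sign.
have := expf_neq0 l e20; have := expf_neq0 k e20.
have := expf_neq0 l e30; have := expf_neq0 k e30.
have b0' : - b != 0 by rewrite oppr_eq0.
have -> : b ^+ k = (-1) ^+ k * (- b) ^+ k by rewrite -exprMn mulN1r opprK.
have := expf_neq0 l b0'; have := expf_neq0 k b0'.
move: (e2 ^+ l) (e2 ^+ k) (e3 ^+ l) (e3 ^+ k) ((- b) ^+ l) ((- b) ^+ k).
move=> ? ? ? ? ? ? n1 n2 n3 n4 n5 n6.
by field; rewrite n1 n2 n3 n4 n5 n6.
Qed.

(** With the middle time infinite, the weight is a summand of the Chu-Vandermonde identity. The
    scales 1 and -1 are those of [pt 0] and [pt 1]. *)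
Lemma bridge_weight_affine_mid a c b l k : b != 0 -> sprod (a + 1) 1 l != 0 ->
  bridge_weight l k (a, 1) (b, 0) (c, -1) =
  (sprod (a + 1) 1 (l + k) * sprod ((l + k)%:R - c) 1 l * sprod (- (l + k)%:R) 1 l) /
  (sprod (a + c + 1 - (l + k)%:R) 1 (l + k) * l`!%:R * sprod (a + 1) 1 l).
Proof.
move=> b0 nz; rewrite /bridge_weight /pdet /= !mul0r !mulr0 !mul1r.
have -> : c * 1 - a * -1 = - 1 * (- (a + c)) by ring.
have -> : 0 - b * -1 = b by ring.
have -> : b * 1 - 0 = b by ring.
have -> : c + - 1 * (l + k)%:R = - 1 * ((l + k)%:R - c) by ring.
rewrite !addr0 !sprodZ1 !sprod_step0 exprD invfM.
have -> : a + c + 1 - (l + k)%:R = 1 - (- (a + c)) - (l + k)%:R by ring.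
rewrite sprod_refl [sprod (a + 1) 1 (l + k)]sprodD.
have -> : a + 1 + 1 * l%:R = a + l.+1%:R by rewrite -natr1; ring.
have f0 n : n`!%:R != 0 :> F by rewrite pnatr_eq0 -lt0n fact_gt0.
have -> : sprod (- (l + k)%:R) 1 l = (-1) ^+ l * 'C(l + k, l)%:R * l`!%:R :> F.
  apply: (mulIf (f0 k)); rewrite sprodN_nat -!mulrA -natrM -[in RHS]natrM.
  by have := bin_fact (leq_addr k l); rewrite addKn => ->.
have := expf_neq0 l b0; have := expf_neq0 k b0.
have := f0 l; have := signr_eq0 F l; have := signr_eq0 F k.
rewrite !exprD !invfM !invr_sign; move: (sprod (- (a + c)) _ _)^-1 => X.
move: (b ^+ l) (b ^+ k) ((-1) ^+ l) ((-1) ^+ k) => bl bk sl sk _ _ n1 n2 n3.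
by field; rewrite n1 n2 n3 nz.
Qed.

(** The very-well-poised factor [(u)_l (u/2 + 1)_l / (u/2)_l] after cancelling the common factor, so
    that it is defined at [u = 0] as well. *)
Definition wpfac u l : F :=
  if l is l'.+1 then 2 * sprod (u + 1) 1 l' * (u / 2 + l%:R) else 1.

(** The two products on the right run through the indices from [l] to [2 l + k] except [2 l]; the
    skipped factor [u + 2 l] is the one supplied by [wpfac]. *)
Lemma wpfacE u l k : (forall i, (0 < i <= (l + k).*2)%N -> u + i%:R != 0) ->
  wpfac u l / (sprod (u + 1) 1 (l + k) * sprod (u + (l + k)%:R + 1) 1 l) =
  (sprod (u + l%:R) 1 l * sprod (u + (l.*2.+1)%:R) 1 k)^-1.
Proof.
move=> h2.
have s2 s n : (0 < n -> 0 < s /\ s + n <= (l + k).*2)%N -> sprod (u + s%:R) 1 n != 0.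
  move=> hs; apply: sprod_neq0 => i hi; have := h2 (s + i)%N ltac:(lia).
  by rewrite natrD mul1r addrA.
have -> : sprod (u + 1) 1 (l + k) * sprod (u + (l + k)%:R + 1) 1 l =
    sprod (u + 1) 1 (l + (l + k)).
  by rewrite [in RHS]addnC [in RHS]sprodD; congr (_ * sprod _ _ _); ring.
case: l h2 s2 => [|l] h2 s2; first by rewrite !sprod0 !add0n !mul1r.
have -> : (l.+1 + (l.+1 + k) = l + (l.+1 + (1 + k)))%N by lia.
rewrite sprodD [sprod _ _ (l.+1 + (1 + k))]sprodD [sprod _ _ (1 + k)]sprodD.
have -> : u + 1 + 1 * l%:R = u + l.+1%:R by rewrite -natr1; ring.
have -> : u + l.+1%:R + 1 * l.+1%:R = u + l.+1.*2%:R.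
  by rewrite -addnn natrD; ring.
have -> : u + l.+1.*2%:R + 1 * 1 = u + (l.+1.*2.+1)%:R by rewrite -!natr1; ring.
have m1 : sprod (u + 1) 1 l != 0 by apply: (s2 1%N); lia.
rewrite [sprod _ _ 1]sprodSr sprod0 mul1r mulr0 addr0 /wpfac.
have := h2 l.+1.*2 ltac:(lia) => m2.
have -> : u / 2 + l.+1%:R = (u + l.+1.*2%:R) / 2.
  by rewrite -addnn natrD; field.
move: m1 m2; move: (u + l.+1.*2%:R) (sprod (u + l.+1%:R) 1 l.+1) => v X m1 m2.
move: (sprod (u + l.+1.*2.+1%:R) 1 k) (sprod (u + 1) 1 l) m1 => Y Z m1.
rewrite !invfM; move: X^-1 Y^-1 => X' Y'.
by field; rewrite m1 m2.
Qed.

(** Each product of length [k] is rewritten as a quotient of products of lengths [M] and [l]. The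
    part depending on [M] alone then separates as the normalising constant, and the rest is the
    very-well-poised summand. *)
Lemma bridge_weight_affine_wellpoised u1 u2 u3 l k (M := (l + k)%N) :
  (forall i, (0 < i <= M.*2)%N -> u2 + i%:R != 0) ->
  sprod (u1 + 1) 1 l != 0 ->
  (forall i, (i < M)%N -> u3 - u2 + i%:R != 0) ->
  'C(l + k, l)%:R *
  (sprod (u2 - u1) 1 l * sprod (u3 - u2) 1 k / sprod (u3 - u1) 1 (l + k)) *
  (sprod (u1 + l.+1%:R) 1 k * sprod (u3 + (l + k)%:R) 1 l /
   (sprod (u2 + l%:R) 1 l * sprod (u2 + (l.*2.+1)%:R) 1 k)) =
  (sprod (u1 + 1) 1 M * sprod (1 - (u3 - u2) - M%:R) 1 M) /
  (sprod (u2 + 1) 1 M * sprod (1 - (u3 - u1) - M%:R) 1 M) *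
  ((wpfac u2 l * sprod (u2 - u1) 1 l * sprod (u3 + M%:R) 1 l * sprod (- M%:R) 1 l) /
   (l`!%:R * sprod (u1 + 1) 1 l * sprod (1 - (u3 - u2) - M%:R) 1 l *
    sprod (u2 + M%:R + 1) 1 l)).
Proof.
move=> h2 n1 h3.
have f0 n : n`!%:R != 0 :> F by rewrite pnatr_eq0 -lt0n fact_gt0.
have fl0 := f0 l.
have -> : sprod (- M%:R) 1 l = (-1) ^+ l * 'C(l + k, l)%:R * l`!%:R :> F.
  apply: (mulIf (f0 k)); rewrite sprodN_nat -!mulrA -natrM -[in RHS]natrM.
  by have := bin_fact (leq_addr k l); rewrite addKn => ->.
have s2 s n : (0 < n -> 0 < s /\ s + n <= M.*2.+1)%N -> sprod (u2 + s%:R) 1 n != 0.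
  move=> hs; apply: sprod_neq0 => i hi; have := h2 (s + i)%N ltac:(lia).
  by rewrite natrD mul1r addrA.
have hM : M = (l + k)%N by [].
have -> : sprod (u1 + 1) 1 M = sprod (u1 + 1) 1 l * sprod (u1 + l.+1%:R) 1 k.
  by rewrite hM sprodD -natr1; congr (_ * sprod _ _ _); ring.
have -> : sprod (1 - (u3 - u1) - M%:R) 1 M = (-1) ^+ M * sprod (u3 - u1) 1 M.
  by rewrite sprod_refl.
have -> : sprod (1 - (u3 - u2) - M%:R) 1 M =
  sprod (1 - (u3 - u2) - M%:R) 1 l * ((-1) ^+ k * sprod (u3 - u2) 1 k).
  by rewrite hM sprodD -sprod_refl natrD; congr (_ * sprod _ _ _); ring.
have n2 : sprod (1 - (u3 - u2) - M%:R) 1 l != 0.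
  apply: sprod_neq0 => i hi; have := h3 (M - i.+1)%N ltac:(lia).
  rewrite natrB; last by lia.
  by rewrite -oppr_eq0 -natr1; congr (_ != 0); ring.
have hrho := wpfacE h2; rewrite -/M in hrho.
have := s2 1%N M ltac:(lia); have := s2 M.+1 l ltac:(lia).
rewrite -natr1 addrA => m1 m2.
rewrite -hrho exprD !invfM !invr_sign.
move: (sprod (u3 - u1) 1 (l + k))^-1 => Y.
have := signr_eq0 F l; have := signr_eq0 F k.
have : (-1) ^+ k * (-1) ^+ k = 1 :> F by rewrite -expr2 sqrr_sign.
have : (-1) ^+ l * (-1) ^+ l = 1 :> F by rewrite -expr2 sqrr_sign.
move: ((-1) ^+ l) ((-1) ^+ k) => sl sk el ek _ _.
field: el ek.
by rewrite n1 n2 m1 m2 fl0.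
Qed.

End AffineWeights.

(** * The transition weights and the law of [Theta] as bridges *)

Section Matching.
Variables (R : realType) (N : nat) (A B C : R).
Hypotheses (hB2 : B < A + 1) (hC : C < - A - N%:R + 1) 
  (hv : 0 < N%:R - 1 - B - C).

Local Notation a := (A - B).
Local Notation c := (N%:R - C - A).
Local Notation pt := (pt a c).
Local Notation bridge := (bridge a c).

Lemma par_a : -1 < a. Proof. by have h := hB2; lra. Qed.
Lemma par_c : N.*2%:R - 1 < c.
Proof. by have h := hC; rewrite -muln2 natrM; lra. Qed.
Lemma par_ac : 1 < a + c. Proof. by have h := hv; lra. Qed.

Lemma poch_sprod (u : R) k : poch u k = sprod u 1 k.
Proof. by rewrite /poch /sprod; apply: eq_bigr => i _; rewrite mul1r. Qed.

(* The time of the chains as a function of [x = t / (1 + t)]. *)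
Definition psi (x : R) : R := (pt x).1 / (pt x).2 - 2 * A.

Lemma pt_psi x m : (pt x).2 != 0 ->
  pshift m.*2 (pt x) = ((pt x).2 * (psi x + 2 * A + 2 * m%:R), (pt x).2).
Proof.
move=> e0; rewrite /psi /pshift -muln2 natrM; congr (_, _).
by move: (pt x).1 (pt x).2 e0 => b e e0; field.
Qed.

Lemma pt_half m : pshift m.*2 (pt 2^-1) = ((a + c) / 2, 0).
Proof. by rewrite /pshift /=; congr (_, _); field. Qed.

Lemma pt2_neq0 x : x != 2^-1 -> (pt x).2 != 0.
Proof. by apply: contra_neq => /= h; lra. Qed.

Lemma psi0 : psi 0 = - A - B.
Proof. by rewrite /psi /=; field. Qed.

Lemma psi1 : psi 1 = - (A + N%:R - C).
Proof. rewrite /psi /=; have -> : 1 - 1 *+ 2 = -1 :> R by ring.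
by rewrite invrN1; ring. Qed.

(** The pin [2^-1] is the infinite time, so the affine form with infinite end applies; the parameter
    [2 * A + 2 * m%:R + t] of [pi_weight] is the time of [y] recentred at [m]. *)
Lemma xi_trans_bridge K x y m j : 0 <= x -> x < y -> y < 2^-1 -> (m <= K)%N ->
  (j <= K <= N)%N -> xi_trans A K (psi x) (psi y) m j = bridge x m y j 2^-1 K.
Proof.
move=> x0 xy y1 mK /andP[jK KN]; rewrite /xi_trans; case: leqP => mj; last first.
  by rewrite bridge_out // negb_and -ltnNge mj.
have [hm hj] : (m + (j - m) = j)%N /\ (m + (j - m) + (K - j) = K)%N by clear -mj jK; lia.
have := @bridge_weightE _ N a c par_a par_c par_ac x m y 2^-1 (j - m) (K - j) x0 xy y1.
rewrite hj hm => -> //; last by lra.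
have ex : (pt x).2 != 0 by apply: pt2_neq0; rewrite lt_eqF //; lra.
have ey : (pt y).2 != 0 by apply: pt2_neq0; rewrite lt_eqF //; lra.
have er : (a + c) / 2 != 0 by rewrite mulf_neq0 ?gt_eqF //; have := par_ac; lra.
rewrite pt_half (pt_psi _ ex) (pt_psi _ ey) bridge_weight_affine_right //.
rewrite /pi_weight !poch_sprod.
have -> : (K - m - (j - m) = K - j)%N by clear -mj jK; lia.
have -> : (j - m + (K - j) = K - m)%N by clear -mj jK; lia.
rewrite -!natr1 -muln2 natrM.
by congr (_ * (sprod _ _ _ / sprod _ _ _) * (sprod _ _ _ / sprod _ _ _)); ring.
Qed.

(** Dual time is [- psi], so a dual step leads from [i] at [z] down to [j] at the smaller [y]: it is
    a bridge read from its right end, with the left end held in state [K] at the middle time. *)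
Lemma xi_dual_trans_bridge K z y i j : 2^-1 < y -> y < z -> z <= 1 ->
  (K <= j)%N -> (K <= i <= N)%N ->
  xi_dual_trans A K (- psi z) (- psi y) i j = bridge 2^-1 K y j z i.
Proof.
move=> y0 yz z1 Kj /andP[Ki iN]; rewrite /xi_dual_trans; case: leqP => ji; last first.
  by rewrite bridge_out // negb_and -!ltnNge ji orbT.
have [hm hj] : (K + (j - K) = j)%N /\ (K + (j - K) + (i - j) = i)%N by clear -Kj ji; lia.
have h0 : 0 <= 2^-1 :> R by lra.
have := @bridge_weightE _ N a c par_a par_c par_ac 2^-1 K y z (j - K) (i - j) h0 y0 yz z1.
rewrite hj hm => -> //.
have ey : (pt y).2 != 0 by apply: pt2_neq0; rewrite gt_eqF //; lra.
have ez : (pt z).2 != 0 by apply: pt2_neq0; rewrite gt_eqF //; lra.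
have er : (a + c) / 2 != 0 by rewrite mulf_neq0 ?gt_eqF //; have := par_ac; lra.
rewrite pt_half (pt_psi _ ey) (pt_psi _ ez) bridge_weight_affine_left //.
rewrite /pi_weight !poch_sprod.
have -> : (i - K - (j - K) = i - j)%N by clear -Kj ji; lia.
have -> : (j - K + (i - j) = i - K)%N by clear -Kj ji; lia.
rewrite -!natr1 -muln2 natrM (natrB _ Ki).
by congr (_ * (sprod _ _ _ / sprod _ _ _) * (sprod _ _ _ / sprod _ _ _)); ring.
Qed.

Lemma Pi_law_bridge k : (k <= N)%N -> Pi_law N (A + C) (a + 1) k = bridge 0 0 2^-1 k 1 N.
Proof.
move=> kN; have hk : (0 + k + (N - k) = N)%N by lia.
have := @bridge_weightE _ N a c par_a par_c par_ac 0 0 2^-1 1 k (N - k).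
rewrite hk add0n => -> //; try lra.
rewrite pt_half /pshift /=.
have -> : ((1 - 0) * a + 0 * c + (1 - 0 *+ 2) * 0, 1 - 0 *+ 2) = (a, 1) :> R * R.
  by congr (_, _); ring.
have -> : ((1 - 1) * a + 1 * c + (1 - 1 *+ 2) * 0, 1 - 1 *+ 2) = (c, -1) :> R * R.
  by congr (_, _); ring.
rewrite bridge_weight_affine_mid.
- rewrite /Pi_law !poch_sprod subnKC //.
  by congr (_ * sprod _ _ _ * _ / (sprod _ _ _ * _ * _)); ring.
- by rewrite mulf_neq0 ?gt_eqF //; have := par_ac; lra.
- apply: sprod_neq0 => i hi; rewrite gt_eqF //.
  by have h1 := par_a; have : 0 <= i%:R :> R by []; lra.
Qed.

(** Case 1 is pinned at [x = 1] in state [N]. With [y < 2^-1] all three times are finite, so the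
    well-poised form applies. *)
Lemma case1_bridge x y m l k (u1 := psi x + 2 * A + 2 * m%:R)
    (u2 := psi y + 2 * A + 2 * m%:R) :
  0 <= x -> x < y -> y < 2^-1 -> (m + l + k = N)%N ->
  case1_weight l (l + k) (u2 / 2) (u2 / 2 - u1) (A + C + m%:R - u2 / 2) =
  bridge x m y (m + l) 1 N.
Proof.
move=> x0 xy y1 hN.
have ex : (pt x).2 != 0 by apply: pt2_neq0; rewrite lt_eqF //; lra.
have ey : (pt y).2 != 0 by apply: pt2_neq0; rewrite lt_eqF //; lra.
have ey0 : 0 < (pt y).2 by rewrite /=; lra.
have ex0 : 0 < (pt x).2 by rewrite /=; lra.
have e1 : -1 != 0 :> R by rewrite oppr_eq0 oner_eq0.
pose u3 := - c + 2 * m%:R.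
have := @bridge_weightE _ N a c par_a par_c par_ac x m y 1 l k x0 xy.
rewrite hN => -> //; last by lra.
have -> : pshift m.*2 (pt 1) = (-1 * u3, -1).
  rewrite /pshift /u3 -muln2 natrM /=; congr (_, _); ring.
rewrite (pt_psi _ ex) (pt_psi _ ey) bridge_weight_affine // -/u1 -/u2.
have hu x' i (u := psi x' + 2 * A + 2 * m%:R) : (pt x').2 != 0 ->
    (pt x').2 * (u + i%:R) = (pt x').1 + (pt x').2 * (m.*2 + i)%:R.
  by move=> h; rewrite /u /psi natrD -muln2 natrM; move: (pt x').1 (pt x').2 h => ? ? ?; field.
have hu2 i : (0 < i <= (l + k).*2)%N -> u2 + i%:R != 0.
  move=> /andP[i0 ik]; rewrite -(mulrI_eq0 _ (lregP ey)) /u2 hu //.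
  have [iN|Ni] := ltnP (m.*2 + i) N.*2.
    by rewrite gt_eqF // (@pt_gt0 _ N _ _ par_a par_c) //; [lra|clear -i0 iN; lia].
  (* The well-poised factor involves one index beyond the range of [pt_gt0]. It is still positive:
     [a + 2 N > 1] and [c - 2 N > -1], and [1 - y] outweighs [y]. *)
  have -> : (m.*2 + i = N.*2)%N by clear -ik Ni hN; lia.
  rewrite gt_eqF //=.
  have -> : (1 - y) * a + y * c + (1 - y *+ 2) * N.*2%:R =
    (1 - y) * (a + N.*2%:R) + y * (c - N.*2%:R) by ring.
  have ha := par_a; have hc := par_c.
  have hN2 : 2 <= N.*2%:R :> R by rewrite ler_nat; clear -i0 ik hN; lia.
  have h1 : (1 - y) * 1 < (1 - y) * (a + N.*2%:R) by rewrite ltr_pM2l; lra.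
  have h2 : y * (-1) <= y * (c - N.*2%:R) by apply: ler_wpM2l; lra.
  by lra.
have hu1 : sprod (u1 + 1) 1 l != 0.
  apply: sprod_neq0 => i hi; rewrite mul1r -addrA [1 + _]addrC natr1.
  rewrite -(mulrI_eq0 _ (lregP ex)) /u1 hu // gt_eqF // (@pt_gt0 _ N _ _ par_a par_c) //;
    first by lra.
  by clear -hi hN; lia.
have hu3 i : (i < l + k)%N -> u3 - u2 + i%:R != 0.
  move=> hi; have /lt0r_neq0 := @pdet_gt0 _ N a c par_a par_c par_ac y 1 i
    ltac:(lra) ltac:(lra) ltac:(lra) ltac:(clear -hi hN; lia).
  apply: contra_neq => h.
  have := hu y 0%N ey; rewrite addr0 -/u2.
  have -> : u2 = u3 + i%:R by lra.
  rewrite /pdet /u3 addn0 -muln2 natrM /= => h'.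
  by lra.
rewrite bridge_weight_affine_wellpoised // /case1_weight /case1_const !poch_sprod.
have -> : poch_ratio (u2 / 2) l = wpfac u2 l.
  case: (l) => [//|l']; rewrite /= poch_sprod.
  by congr (_ * sprod _ _ _ * _); field.
have hM : (l + k)%:R = N%:R - m%:R :> R by rewrite -hN -addnA natrD; ring.
congr ((sprod _ _ _ * sprod _ _ _) / (sprod _ _ _ * sprod _ _ _) *
  (_ * sprod _ _ _ * sprod _ _ _ * _ / (_ * sprod _ _ _ * sprod _ _ _ * sprod _ _ _)));
  by rewrite ?hM /u3; field.
Qed.

Lemma case1_marginal_bridge y j : 0 < y -> y < 2^-1 -> (j <= N)%N ->
  case1_marginal N A B C (psi y) j = bridge 0 0 y j 1 N.
Proof.
move=> y0 y1 jN; rewrite -(@case1_bridge 0 y 0 j (N - j)) ?subnKC //.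
by rewrite /case1_marginal psi0; congr case1_weight; field.
Qed.

Lemma case1_trans_bridge x y m j : 0 <= x -> x < y -> y < 2^-1 -> (m <= N)%N -> (j <= N)%N ->
  case1_trans N A C (psi x) (psi y) m j = bridge x m y j 1 N.
Proof.
move=> x0 xy y1 mN jN; rewrite /case1_trans; case: leqP => mj; last first.
  by rewrite bridge_out // negb_and -ltnNge mj.
have := @case1_bridge x y m (j - m) (N - j) x0 xy y1.
rewrite subnKC // => <-; last by lia.
have -> : (j - m + (N - j) = N - m)%N by lia.
by congr case1_weight; field.
Qed.

End Matching.

(** * Finite-dimensional distributions *)

Section Prob.
Context (R : realType) d (Omega : measurableType d) (P : probability Omega R).
Implicit Types (E F H : set Omega).

Lemma probE E : measurable E -> P E = (prob P E)%:E.
Proof. by move=> mE; rewrite /prob fineK // fin_num_measure. Qed.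

Lemma prob_ge0 E : 0 <= prob P E.
Proof. exact: fine_ge0. Qed.

Lemma prob_le E F : measurable E -> measurable F -> E `<=` F -> prob P E <= prob P F.
Proof.
by move=> mE mF EF; rewrite -lee_fin -!probE //; apply: le_measure; rewrite ?inE.
Qed.

Lemma prob_set0 : prob P set0 = 0.
Proof. by rewrite /prob measure0. Qed.

Lemma prob_setT : prob P setT = 1.
Proof. by rewrite /prob probability_setT. Qed.

Lemma prob_setU E F : measurable E -> measurable F -> E `&` F = set0 ->
  prob P (E `|` F) = prob P E + prob P F.
Proof.
move=> mE mF EF; apply: EFin_inj; rewrite EFinD -!probE //; last exact: measurableU.
by rewrite measureU.
Qed.

Lemma prob_setC E : measurable E -> prob P (~` E) = 1 - prob P E.
Proof.
move=> mE; rewrite -prob_setT -(setUCr E) prob_setU ?setICr //; last exact: measurableC.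
by ring.
Qed.

Lemma prob_sub0 E F : measurable E -> measurable F -> E `<=` F -> prob P F = 0 ->
  prob P E = 0.
Proof.
move=> mE mF EF F0; apply/eqP; rewrite eq_le prob_ge0 andbT -F0.
exact: prob_le.
Qed.

Lemma prob_setI_null E F : measurable E -> measurable F -> prob P (~` F) = 0 ->
  prob P (E `&` F) = prob P E.
Proof.
move=> mE mF F0.
have mC : measurable (~` F) by exact: measurableC.
have -> : prob P E = prob P ((E `&` F) `|` (E `&` ~` F)).
  by rewrite -setIUr setUCr setIT.
rewrite prob_setU; [|exact: measurableI|exact: measurableI|].
  have mI : measurable (E `&` ~` F) by exact: measurableI.
  by rewrite (prob_sub0 mI mC _ F0) ?addr0.
by rewrite setIACA setICr setI0.
Qed.

Lemma measurable_preimage_nat (f : Omega -> nat) (S : set nat) :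
  measurable_fun setT f -> measurable (f @^-1` S).
Proof. by move=> mf; rewrite -[X in measurable X]setTI; apply: mf. Qed.

Lemma prob_sum_lt (f : Omega -> nat) n E : measurable_fun setT f -> measurable E ->
  prob P (E `&` f @^-1` [set j | (j < n)%N]) =
  \sum_(k < n) prob P (E `&` f @^-1` [set (k : nat)]).
Proof.
move=> mf mE.
have mp S := @measurable_preimage_nat f S mf.
elim: n => [|n IHn].
  rewrite big_ord0 (_ : _ `&` _ = set0) ?prob_set0 //.
  by rewrite -subset0 => w [].
rewrite big_ord_recr /= -IHn -prob_setU.
- congr prob; apply/seteqP; split=> w /=.
    move=> [Ew]; rewrite ltnS leq_eqVlt => /orP[/eqP|]; by [right|left].
  by move=> [[Ew h]|[Ew ->]]; split=> //; apply: ltnW.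
- exact: measurableI.
- exact: measurableI.
- by rewrite -subset0 => w [[_ /= h] [_ /= h']]; rewrite h' ltnn in h.
Qed.

Lemma prob_partition (f : Omega -> nat) N E : measurable_fun setT f -> measurable E ->
  prob P (~` (f @^-1` [set j | (j <= N)%N])) = 0 ->
  prob P E = \sum_(k < N.+1) prob P (E `&` f @^-1` [set (k : nat)]).
Proof.
move=> mf mE null; rewrite -prob_sum_lt // prob_setI_null //.
exact: measurable_preimage_nat.
Qed.

Lemma cond_probE H E : prob P H != 0 -> prob P (E `&` H) = prob P H * cond_prob P H E.
Proof. by move=> H0; rewrite /cond_prob mulrC mulfVK. Qed.

End Prob.

Section Cylinders.
Context (R : realType) (Omega : Type).
Implicit Types (X : R -> Omega -> nat) (s : seq R) (k : R -> nat).

(** States are prescribed by a function of time rather than by position in the list, so repetitions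
    and order do not matter and cylinders concatenate. *)
Definition cylinder X s k : set Omega := [set w | {in s, forall r, X r w = k r}].

Lemma cylinder_nil X k : cylinder X [::] k = setT.
Proof. by apply/seteqP; split=> // w _ r. Qed.

Lemma cylinder_cat X s s' k : cylinder X (s ++ s') k = cylinder X s k `&` cylinder X s' k.
Proof.
apply/seteqP; split=> w /=.
  by move=> h; split=> r rs; apply: h; rewrite mem_cat rs ?orbT.
by move=> [h h'] r; rewrite mem_cat => /orP[/h|/h'].
Qed.

Lemma cylinder1 X r k : cylinder X [:: r] k = X r @^-1` [set k r].
Proof.
apply/seteqP; split=> w /=; first by apply; rewrite inE.
by move=> h r'; rewrite inE => /eqP ->.
Qed.

Lemma cylinder_cons X r s k : cylinder X (r :: s) k = X r @^-1` [set k r] `&` cylinder X s k.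
Proof. by rewrite -cat1s cylinder_cat cylinder1. Qed.

Lemma cylinder_rcons X r s k : cylinder X (rcons s r) k = cylinder X s k `&` X r @^-1` [set k
  r].
Proof. by rewrite -cats1 cylinder_cat cylinder1. Qed.

Lemma eq_cylinder X X' s k k' : {in s, X =1 X'} -> {in s, k =1 k'} ->
  cylinder X s k = cylinder X' s k'.
Proof.
move=> XX kk; apply/seteqP; split=> w h r rs.
  by rewrite -XX // -kk //; apply: h.
by rewrite XX // kk //; apply: h.
Qed.

End Cylinders.

Section CylinderMeasurability.
Context (R : realType) d (Omega : measurableType d).

Lemma measurable_cylinder (X : R -> Omega -> nat) s k :
  {in s, forall r, measurable_fun setT (X r)} -> measurable (cylinder X s k).
Proof.
elim: s => [_|r s IHs h]; first by rewrite cylinder_nil.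
rewrite cylinder_cons; apply: measurableI.
  by apply: measurable_preimage_nat; apply: h; rewrite inE eqxx.
by apply: IHs => r' rs; apply: h; rewrite inE rs orbT.
Qed.

Lemma sigma_process_cylinder (D : set R) (X : R -> Omega -> nat) (f : R -> R) s k :
  {in s, forall r, D (f r)} -> sigma_process D X (cylinder (X \o f) s k).
Proof.
move=> sD; rewrite /sigma_process.
set G := \bigcup_(t in D) _.
suff : @measurable _ (g_sigma_algebraType G) (cylinder (X \o f) s k) by [].
elim: s sD => [_|r s IHs h]; first by rewrite cylinder_nil.
rewrite cylinder_cons; apply: measurableI.
  apply: sub_sigma_algebra; exists (f r); first by apply: h; rewrite inE eqxx.
  by exists [set k r] => //; rewrite setTI.
by apply: IHs => r' rs; apply: h; rewrite inE rs orbT.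
Qed.

End CylinderMeasurability.

(** * Path weights and chains pinned at their end *)

Section PathWeight.
Variables (R : realType) (N : nat) (a c : R).
Hypotheses (a_gt : -1 < a) (c_gt : N.*2%:R - 1 < c) (ac_gt : 1 < a + c).
Implicit Types (s : seq R) (k : R -> nat) (x y z : R).

Fixpoint path_weight k x s : R :=
  if s is y :: s' then qk a c x (k x) y (k y) * path_weight k y s' else 1.

Lemma path_weight_cat k x s s' : path_weight k x (s ++ s') = path_weight k x s * path_weight
  k (last x s) s'.
Proof. by elim: s x => [|y s IHs] x /=; rewrite ?mul1r // IHs mulrA. Qed.

Lemma path_weight_rcons k x s y :
  path_weight k x (rcons s y) = path_weight k x s * qk a c (last x s) (k (last x s)) y (k y).
Proof. by rewrite -cats1 path_weight_cat /= mulr1. Qed.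

Lemma eq_path_weight k k' x s : {in x :: s, k =1 k'} -> path_weight k x s = path_weight k' x s.
Proof.
elim: s x => [//|y s IHs] x h /=.
rewrite (h x) ?inE ?eqxx // (h y) ?inE ?eqxx ?orbT // IHs // => r rs.
by apply: h; rewrite inE rs orbT.
Qed.

Lemma path_weight_eq0 k x s : (k (last x s) < k x)%N -> path_weight k x s = 0.
Proof.
elim: s x => [|y s IHs] x /=; first by rewrite ltnn.
move=> h; have [xy|yx] := leqP (k x) (k y); last by rewrite qk_lt0 ?mul0r.
by rewrite IHs ?mulr0 //; apply: leq_trans h _.
Qed.

(** Chapman-Kolmogorov inside a path. If the state at [z] exceeds [N], both sides vanish, because a
    path of positive weight cannot come down again. *)
Lemma path_weight_CK k x y z s : 0 <= x -> x < y -> y < z -> z <= 1 -> y \notin s ->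
  (k (last z s) <= N)%N ->
  \sum_(K < N.+1) path_weight (fun r => if r == y then K : nat else k r) x [:: y, z & s] =
  path_weight k x (z :: s).
Proof.
move=> x0 xy yz z1 ys kN /=.
rewrite (eq_bigr (fun K : 'I_N.+1 => qk a c x (k x) y K * qk a c y K z (k z) * path_weight k
  z s)).
  rewrite -mulr_suml; have [kzN|Nkz] := leqP (k z) N; first by rewrite (qk_CK (N := N)).
  by rewrite path_weight_eq0 ?mulr0 // (leq_ltn_trans kN).
move=> K _; rewrite eqxx (lt_eqF xy) (gt_eqF yz) mulrA; congr (_ * _).
apply: eq_path_weight => r; rewrite inE => /orP[/eqP ->|rs]; first by rewrite gt_eqF.
by rewrite ifN //; apply: contraNneq ys => <-.
Qed.

End PathWeight.

Lemma path_lt_mem (R : realType) (x z : R) s :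
  path <%R x (rcons s z) -> {in s, forall r, x < r < z}.
Proof.
rewrite (path_pairwise lt_trans) pairwise_cons pairwise_rcons => /and3P[/allP h1 /allP h2 _]
  r rs.
by rewrite h1 ?h2 // mem_rcons inE rs orbT.
Qed.

Section PinnedChains.
Context (R : realType) (N : nat) (a c : R).
Hypotheses (a_gt : -1 < a) (c_gt : N.*2%:R - 1 < c) (ac_gt : 1 < a + c).
Context d (Omega : measurableType d) (P : probability Omega R) (H : set Omega).
Hypotheses (mH : measurable H) (H0 : prob P H != 0).
Local Notation Q := (cond_prob P H).
Local Notation bridge := (bridge a c).
Local Notation qk := (qk a c).
Local Notation path_weight := (path_weight a c).

Lemma cond_prob_sub0 (E F : set Omega) : measurable E -> measurable F -> E `<=` F ->
  Q F = 0 -> Q E = 0.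
Proof.
move=> mE mF EF /eqP; rewrite /cond_prob mulf_eq0 invr_eq0 (negbTE H0) orbF => /eqP F0.
have -> : prob P (E `&` H) = 0; last by rewrite mul0r.
apply: prob_sub0 F0; [exact: measurableI|exact: measurableI|].
exact: setSI.
Qed.

Lemma cond_prob_setC0 (E : set Omega) : measurable E -> Q E = 1 -> Q (~` E) = 0.
Proof.
move=> mE; rewrite /cond_prob => hE.
have {hE} : prob P (E `&` H) = prob P H.
  by apply: (mulIf (invr_neq0 H0)); rewrite hE mulfV.
have mC : measurable (~` E) by exact: measurableC.
have : prob P H = prob P (E `&` H) + prob P (~` E `&` H).
  rewrite -prob_setU; [|exact: measurableI|exact: measurableI|].
    by rewrite -setIUl setUCr setTI.
  by rewrite setIACA setICr set0I.
move=> hs h; have -> : prob P (~` E `&` H) = 0 by lra.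
by rewrite mul0r.
Qed.

(** [h] is the horizon of the chain and [z] the later time at which it is pinned in state [K]. Both
    are the middle time for the forward chain given [Theta]; the Case 1 chain has horizon [2^-1] and
    pin 1. Each transition replaces the kernel from the last state to the pin by two kernels, so the
    product telescopes. *)
Lemma forward_fdd (h z : R) K (V : R -> Omega -> nat) : 0 < h -> h <= z -> z <= 1 -> (K <=
  N)%N ->
  (forall x : R, 0 < x < h -> measurable_fun setT (V x)) ->
  (forall x : R, 0 < x < h -> Q (V x @^-1` [set j | (j <= K)%N]) = 1) ->
  (forall (x : R) j, 0 < x < h -> (j <= K)%N -> Q (V x @^-1` [set j]) = bridge 0 0 x j z K) ->
  (forall (x y : R) m j (s : seq R) k, 0 < x -> x < y -> y < h -> (m <= K)%N -> (j <= K)%N ->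
    {in s, forall r, 0 < r <= x} ->
    Q (cylinder V s k `&` V x @^-1` [set m] `&` V y @^-1` [set j]) =
    Q (cylinder V s k `&` V x @^-1` [set m]) * bridge x m y j z K) ->
  forall (s : seq R) k, path <%R 0 (rcons s h) -> k 0 = 0%N -> k z = K ->
    Q (cylinder V s k) = path_weight k 0 (rcons s z) / qk 0 0 z K.
Proof.
move=> h0 hz z1 KN mV V1 Vmarg Vtrans s k + k0 kz.
have z0 := lt_le_trans h0 hz.
have mp x S : 0 < x < h -> measurable (V x @^-1` S).
  by move=> hx; apply: measurable_preimage_nat; apply: mV.
have Vout x j : 0 < x < h -> (K < j)%N -> Q (V x @^-1` [set j]) = 0.
  move=> hx Kj; have := cond_prob_setC0 (mp _ _ hx) (V1 _ hx).
  apply: cond_prob_sub0; [exact: mp|by apply: measurableC; exact: mp|].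
  by move=> w /= ->; apply/negP; rewrite -ltnNge.
elim/last_ind: s => [|s y IHs] hp.
  rewrite cylinder_nil /= k0 kz mulr1 mulfV; first by rewrite /cond_prob setTI mulfV.
  by rewrite gt_eqF // (qk_gt0 a_gt c_gt ac_gt).
have hy : 0 < y < h by apply: (path_lt_mem hp); rewrite mem_rcons inE eqxx.
have [y0 yh] := andP hy; have yz := lt_le_trans yh hz.
have hp' : path <%R 0 (rcons s h).
  move: hp; rewrite -!cats1 !cat_path /= !andbT => /andP[/andP[-> l1] l2] /=.
  by rewrite last_cat /= in l2; apply: lt_trans yh.
have {}IHs := IHs hp'.
case/lastP: s hp hp' IHs => [|s x] hp hp' IHs.
  rewrite /= cylinder1 k0 kz mulr1; have [yK|Ky] := leqP (k y) K; first by rewrite Vmarg.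
  by rewrite Vout // (qk_lt0 _ _ _ _ Ky) mulr0 mul0r.
have hx : 0 < x < h by apply: (path_lt_mem hp'); rewrite mem_rcons inE eqxx.
have [x0 xh] := andP hx.
have xy : x < y.
  by move: hp; rewrite -!cats1 -!catA cat_path /= => /andP[_ /and3P[_ ->]].
have ms : measurable (cylinder V s k).
  apply: measurable_cylinder => r rs; apply: mV; apply: (path_lt_mem hp').
  by rewrite mem_rcons inE rs orbT.
rewrite cylinder_rcons in IHs; rewrite !cylinder_rcons.
have -> : Q (cylinder V s k `&` V x @^-1` [set k x] `&` V y @^-1` [set k y]) =
    Q (cylinder V s k `&` V x @^-1` [set k x]) * bridge x (k x) y (k y) z K.
  (* The Markov clause speaks only of states up to [K]; for the others both sides are zero. *)
  have [xK|Kx] := leqP (k x) K; last first.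
    have QE0 : Q (cylinder V s k `&` V x @^-1` [set k x]) = 0.
      apply: cond_prob_sub0 (Vout _ _ hx Kx); last exact: subIsetr.
        by apply: measurableI => //; exact: mp.
      exact: mp.
    rewrite QE0 mul0r; apply: cond_prob_sub0 QE0.
    - by apply: measurableI; [apply: measurableI => //|]; exact: mp.
    - by apply: measurableI => //; exact: mp.
    - exact: subIsetl.
  have [yK|Ky] := leqP (k y) K; last first.
    rewrite bridge_out ?mulr0; last by rewrite negb_and -!ltnNge Ky orbT.
    apply: cond_prob_sub0 (Vout _ _ hy Ky); last exact: subIsetr.
      by apply: measurableI; [apply: measurableI => //|]; exact: mp.
    exact: mp.
  apply: Vtrans => // r rs; have := path_lt_mem (z := x) (s := s).
  move: hp'; rewrite -cats1 cat_path => /andP[hpx _] /(_ _ hpx r rs) /andP[-> /ltW ->] //.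
rewrite IHs !path_weight_rcons !last_rcons kz -[X in _ = X / _]mulrA.
by rewrite (qk_bridgeE a_gt c_gt ac_gt _ _ (ltW x0) xy yz z1 KN); ring.
Qed.

(** The mirror image of [forward_fdd]: the chain starts from [N] at the right end and is pinned on
    the left at [z], so the induction adds times at the head of the list. *)
Lemma backward_fdd (z : R) K (V : R -> Omega -> nat) : 0 <= z -> z < 1 -> (K <= N)%N ->
  (forall x : R, z < x < 1 -> measurable_fun setT (V x)) ->
  (forall x : R, z < x < 1 -> Q (V x @^-1` [set j | (K <= j <= N)%N]) = 1) ->
  (forall (x : R) j, z < x < 1 -> (K <= j <= N)%N ->
    Q (V x @^-1` [set j]) = bridge z K x j 1 N) ->
  (forall (x y : R) i j (s : seq R) k, z < x -> x < y -> y < 1 ->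
    (K <= i <= N)%N -> (K <= j <= N)%N -> {in s, forall r, y <= r < 1} ->
    Q (cylinder V s k `&` V y @^-1` [set i] `&` V x @^-1` [set j]) =
    Q (cylinder V s k `&` V y @^-1` [set i]) * bridge z K x j y i) ->
  forall (s : seq R) k, path <%R z (rcons s 1) -> k z = K -> k 1 = N ->
    Q (cylinder V s k) = path_weight k z (rcons s 1) / qk z K 1 N.
Proof.
move=> z0 z1 KN mV V1 Vmarg Vtrans s k + kz k1.
have mp x S : z < x < 1 -> measurable (V x @^-1` S).
  by move=> hx; apply: measurable_preimage_nat; apply: mV.
have Vout x j : z < x < 1 -> ~~ (K <= j <= N)%N -> Q (V x @^-1` [set j]) = 0.
  move=> hx Kj; have := cond_prob_setC0 (mp _ _ hx) (V1 _ hx).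
  apply: cond_prob_sub0; [exact: mp|by apply: measurableC; exact: mp|].
  by move=> w /= ->; apply/negP.
elim: s => [|x s IHs] hp.
  rewrite cylinder_nil /= kz k1 mulr1 mulfV; first by rewrite /cond_prob setTI mulfV.
  by rewrite gt_eqF // (qk_gt0 a_gt c_gt ac_gt) ?KN /=.
have hx : z < x < 1 by apply: (path_lt_mem hp); rewrite inE eqxx.
have [x0 x1] := andP hx.
case: s hp IHs => [|y s] hp IHs.
  rewrite /= cylinder1 kz k1 mulr1; have [xK|Kx] := boolP (K <= k x <= N)%N;
    first by rewrite Vmarg.
  by rewrite Vout //; move: (bridge_out a c z x 1 Kx); rewrite bridgeE => ->.
have hp' : path <%R z (rcons (y :: s) 1).
  by move: hp; rewrite /= => /and3P[h1 h2 ->]; rewrite (lt_trans h1 h2).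
have {}IHs := IHs hp'.
have hy : z < y < 1 by apply: (path_lt_mem hp'); rewrite inE eqxx.
have [y0 y1] := andP hy.
have xy : x < y by move: hp; rewrite /= => /and3P[].
have ms : measurable (cylinder V s k).
  apply: measurable_cylinder => r rs; apply: mV; apply: (path_lt_mem hp').
  by rewrite inE rs orbT.
rewrite cylinder_cons setIC in IHs; rewrite 2!cylinder_cons setIC [_ `&` cylinder V s k]setIC.
have mQ S : measurable (cylinder V s k `&` V y @^-1` S) by apply: measurableI => //; exact: mp.
have -> : Q (cylinder V s k `&` V y @^-1` [set k y] `&` V x @^-1` [set k x]) =
    Q (cylinder V s k `&` V y @^-1` [set k y]) * bridge z K x (k x) y (k y).
  have [yK|Ky] := boolP (K <= k y <= N)%N; last first.
    have QE0 : Q (cylinder V s k `&` V y @^-1` [set k y]) = 0.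
      by apply: cond_prob_sub0 (Vout _ _ hy Ky); [|exact: mp|exact: subIsetr].
    rewrite QE0 mul0r.
    by apply: cond_prob_sub0 QE0; [apply: measurableI => //;
      exact: mp|exact: mQ|exact: subIsetl].
  have [xK|Kx] := boolP (K <= k x <= N)%N; last first.
    rewrite bridge_out ?mulr0; last first.
      by apply: contra Kx => /andP[-> /leq_trans] -> //; case/andP: yK.
    apply: cond_prob_sub0 (Vout _ _ hx Kx); [|exact: mp|exact: subIsetr].
    by apply: measurableI => //; exact: mp.
  apply: Vtrans => // r rs; have := path_lt_mem (x := y) (z := 1) (s := s).
  by move: hp' => /= /andP[_ hpy] /(_ hpy r rs) /andP[/ltW -> ->].
rewrite IHs /= kz.
have [yN|Ny] := leqP (k y) N; last by rewrite (@path_weight_eq0 R a c k y) ?last_rcons ?k1 //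
  !(mulr0, mul0r).
by rewrite [X in _ = X / _]mulrA (qk_bridgeE a_gt c_gt ac_gt _ _ z0 x0 xy (ltW y1) yN); ring.
Qed.

End PinnedChains.

Section PsiOrder.
Variables (R : realType) (N : nat) (A B C : R).
Hypothesis (hv : 0 < N%:R - 1 - B - C).

(** A difference of times is [pdet] over the product of the two scales. [psi] has a pole at [2^-1],
    hence the condition that both points lie on the same side. *)
Lemma psi_lt (x y : R) : x < y -> 0 < (1 - x *+ 2) * (1 - y *+ 2) ->
  psi N A B C x < psi N A B C y.
Proof.
move=> xy exy; rewrite -subr_gt0.
have := par_ac A hv => ac.
have ex : 1 - x *+ 2 != 0 by apply: contraTneq exy => ->; rewrite mul0r ltxx.
have ey : 1 - y *+ 2 != 0 by apply: contraTneq exy => ->; rewrite mulr0 ltxx.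
have -> : psi N A B C y - psi N A B C x =
    (A - B + (N%:R - C - A)) * (y - x) / ((1 - x *+ 2) * (1 - y *+ 2)).
  have h (p q : R * R) : p.2 != 0 -> q.2 != 0 ->
      q.1 / q.2 - 2 * A - (p.1 / p.2 - 2 * A) = pdet p q / (p.2 * q.2).
    by case: p q => [b e] [b' e'] /= e0 e'0; rewrite /pdet /=; field; rewrite e0 e'0.
  by rewrite -pdet_pt; apply: h.
by apply: divr_gt0 => //; apply: mulr_gt0; lra.
Qed.

Lemma psi_ltl (x y : R) : x < y -> y < 2^-1 -> psi N A B C x < psi N A B C y.
Proof. by move=> xy y1; apply: psi_lt => //; apply: mulr_gt0; lra. Qed.

Lemma psi_ltr (x y : R) : 2^-1 < x -> x < y -> psi N A B C x < psi N A B C y.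
Proof.
by move=> x1 xy; apply: psi_lt => //; rewrite -mulrNN; apply: mulr_gt0; lra.
Qed.

Lemma T_dom_psi (x : R) : 0 < x < 2^-1 -> T_dom A B (psi N A B C x).
Proof. by move=> /andP[x0 x1]; rewrite /T_dom /= -(psi0 N A B C); apply: psi_ltl. Qed.

Lemma T'_dom_psi (x : R) : 2^-1 < x < 1 -> T'_dom N A C (- psi N A B C x).
Proof.
move=> /andP[x0 x1]; rewrite /T'_dom /= ltrNr -(psi1 N A B C); exact: psi_ltr.
Qed.

End PsiOrder.

Lemma path_split (R : realType) (x h : R) s : path <%R x s -> h \notin s -> x < h ->
  exists s1 s2, [/\ s = s1 ++ s2, path <%R x (rcons s1 h) & path <%R h s2].
Proof.
elim: s x => [|y s IHs] x /=; first by move=> _ _ xh; exists [::], [::]; rewrite /= xh.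
move=> /andP[xy hp]; rewrite inE negb_or => /andP[hy hs] xh.
have [yh|yh] := ltP y h.
  have [s1 [s2 [-> h1 h2]]] := IHs _ hp hs yh.
  by exists (y :: s1), s2; rewrite /= xy.
by exists [::], (y :: s); rewrite /= xh lt_neqAle hy yh.
Qed.

(** * Gluing the two chains along [Theta] *)

Section StateProcess.
Context (R : realType) (N : nat) (A B C : R).
Context d (Omega : measurableType d) (P : probability Omega R).
Context (Theta : Omega -> nat) (zeta zeta' : R -> Omega -> nat).
Hypotheses (hB2 : B < A + 1)
  (hC : C < - A - N%:R + 1) (hv : 0 < N%:R - 1 - B - C)
  (mTheta : measurable_fun setT Theta)
  (mzeta : process (T_dom A B) zeta)
  (mzeta' : process (T'_dom N A C) zeta')
  (hTheta : forall k : nat, (k <= N)%N ->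
     prob P (Theta @^-1` [set k]) = Pi_law N (A + C) (A - B + 1) k)
  (hindep : cond_independent P N Theta (T_dom A B) (T'_dom N A C) zeta zeta')
  (hzeta : forall K : nat, (K <= N)%N ->
     xi_chain (cond_prob P (Theta @^-1` [set K])) A B K zeta)
  (hzeta' : forall K : nat, (K <= N)%N ->
     xi_dual_chain (cond_prob P (Theta @^-1` [set K])) N A C K zeta').

Local Notation psi := (psi N A B C).
Local Notation a := (A - B).
Local Notation c := (N%:R - C - A).
Local Notation bridge := (bridge a c).
Local Notation qk := (qk a c).
Local Notation path_weight := (path_weight a c).
Let a_gt := par_a hB2.
Let c_gt := par_c hC.
Let ac_gt := par_ac A hv.

(* The ends [x <= 0] and [x >= 1] carry the deterministic states [0] and [N], so
   that one-sided conditioning is a special case of two-sided conditioning. *)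
Definition state (x : R) (w : Omega) : nat :=
  if x <= 0 then 0%N else if x < 2^-1 then zeta (psi x) w
  else if x == 2^-1 then Theta w else if x < 1 then zeta' (- psi x) w else N.

Lemma state_left x : 0 < x < 2^-1 -> state x = (zeta \o psi) x.
Proof. by move=> /andP[x0 x1]; apply/funext => w; rewrite /state leNgt x0 x1. Qed.

Lemma state_mid : state 2^-1 = Theta.
Proof. by apply/funext => w; rewrite /state leNgt invr_gt0 ltr0n ltxx eqxx. Qed.

Lemma state_right x : 2^-1 < x < 1 -> state x = (zeta' \o (fun y => - psi y)) x.
Proof.
move=> /andP[x0 x1]; apply/funext => w; rewrite /state.
by rewrite leNgt (lt_trans _ x0) ?invr_gt0 ?ltr0n //= ltNge (ltW x0) gt_eqF // x1.
Qed.

Lemma state0 w : state 0 w = 0%N.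
Proof. by rewrite /state lexx. Qed.

Lemma state1 w : state 1 w = N.
Proof.
have h : (2^-1 : R) < 1 by lra.
by rewrite /state leNgt ltr01 /= ltNge (ltW h) gt_eqF // ltxx.
Qed.

Lemma measurable_state x : measurable_fun setT (state x).
Proof.
have [x0|x0] := leP x 0.
  by rewrite (_ : state x = cst 0%N) //; apply/funext => w; rewrite /state x0.
have [x1|x1|->] := ltgtP x 2^-1.
- by rewrite state_left ?x0 //; apply/mzeta/T_dom_psi => //; rewrite x0.
- have [y1|y1] := ltP x 1.
    by rewrite state_right ?x1 //; apply/mzeta'/(T'_dom_psi A hv) => //; rewrite x1.
  rewrite (_ : state x = cst N) //; apply/funext => w.
  by rewrite /state leNgt x0 /= ltNge (ltW x1) /= gt_eqF // ltNge y1.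
- by rewrite state_mid.
Qed.

Let half0 : 0 < 2^-1 :> R. Proof. by rewrite invr_gt0. Qed.
Let half1 : 2^-1 < 1 :> R. Proof. by lra. Qed.

Lemma prob_Theta K : (K <= N)%N -> prob P (Theta @^-1` [set K]) = bridge 0 0 2^-1 K 1 N.
Proof. by move=> KN; rewrite hTheta // (Pi_law_bridge hB2 hC hv). Qed.

Lemma prob_Theta_neq0 K : (K <= N)%N -> prob P (Theta @^-1` [set K]) != 0.
Proof.
move=> KN; rewrite prob_Theta // gt_eqF // bridgeE.
have qpos x m y j : 0 <= x -> x < y -> y <= 1 -> (m <= j <= N)%N -> 0 < qk x m y j.
  exact: (qk_gt0 a_gt c_gt ac_gt).
by apply: divr_gt0; first apply: mulr_gt0; apply: qpos; rewrite ?KN ?leqnn ?(ltW half0) ?(ltW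
  half1).
Qed.

(** The given masses on the states up to [N] already add up to 1, by the total mass of a bridge from
    0 to [N]. *)
Lemma prob_Theta_out : prob P (~` (Theta @^-1` [set j | (j <= N)%N])) = 0.
Proof.
rewrite prob_setC; last exact: measurable_preimage_nat.
have := prob_sum_lt P N.+1 mTheta (measurableT : measurable [set: Omega]).
rewrite setTI => ->; rewrite (eq_bigr (fun K : 'I_N.+1 => bridge 0 0 2^-1 K 1 N)).
  by rewrite (bridge_sum a_gt c_gt ac_gt (lexx 0) half0 half1 (lexx 1)) ?subrr ?leqnn.
by move=> K _; rewrite setTI prob_Theta // -ltnS.
Qed.

Lemma cond_prob_left K (s : seq R) k : (K <= N)%N -> path <%R 0 (rcons s 2^-1) ->
  k 0 = 0%N -> k 2^-1 = K ->
  cond_prob P (Theta @^-1` [set K]) (cylinder state s k) =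
  path_weight k 0 (rcons s 2^-1) / qk 0 0 2^-1 K.
Proof.
move=> KN hp k0 kh; have [h1 h2 h3] := hzeta KN.
rewrite (@eq_cylinder _ _ state (zeta \o psi) s k k) //; last first.
  by move=> r rs; rewrite state_left //; apply: (path_lt_mem hp).
apply: (forward_fdd a_gt c_gt ac_gt _ _ half0 (lexx _) (ltW half1) KN) => //.
- exact: measurable_preimage_nat.
- exact: prob_Theta_neq0.
- by move=> x hx; apply/mzeta/T_dom_psi.
- by move=> x hx; apply/h1/T_dom_psi.
- move=> x j hx jK; rewrite h2 //; last exact: T_dom_psi.
  by have /andP[x0 x1] := hx; rewrite -(psi0 N A B C) (xi_trans_bridge hB2 hC hv) ?jK.
- move=> x y m j s' k' x0 xy y1 mK jK hs'.
  rewrite (h3 (psi x) (psi y)) //.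
  + by rewrite (xi_trans_bridge hB2 hC hv) ?jK // ltW.
  + by apply: T_dom_psi => //; rewrite x0 (lt_trans xy).
  + by apply: T_dom_psi => //; rewrite y1 (lt_trans x0).
  + exact: psi_ltl.
  + apply: sigma_process_cylinder => r /hs' /andP[r0 rx] /=.
    split; first by apply: T_dom_psi => //; rewrite r0 (le_lt_trans rx) // (lt_trans xy).
    by move: rx; rewrite le_eqVlt => /orP[/eqP -> //|rx]; apply/ltW/psi_ltl => //;
      apply: lt_trans y1.
Qed.

Lemma cond_prob_right K (s : seq R) k : (K <= N)%N -> path <%R 2^-1 (rcons s 1) ->
  k 2^-1 = K -> k 1 = N ->
  cond_prob P (Theta @^-1` [set K]) (cylinder state s k) =
  path_weight k 2^-1 (rcons s 1) / qk 2^-1 K 1 N.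
Proof.
move=> KN hp kh k1; have [h1 h2 h3] := hzeta' KN.
rewrite (@eq_cylinder _ _ state (zeta' \o (fun y => - psi y)) s k k) //; last first.
  by move=> r rs; rewrite state_right //; apply: (path_lt_mem hp).
apply: (backward_fdd a_gt c_gt ac_gt _ _ (ltW half0) half1 KN) => //.
- exact: measurable_preimage_nat.
- exact: prob_Theta_neq0.
- by move=> x hx; apply/mzeta'/(T'_dom_psi A hv).
- by move=> x hx; apply/h1/(T'_dom_psi A hv).
- move=> x j hx jK; rewrite h2 //; last exact: (T'_dom_psi A hv).
  have /andP[x0 x1] := hx; have /andP[Kj jN] := jK.
  have -> : A + N%:R - C = - psi 1 by rewrite psi1 opprK.
  by rewrite (xi_dual_trans_bridge hB2 hC hv) ?KN ?leqnn.
- move=> x y i j s' k' x0 xy y1 iK jK hs'.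
  rewrite (h3 (- psi y) (- psi x)) //.
  + by case/andP: jK => Kj jN; rewrite (xi_dual_trans_bridge hB2 hC hv) // ltW.
  + by apply: (T'_dom_psi A hv) => //; rewrite y1 (lt_trans x0).
  + by apply: (T'_dom_psi A hv) => //; rewrite x0 (lt_trans xy).
  + by rewrite ltrN2; apply: psi_ltr.
  + apply: sigma_process_cylinder => r /hs' /andP[r0 rx] /=.
    have yh : 2^-1 < y by apply: lt_trans xy.
    split; first by apply: (T'_dom_psi A hv) => //; rewrite rx (lt_le_trans yh).
    by move: r0; rewrite lerN2 le_eqVlt => /orP[/eqP -> //|yr]; apply/ltW/psi_ltr.
Qed.

(** Given the middle state the two halves are independent; their normalising kernels to and from
    that state cancel against the law of [Theta]. *)
Lemma state_fdd_mid (s1 s2 : seq R) k :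
  path <%R 0 (s1 ++ 2^-1 :: rcons s2 1) -> k 0 = 0%N -> k 1 = N ->
  prob P (cylinder state (s1 ++ 2^-1 :: s2) k) =
  path_weight k 0 (s1 ++ 2^-1 :: rcons s2 1) / qk 0 0 1 N.
Proof.
rewrite -cat_rcons cat_path last_rcons => /andP[hp1 hp2] k0 k1.
have mh S : measurable (Theta @^-1` S) by exact: measurable_preimage_nat.
have mc s : measurable (cylinder state s k).
  by apply: measurable_cylinder => r _; apply: measurable_state.
rewrite path_weight_cat last_rcons; have [kN|Nk] := leqP (k 2^-1) N; last first.
  rewrite (@path_weight_eq0 _ _ _ _ 2^-1) ?mulr0 ?mul0r ?last_rcons ?k1 //.
  apply: prob_sub0 prob_Theta_out; [exact: mc|by apply: measurableC; exact: mh|].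
  move=> w /= h; have := h 2^-1; rewrite mem_cat inE eqxx orbT state_mid => -> //.
  by apply/negP; rewrite -ltnNge.
have -> : cylinder state (s1 ++ 2^-1 :: s2) k =
    (cylinder state s1 k `&` cylinder state s2 k) `&` Theta @^-1` [set k 2^-1].
  by rewrite cylinder_cat cylinder_cons state_mid setIAC setIA.
rewrite cond_probE ?prob_Theta_neq0 // hindep //.
- rewrite (cond_prob_left _ _ k0) // (cond_prob_right _ _ _ k1) // prob_Theta // bridgeE.
  have q1 : qk 0 0 2^-1 (k 2^-1) != 0.
    by rewrite gt_eqF // (qk_gt0 a_gt c_gt ac_gt) // ltW.
  have q2 : qk 2^-1 (k 2^-1) 1 N != 0.
    by rewrite gt_eqF // (qk_gt0 a_gt c_gt ac_gt) ?kN ?leqnn // ltW.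
  have q3 : qk 0 0 1 N != 0.
    by rewrite gt_eqF // (qk_gt0 a_gt c_gt ac_gt) ?leqnn.
  move: (qk 0 _ _ _) (qk _ _ _ _) (qk _ _ _ _) q1 q2 q3 => ? ? ? q1 q2 q3.
  by field; rewrite q1 q2 q3.
- rewrite (@eq_cylinder _ _ state (zeta \o psi) s1 k k) //; last first.
    by move=> r rs; rewrite state_left //; apply: (path_lt_mem hp1).
  by apply: sigma_process_cylinder => r rs; apply: T_dom_psi => //; apply: (path_lt_mem hp1).
- rewrite (@eq_cylinder _ _ state (zeta' \o (fun y => - psi y)) s2 k k) //; last first.
    by move=> r rs; rewrite state_right //; apply: (path_lt_mem hp2).
  by apply: sigma_process_cylinder => r rs; apply: (T'_dom_psi A hv); apply: (path_lt_mem hp2).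
Qed.

(** When the middle time is absent from [s], it is inserted, [Theta] is summed out, and
    Chapman-Kolmogorov removes it again. *)
Lemma state_fdd (s : seq R) k : path <%R 0 (rcons s 1) -> k 0 = 0%N -> k 1 = N ->
  prob P (cylinder state s k) = path_weight k 0 (rcons s 1) / qk 0 0 1 N.
Proof.
move=> hp k0 k1; have [hs|hs] := boolP (2^-1 \in s).
  case/splitPr: hs hp => s1 s2; rewrite rcons_cat /= => hp.
  by rewrite state_fdd_mid.
have hs' : 2^-1 \notin rcons s 1 by rewrite mem_rcons inE negb_or hs andbT lt_eqF.
have [s1 [s2 [Es hp1 hp2]]] := path_split hp hs' half0.
case/lastP: s2 Es hp2 => [|s2 y] Es hp2.
  have /(_ 1) := path_lt_mem hp1; rewrite -(cats0 s1) -Es mem_rcons inE eqxx.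
  by move=> /(_ isT) /andP[_]; rewrite ltNge (ltW half1).
move: Es; rewrite -rcons_cat => /rcons_inj[Es Ey]; subst y s.
have ps : path <%R 0 (s1 ++ 2^-1 :: rcons s2 1).
  by rewrite -cat_rcons cat_path last_rcons hp1 hp2.
have mc s' k' : measurable (cylinder state s' k').
  by apply: measurable_cylinder => r _; apply: measurable_state.
rewrite (prob_partition mTheta (mc _ _) prob_Theta_out).
pose kK (K : nat) r := if r == 2^-1 then K else k r.
have k2 K : {in s1 ++ s2, k =1 kK K}.
  move=> r rs; rewrite /kK ifN //; apply: contraNneq hs => <- //.
rewrite (eq_bigr (fun K : 'I_N.+1 => path_weight k 0 s1 *
    path_weight (kK K) (last 0 s1) (2^-1 :: rcons s2 1) / qk 0 0 1 N)); last first.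
  move=> K _; have -> : cylinder state (s1 ++ s2) k `&` Theta @^-1` [set (K : nat)] =
      cylinder state (s1 ++ 2^-1 :: s2) (kK K).
    rewrite (@eq_cylinder _ _ state state (s1 ++ s2) k (kK K) (fun _ _ => erefl) (k2 K)).
    have e : kK K 2^-1 = K by rewrite /kK eqxx.
    rewrite !cylinder_cat cylinder_cons state_mid e.
    by rewrite [RHS]setICA setIC.
  rewrite state_fdd_mid //; last 2 first.
  - by rewrite /kK ifN // lt_eqF.
  - by rewrite /kK ifN // gt_eqF.
  rewrite path_weight_cat; congr (_ * _ / _); apply: eq_path_weight => r.
  rewrite inE => /orP[/eqP ->|rs]; first by rewrite /kK ifN // lt_eqF.
  by rewrite (k2 K) // mem_cat rs.
rewrite -mulr_suml -mulr_sumr rcons_cat path_weight_cat; congr (_ * _ / _).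
have hl : last 0 s1 < 2^-1 by move: hp1; rewrite -cats1 cat_path /= andbT => /andP[].
have hl0 : 0 <= last 0 s1.
  have := mem_last 0 s1; rewrite inE => /orP[/eqP -> //|h].
  by have /andP[/ltW] := path_lt_mem hp1 h.
have zN : k (last 0 (rcons s2 1)) = N by rewrite last_rcons.
have z1 : all (fun r => r <= 1) (rcons s2 1).
  rewrite all_rcons lexx; apply/allP => r rs; apply/ltW.
  by have /andP[] := path_lt_mem hp2 rs.
have hn : 2^-1 \notin rcons s2 1.
  rewrite mem_rcons inE negb_or lt_eqF //=.
  by apply: contra hs; rewrite mem_cat => ->; rewrite orbT.
(* [z] is the next time after the middle one, possibly the right end 1 itself. *)
case: (rcons s2 1) (hp2) z1 zN hn (size_rcons s2 1) => [//|z t] /= /andP[hz _] /andP[z1 _] zN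
  hn _.
apply: (path_weight_CK a_gt c_gt ac_gt) => //; last by rewrite zN.
by apply: contra hn; rewrite inE => ->; rewrite orbT.
Qed.

End StateProcess.

(** * Conditioning on the past and the future *)

Section FiniteValued.
Context (R : realType) d (Omega : measurableType d) (P : probability Omega R).
Context (I : finType) (A : I -> set Omega) (f : I -> R) (X : Omega -> R) (Bad : set Omega).
Hypotheses (mA : forall i, measurable (A i)) (mX : measurable_fun setT X)
  (mBad : measurable Bad) (Bad0 : prob P Bad = 0)
  (XE : forall w, ~ Bad w -> X w = \sum_i f i * \1_(A i) w).

Let g w : R := \sum_i f i * \1_(A i) w.

Let gE : EFin \o g = (fun w => \sum_i (f i)%:E * (\1_(A i) w)%:E)%E.
Proof. by apply/funext => w; rewrite /g /= -sumEFin. Qed.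

Let integrable_term i (E : set Omega) : measurable E ->
  P.-integrable E (fun w => (\1_(A i) w)%:E).
Proof.
move=> mE; apply: (@integrableS _ _ _ _ setT) => //; exact: integrable_indic.
Qed.

Let integrable_g (E : set Omega) : measurable E -> P.-integrable E (EFin \o g).
Proof.
move=> mE; rewrite gE; apply: integrable_sum => // i _.
by apply: integrableZl => //; apply: integrable_term.
Qed.

Let mg : measurable_fun setT g.
Proof.
by apply/measurable_EFinP; have /integrableP[] := integrable_g (@measurableT _ Omega).
Qed.

Let ae_Xg (E : set Omega) h : (forall w, X w = g w -> h (X w) = h (g w) :> \bar R) ->
  ae_eq P E (h \o X) (h \o g).
Proof.
move=> hh; exists Bad; split=> //; first by have := probE P mBad; rewrite Bad0.
move=> w /= hw; apply: contrapT => nBad; apply: hw => _.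
by rewrite /= XE.
Qed.

(** The equality with a simple function is assumed only off the null event [Bad], since a state may
    exceed [N] on a null event. *)
Lemma integrable_finite_valued : P.-integrable setT (EFin \o X).
Proof.
have /integrableP[_ gfin] := integrable_g (@measurableT _ Omega).
apply/integrableP; split; first exact/measurable_EFinP.
rewrite (@ae_eq_integral _ _ _ _ _ (fun w => `|(EFin \o g) w|)%E) //.
- by apply: measurableT_comp => //; exact/measurable_EFinP.
- by apply: measurableT_comp => //; exact/measurable_EFinP.
- by apply: (@ae_Xg _ (fun r => `|r%:E|)%E) => w ->.
Qed.

Lemma integral_finite_valued (E : set Omega) : measurable E ->
  (\int[P]_(w in E) (X w)%:E = (\sum_i f i * prob P (E `&` A i))%:E)%E.
Proof.
move=> mE; rewrite (@ae_eq_integral _ _ _ _ _ (EFin \o g)) //.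
- rewrite gE integral_sum //; last first.
    by move=> i; apply: integrableZl => //; apply: integrable_term.
  rewrite -sumEFin; apply: eq_bigr => i _.
  rewrite integralZl //; last exact: integrable_term.
  by rewrite integral_indic // EFinM -probE ?[E `&` _]setIC //; exact: measurableI.
- by apply/measurable_EFinP; apply: measurable_funTS.
- by apply/measurable_EFinP; apply: measurable_funTS.
- by apply: (@ae_Xg _ EFin) => w ->.
Qed.

End FiniteValued.

(** * Conditional expectations from the finite-dimensional laws *)

Section Bridge.
Context (R : realType) (N : nat) (a c : R).
Hypotheses (a_gt : -1 < a) (c_gt : N.*2%:R - 1 < c) (ac_gt : 1 < a + c).
Context d (Omega : measurableType d) (P : probability Omega R).
Context (W : R -> Omega -> nat).
Local Notation bridge := (bridge a c).
Local Notation qk := (qk a c).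
Local Notation path_weight := (path_weight a c).
Hypotheses (mW : forall x, measurable_fun setT (W x))
  (W0 : forall w, W 0 w = 0%N) (W1 : forall w, W 1 w = N)
  (W_fdd : forall (s : seq R) k, path <%R 0 (rcons s 1) -> k 0 = 0%N -> k 1 = N ->
    prob P (cylinder W s k) = path_weight k 0 (rcons s 1) / qk 0 0 1 N).

Let mp x S : measurable (W x @^-1` S).
Proof. exact: measurable_preimage_nat. Qed.

Let mc s k : measurable (cylinder W s k).
Proof. by apply: measurable_cylinder => r _. Qed.

(** The deterministic ends 0 and 1 may now be members of the list, so a conditioning time can be an
    end without a separate case. *)
Lemma fdd_sorted (l : seq R) k : sorted <%R l -> 0 \in l -> 1 \in l ->
  {in l, forall r, 0 <= r <= 1} -> k 0 = 0%N -> k 1 = N ->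
  prob P (cylinder W l k) = path_weight k (head 0 l) (behead l) / qk 0 0 1 N.
Proof.
move=> sl l0 l1 hl k0 k1; case: l sl l0 l1 hl => [//|y l] sl l0 l1 hl.
have y0 : y = 0.
  apply/eqP; rewrite eq_le (andP (hl y _)).1 ?inE ?eqxx // andbT.
  move: l0; rewrite inE => /orP[/eqP <- //|l0]; apply/ltW.
  by have /allP := order_path_min lt_trans sl; apply.
subst y; case/lastP: l sl l0 l1 hl => [|l y] sl l0 l1 hl.
  by move: l1; rewrite inE oner_eq0.
have y1 : y = 1.
  apply/eqP; rewrite eq_le (andP (hl y _)).2 ?inE ?mem_rcons ?inE ?eqxx ?orbT //=.
  move: l1; rewrite inE oner_eq0 mem_rcons inE /= => /orP[/eqP -> //|l1]; apply/ltW.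
  by have /andP[] := path_lt_mem sl l1.
subst y; rewrite -W_fdd // cylinder_cons cylinder_rcons; congr prob.
apply/seteqP; split=> w /=; first by move=> [_ []].
by move=> h; split; [rewrite W0 k0|split=> //; rewrite W1 k1].
Qed.

Lemma path_weight_mid k (l : seq R) x s : path_weight k (head 0 (l ++ x :: s)) (behead (l ++
  x :: s)) =
  path_weight k (head 0 (rcons l x)) (behead (rcons l x)) * path_weight k x s.
Proof. by case: l => [|y l] /=; rewrite ?mul1r // -cat_rcons path_weight_cat last_rcons. Qed.

Lemma lt_sorted_sort (s : seq R) : sorted <%R (sort <=%R (undup s)).
Proof. by rewrite lt_sorted_uniq_le sort_uniq undup_uniq sort_le_sorted. Qed.

Lemma eq_mem_cylinder (s s' : seq R) k : s =i s' -> cylinder W s k = cylinder W s' k.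
Proof. by move=> h; apply/seteqP; split=> w H r rs; apply: H; rewrite ?h // -h. Qed.

(* When the cylinder is not empty, any of its points supplies a consistent path. *)
Lemma bridge_cylinder x y z (ts : seq R) k m j n :
  0 <= x -> x < y -> y < z -> z <= 1 -> (n <= N)%N ->
  {in ts, forall r, 0 < r < 1 /\ (r <= x \/ z <= r)} ->
  prob P (cylinder W ts k `&` (W x @^-1` [set m] `&` W z @^-1` [set n]) `&` W y @^-1` [set j]) =
  prob P (cylinder W ts k `&` (W x @^-1` [set m] `&` W z @^-1` [set n])) * bridge x m y j z n.
Proof.
move=> x0 xy yz z1 nN hts.
have [->|/set0P[w0 [h0 [hm hn]]]] :=
    eqVneq (cylinder W ts k `&` (W x @^-1` [set m] `&` W z @^-1` [set n])) set0.
  by rewrite set0I prob_set0 mul0r.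
pose k' r := if r == y then j else W r w0.
(* The times 0 and 1 are added so that [fdd_sorted] applies; if one of them is [x] or [z], the
   strict filter drops it and it reappears in the middle of the list. *)
pose L1 := sort <=%R (undup [seq r <- [:: 0, 1 & ts] | r < x]).
pose L2 := sort <=%R (undup [seq r <- [:: 0, 1 & ts] | z < r]).
have m1 r : (r \in L1) = (r < x) && (r \in [:: 0, 1 & ts]).
  by rewrite mem_sort mem_undup mem_filter.
have m2 r : (r \in L2) = (z < r) && (r \in [:: 0, 1 & ts]).
  by rewrite mem_sort mem_undup mem_filter.
have s1 : pairwise <%R L1 by rewrite -(sorted_pairwise lt_trans) lt_sorted_sort.
have s2 : pairwise <%R L2 by rewrite -(sorted_pairwise lt_trans) lt_sorted_sort.
have xz := lt_trans xy yz.
have h01 r : r \in [:: 0, 1 & ts] -> 0 <= r <= 1.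
  rewrite !inE => /or3P[/eqP ->|/eqP ->|/hts[/andP[/ltW -> /ltW ->]]//];
  by rewrite ?lexx ?ler01.
have hL r : r \in L1 ++ [:: x, z & L2] -> r != y /\ 0 <= r <= 1.
  rewrite mem_cat !inE m1 m2 => /or4P[/andP[rx /h01]|/eqP ->|/eqP ->|/andP[zr /h01]].
  - by move=> h; rewrite lt_eqF // (lt_trans rx).
  - by rewrite lt_eqF // x0 (le_trans (ltW xz)).
  - by rewrite gt_eqF // z1 (le_trans x0) // ltW.
  - by move=> h; rewrite gt_eqF // (lt_trans yz).
have sL : sorted <%R (L1 ++ [:: x, z & L2]).
  rewrite (sorted_pairwise lt_trans) pairwise_cat s1 /= s2 andbT xz /=.
  apply/and3P; split.
  - apply/allrelP => r r'; rewrite m1 !inE m2 => /andP[rx _].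
    move=> /or3P[/eqP -> //|/eqP ->|/andP[zr _]]; first exact: lt_trans xz.
    by apply: lt_trans zr; apply: lt_trans xz.
  - by apply/allP => r; rewrite m2 => /andP[zr _]; apply: lt_trans zr.
  - by apply/allP => r; rewrite m2 => /andP[].
have sL' : sorted <%R (L1 ++ [:: x, y, z & L2]).
  rewrite (sorted_pairwise lt_trans) pairwise_cat s1 /= s2 andbT xz xy yz /=.
  apply/and4P; split.
  - apply/allrelP => r r'; rewrite m1 !inE m2 => /andP[rx _].
    move=> /or4P[/eqP -> //|/eqP ->|/eqP ->|/andP[zr _]].
    + exact: lt_trans xy.
    + exact: lt_trans xz.
    + by apply: lt_trans zr; apply: lt_trans xz.
  - by apply/allP => r; rewrite m2 => /andP[zr _]; apply: lt_trans zr.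
  - by apply/allP => r; rewrite m2 => /andP[zr _]; apply: lt_trans zr.
  - by apply/allP => r; rewrite m2 => /andP[].
have L0 : 0 \in L1 ++ [:: x, z & L2].
  rewrite mem_cat m1 !inE eqxx; move: x0; rewrite le_eqVlt => /orP[->|->] //.
  by rewrite orbT.
have L1' : 1 \in L1 ++ [:: x, z & L2].
  rewrite mem_cat !inE m2 !inE eqxx !orbT; move: z1; rewrite le_eqVlt eq_sym => /orP[->|->];
  by rewrite ?orbT.
have mL' : L1 ++ [:: x, y, z & L2] =i y :: (L1 ++ [:: x, z & L2]).
  by move=> r; rewrite !(inE, mem_cat); do !case: (_ == _); rewrite ?orbT.
have k'W r : r != y -> k' r = W r w0 by move=> ry; rewrite /k' (negbTE ry).
have cL : cylinder W (L1 ++ [:: x, z & L2]) k' =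
    cylinder W ts k `&` (W x @^-1` [set m] `&` W z @^-1` [set n]).
  apply/seteqP; split=> w.
    move=> h; have hk r : r \in L1 ++ [:: x, z & L2] -> W r w = W r w0.
      by move=> rL; rewrite h // k'W //; case: (hL _ rL).
    split; last by split; rewrite /= hk // mem_cat !inE eqxx ?orbT.
    move=> r rts; rewrite -(h0 r rts) hk // mem_cat m1 !inE m2 !inE rts !orbT !andbT.
    have [_ [|]] := hts r rts; rewrite le_eqVlt => /orP[/eqP h'|->]; rewrite ?orbT //.
      by rewrite h' eqxx orbT.
    by rewrite h' eqxx !orbT.
  move=> [hE [wm wn]] r rL; rewrite k'W; last by case: (hL _ rL).
  have hT : r \in [:: 0, 1 & ts] -> W r w = W r w0.
    rewrite !inE => /or3P[/eqP ->|/eqP ->|rts]; rewrite ?W0 ?W1 //.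
    by rewrite (hE r rts) (h0 r rts).
  move: rL; rewrite mem_cat !inE m1 m2 => /or4P[/andP[_ /hT]|/eqP ->|/eqP ->|/andP[_ /hT]] //.
    by rewrite [LHS]wm [RHS]hm.
  by rewrite [LHS]wn [RHS]hn.
have kk0 : k' 0 = 0%N by rewrite k'W ?W0 // lt_eqF // (le_lt_trans x0).
have kk1 : k' 1 = N by rewrite k'W ?W1 // gt_eqF // (lt_le_trans yz).
have kx : k' x = m by rewrite k'W ?hm // lt_eqF.
have kz : k' z = n by rewrite k'W ?hn // gt_eqF.
have ky : k' y = j by rewrite /k' eqxx.
have -> : cylinder W ts k `&` (W x @^-1` [set m] `&` W z @^-1` [set n]) `&` W y @^-1` [set j] =
    cylinder W (L1 ++ [:: x, y, z & L2]) k'.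
  by rewrite (eq_mem_cylinder _ mL') cylinder_cons ky -cL setIC.
rewrite -cL !fdd_sorted //; last 3 first.
- by rewrite mL' inE L0 orbT.
- by rewrite mL' inE L1' orbT.
- move=> r; rewrite mL' inE => /orP[/eqP ->|/hL[]//].
  by rewrite (le_trans x0) ?(le_trans (ltW yz)) // ltW.
rewrite !path_weight_mid /= kx ky kz [qk _ _ _ _ * (_ * _)]mulrA.
by rewrite (qk_bridgeE a_gt c_gt ac_gt _ _ x0 xy yz z1 nN); ring.
by move=> r /hL[].
Qed.

Lemma prob_state x j : 0 < x < 1 -> prob P (W x @^-1` [set j]) = bridge 0 0 x j 1 N.
Proof.
move=> /andP[x0 x1]; pose k r := if r == x then j else if r == 1 then N else 0%N.
have kx : k x = j by rewrite /k eqxx.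
have k1 : k 1 = N by rewrite /k eqxx gt_eqF.
have k0 : k 0 = 0%N by rewrite /k lt_eqF // eq_sym oner_eq0.
have := @W_fdd [:: x] k; rewrite /= x0 x1 => /(_ isT k0 k1).
by rewrite cylinder1 kx k0 k1 mulr1.
Qed.

Lemma state_out x : 0 <= x <= 1 -> prob P (~` (W x @^-1` [set j | (j <= N)%N])) = 0.
Proof.
move=> /andP[]; rewrite [0 <= x]le_eqVlt => /orP[/eqP <- _|x0].
  rewrite (_ : ~` _ = set0) ?prob_set0 // -subset0 => w /=; rewrite W0; exact.
rewrite le_eqVlt => /orP[/eqP ->|x1].
  rewrite (_ : ~` _ = set0) ?prob_set0 // -subset0 => w /=; rewrite W1; exact.
rewrite prob_setC //.
have := prob_sum_lt P N.+1 (mW x) (measurableT : measurable [set: Omega]).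
rewrite setTI => ->; rewrite (eq_bigr (fun K : 'I_N.+1 => bridge 0 0 x K 1 N)).
  by rewrite (bridge_sum a_gt c_gt ac_gt (lexx 0) x0 x1 (lexx 1)) ?subrr ?leqnn.
by move=> K _; rewrite setTI prob_state // x0.
Qed.

Section SigmaAlgebra.
Variables (x y z : R) (I : set R) (f : R -> R) (g : R -> nat -> R) (Z : R -> Omega -> R).
Hypotheses (x0 : 0 <= x) (xy : x < y) (yz : y < z) (z1 : z <= 1).
Hypothesis ZE : forall r, I r -> Z r = g r \o W (f r).
Hypothesis If : forall r, I r -> 0 < f r < 1 /\ (f r <= x \/ z <= f r).

(** The identity of [bridge_cylinder] survives complements and disjoint countable unions, and
    cylinders are stable under intersection. Measurability of [E] in the ambient space comes from
    the same induction. *)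
Lemma bridge_sigma (E : set Omega) : sigma_process I Z E ->
  measurable E /\ forall m j n, (n <= N)%N ->
  prob P (E `&` (W x @^-1` [set m] `&` W z @^-1` [set n]) `&` W y @^-1` [set j]) =
  prob P (E `&` (W x @^-1` [set m] `&` W z @^-1` [set n])) * bridge x m y j z n.
Proof.
(* The empty set is included because cylinders that prescribe different states at a common time are
   disjoint. *)
pose G : set (set Omega) := [set E | E = set0 \/ exists s k,
  {in s, forall r, 0 < r < 1 /\ (r <= x \/ z <= r)} /\ E = cylinder W s k].
have sG : sigma_process I Z `<=` <<s G >>.
  apply: smallest_sub; first exact: smallest_sigma_algebra.
  move=> _ [r Ir [V mV <-]]; rewrite setTI ZE //.
  (* A preimage under [Z r] is a countable union over the values of the state. *)
  have -> : (g r \o W (f r)) @^-1` V =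
      \bigcup_i (if g r i \in V then cylinder W [:: f r] (fun=> i) else set0).
    apply/seteqP; split=> w /=.
      move=> Vw; exists (W (f r) w) => //; rewrite mem_set // cylinder1 //.
    by move=> [i _]; case: ifPn => [/set_mem Vi|//]; rewrite cylinder1 /= => ->.
  suff : @measurable _ (g_sigma_algebraType G)
      (\bigcup_i (if g r i \in V then cylinder W [:: f r] (fun=> i) else set0)) by [].
  apply: bigcupT_measurable => i; apply: sub_sigma_algebra; case: ifPn => _; last by left.
  right; exists [:: f r], (fun=> i); split=> // q; rewrite inE => /eqP ->; exact: If.
have GI : setI_closed G.
  move=> E1 E2 [->|[s1 [k1 [h1 ->]]]]; first by left; rewrite set0I.
  move=> [->|[s2 [k2 [h2 ->]]]]; first by left; rewrite setI0.
  have [->|/set0P[w0 [hw1 hw2]]] := eqVneq (cylinder W s1 k1 `&` cylinder W s2 k2) set0;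
    first by left.
  right; exists (s1 ++ s2), (fun r => W r w0); split.
    by move=> r; rewrite mem_cat => /orP[/h1|/h2].
  by rewrite cylinder_cat; congr (_ `&` _); apply: eq_cylinder => // r rs;
  symmetry; by [exact: hw1|exact: hw2].
have hT m j n : (n <= N)%N ->
    prob P (setT `&` (W x @^-1` [set m] `&` W z @^-1` [set n]) `&` W y @^-1` [set j]) =
    prob P (setT `&` (W x @^-1` [set m] `&` W z @^-1` [set n])) * bridge x m y j z n.
  move=> nN; rewrite -(cylinder_nil W (fun=> 0%N)); exact: bridge_cylinder.
pose Pr (S : set Omega) := measurable S /\ forall m j n, (n <= N)%N ->
  prob P (S `&` (W x @^-1` [set m] `&` W z @^-1` [set n]) `&` W y @^-1` [set j]) =
  prob P (S `&` (W x @^-1` [set m] `&` W z @^-1` [set n])) * bridge x m y j z n.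
have hbig (F : nat -> set Omega) : trivIset setT F -> (forall i, Pr (F i)) ->
    Pr (\bigcup_k F k).
  move=> tF hF; split=> [|m j n nN].
    by apply: bigcupT_measurable => i; case: (hF i).
  have hU (B : set Omega) : measurable B ->
      (prob P (\bigcup_k F k `&` B))%:E = (\sum_(k <oo) (prob P (F k `&` B))%:E)%E.
    have mF i : measurable (F i : set Omega) by case: (hF i).
    move=> mB; have mFB i : measurable (F i `&` B) by exact: measurableI.
    rewrite setI_bigcupl -probE; last exact: bigcupT_measurable.
    rewrite measure_semi_bigcup //.
    - by apply: eq_eseriesr => i _; exact: probE.
    - exact: trivIset_setIr.
    - exact: bigcupT_measurable.
  have mB : measurable (W x @^-1` [set m] `&` W z @^-1` [set n]) by apply: measurableI.
  apply: EFin_inj; rewrite -setIA hU; last exact: measurableI.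
  rewrite mulrC EFinM hU // -nneseriesZl; last by move=> i _; rewrite lee_fin prob_ge0.
  apply: eq_eseriesr => i _; rewrite setIA -EFinM mulrC.
  by case: (hF i) => _ ->.
move=> /sG; apply: (@dynkin_induction _ (g_sigma_algebraType G) G Pr) => //.
- move=> _ [->|[s [k [hs ->]]]].
    by split=> [|m j n nN]; [exact: (@measurable0 _ Omega)|rewrite !set0I prob_set0 mul0r].
  by split=> [|m j n nN]; [exact: mc|exact: bridge_cylinder].
- move=> S _ [mS hS]; split=> [|m j n nN]; first exact: measurableC.
  have hD (B : set Omega) : measurable B -> prob P (~` S `&` B) = prob P B - prob P (S `&` B).
    move=> mB; apply/eqP; rewrite eq_sym subr_eq; apply/eqP.
    rewrite -prob_setU; [|by apply: measurableI => //; exact: measurableC|exact: measurableI|].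
      by rewrite -setIUl setUC setUCr setTI.
    by rewrite setIACA setICl set0I.
  have mB : measurable (W x @^-1` [set m] `&` W z @^-1` [set n]) by apply: measurableI.
  rewrite -setIA !hD //; last exact: measurableI.
  by have := hT m j n nN; rewrite !setTI setIA hS // => ->; ring.
- by move=> F _; exact: hbig.
Qed.

(** The moment identity is required only for end states attained at some [w]. At [x = 0] or [z = 1]
    this leaves the single state 0 or [N], which yields the one-sided statements. *)
Lemma is_cond_exp_bridge (F : nat -> nat -> nat -> R) (G : nat -> nat -> R)
    (X V : Omega -> R) :
  measurable_fun setT X ->
  preimage_set_system setT V measurable `<=` sigma_process I Z ->
  (forall w, X w = F (W x w) (W z w) (W y w)) -> (forall w, V w = G (W x w) (W z w)) ->
  (forall w, (W x w <= W z w <= N)%N ->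
    \sum_(j < N.+1) bridge x (W x w) y j z (W z w) * F (W x w) (W z w) j =
    G (W x w) (W z w)) ->
  is_cond_exp P (sigma_process I Z) X V.
Proof.
move=> mX mV XE VE FG.
have mVO : measurable_fun setT V.
  move=> _ U mU; suff /bridge_sigma[] : sigma_process I Z (setT `&` V @^-1` U) by [].
  by apply: mV; exists U.
pose J : finType := ('I_N.+1 * 'I_N.+1 * 'I_N.+1)%type.
pose A (i : J) := (W x @^-1` [set (i.1.1 : nat)] `&` W z @^-1` [set (i.1.2 : nat)]) `&`
  W y @^-1` [set (i.2 : nat)].
pose Bad := ~` (W x @^-1` [set j | (j <= N)%N]) `|` ~` (W y @^-1` [set j | (j <= N)%N])
  `|` ~` (W z @^-1` [set j | (j <= N)%N]).
have mA i : measurable (A i) by apply: measurableI => //; apply: measurableI.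
have mC u S : measurable (~` (W u @^-1` S)) by apply: measurableC.
have mBad : measurable Bad by apply: measurableU => //; apply: measurableU.
have Bad0 : prob P Bad = 0.
  have u0 u : 0 <= u <= 1 -> P (~` (W u @^-1` [set j | (j <= N)%N])) = 0%E.
    by move=> hu; have := probE P (mC u [set j | (j <= N)%N]); rewrite state_out.
  have hx1 : 0 <= x <= 1 by rewrite x0 (le_trans (ltW xy)) // (le_trans (ltW yz)).
  have hy1 : 0 <= y <= 1 by rewrite (le_trans x0 (ltW xy)) (le_trans (ltW yz)).
  have hz1 : 0 <= z <= 1 by rewrite z1 (le_trans x0) // (le_trans (ltW xy)) // ltW.
  rewrite /prob (measureU0 (measurableU _ _ (mC _ _) (mC _ _)) (mC _ _) (u0 _ hz1)).
  rewrite (measureU0 (mC _ _) (mC _ _) (u0 _ hy1)).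
  exact: (congr1 fine (u0 _ hx1)).
have decomp (H : nat -> nat -> nat -> R) w : ~ Bad w ->
    H (W x w) (W z w) (W y w) = \sum_(i : J) H i.1.1 i.1.2 i.2 * \1_(A i) w.
  move=> nB; have [hx hy hz] : [/\ (W x w < N.+1)%N, (W y w < N.+1)%N & (W z w < N.+1)%N].
    by split; rewrite ltnS; apply: contrapT => h; apply: nB; [left; left|left; right|right].
  pose i0 : J := (Ordinal hx, Ordinal hz, Ordinal hy).
  rewrite (bigD1 i0) //= big1 ?addr0; last first.
    move=> [[i j] l] /= hne; rewrite indicE memNset ?mulr0 // => -[[/= h1 h2] h3].
    case/negP: hne; apply/eqP; congr (_, _, _); apply: val_inj => /=.
    - exact/esym.
    - exact/esym.
    - exact/esym.
  by rewrite indicE mem_set ?mulr1.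
have XA w : ~ Bad w -> X w = \sum_(i : J) F i.1.1 i.1.2 i.2 * \1_(A i) w.
  by move=> nB; rewrite XE (decomp F).
have VA w : ~ Bad w -> V w = \sum_(i : J) G i.1.1 i.1.2 * \1_(A i) w.
  by move=> nB; rewrite VE (decomp (fun m n _ => G m n)).
split => //.
- exact: (integrable_finite_valued mA mX mBad Bad0 XA).
- exact: (integrable_finite_valued mA mVO mBad Bad0 VA).
- move=> E sE; have [mE hE] := bridge_sigma sE.
  rewrite (integral_finite_valued mA mX mBad Bad0 XA mE).
  rewrite (integral_finite_valued mA mVO mBad Bad0 VA mE); congr EFin.
  pose B (i : 'I_N.+1 * 'I_N.+1) :=
    W x @^-1` [set (i.1 : nat)] `&` W z @^-1` [set (i.2 : nat)].
  have EA (i : 'I_N.+1 * 'I_N.+1) (j : 'I_N.+1) : prob P (E `&` A (i, j)) =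
      prob P (E `&` B i) * bridge x i.1 y j z i.2.
    by rewrite setIA hE // -ltnS.
  rewrite -(pair_bigA _ (fun (i : 'I_N.+1 * 'I_N.+1) (j : 'I_N.+1) => G i.1 i.2 * prob P (E
    `&` A (i, j)))).
  rewrite -(pair_bigA _ (fun (i : 'I_N.+1 * 'I_N.+1) (j : 'I_N.+1) => F i.1 i.2 j * prob P (E
    `&` A (i, j)))) /=.
  apply: eq_bigr => -[m n] _ /=; under eq_bigr do rewrite EA.
  under [RHS]eq_bigr do rewrite EA.
  have [mn|nm] := leqP m n; last first.
    by rewrite !big1 // => j _; rewrite bridge_out ?mulr0 //=; apply/negP=> /andP[h1 h2];
      have := leq_trans h1 h2; rewrite leqNgt nm.
  have mnN : (m <= n <= N)%N by rewrite mn -ltnS ltn_ord.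
  rewrite -[RHS]/(\sum_(j < N.+1) _).
  rewrite -mulr_sumr -mulr_sumr (bridge_sum a_gt c_gt ac_gt x0 xy yz z1 mnN) mulr1.
  (* A point of the event realises the two end states, as [FG] demands; an empty event contributes
     nothing. *)
  have [->|/set0P[w [_ [hm hn]]]] := eqVneq (E `&` B (m, n)) set0.
    by rewrite prob_set0 mulr0 big1 // => j _; rewrite mul0r mulr0.
  have := FG w; rewrite (hm : W x w = m) (hn : W z w = n) => <- //.
  by rewrite mulr_suml; apply: eq_bigr => j _ /=; ring.
Qed.

End SigmaAlgebra.

End Bridge.

(** * The quadratic harness *)

Section HarnessMoments.
Context (R : realType) (N : nat) (a c v : R).
Hypotheses (a_gt : -1 < a) (c_gt : N.*2%:R - 1 < c) (ac_gt : 1 < a + c).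
Hypotheses (v0 : v != 0)
  (v2 : v ^+ 2 * (a + c - 1) = N%:R * (N%:R + a) * (N%:R - c) * (N%:R - a - c)).
Local Notation bridge := (bridge a c).
Local Notation height := (height N a c).

Definition xt (t : R) : R := t / (1 + t).

(** The value of the harness in state [k]. It is [height] scaled by [(1 + t) / v]: the factor
    [1 + t] turns functions affine in [x = t / (1 + t)] into functions affine in [t]. *)
Definition zval (t : R) (k : nat) : R :=
  (k%:R * (k%:R + a) + t * (k%:R * (c - k%:R) - N%:R * (c - N%:R))) / v.

(** [h_eta] and [h_theta] are the linear coefficients of [var_form] after its constant term, which
    is [v ^+ 2 * (a + c - 1)], has been scaled to 1. *)
Definition h_eta : R :=
  - ((N%:R - c) * (N%:R - a - c) + N%:R * (N%:R + a)) / (v * (a + c - 1)).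
Definition h_theta : R :=
  - (a * (N%:R - a - c) + N%:R * (N%:R *+ 2 - a - c *+ 2)) / (v * (a + c - 1)).
Definition h_sigma : R := (a + c - 1)^-1.

Lemma xt_gt0 t : 0 < t -> 0 < xt t.
Proof. by move=> t0; rewrite /xt divr_gt0 // addr_gt0. Qed.

Lemma xt_lt1 t : 0 < t -> xt t < 1.
Proof. by move=> t0; rewrite /xt ltr_pdivrMr ?mul1r ?ltrDr ?addr_gt0 //; lra. Qed.

Lemma xt_lt s t : 0 < s -> s < t -> xt s < xt t.
Proof.
move=> s0 st; have t0 := lt_trans s0 st.
rewrite /xt ltr_pdivrMr ?addr_gt0 // mulrAC ltr_pdivlMr ?addr_gt0 //.
by rewrite !mulrDr !mulr1 (mulrC t) ltrD2r.
Qed.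

Lemma xt_le s t : 0 < s -> s <= t -> xt s <= xt t.
Proof. by move=> s0; rewrite le_eqVlt => /orP[/eqP -> //|st]; apply/ltW/xt_lt. Qed.

Lemma zvalE t k : 0 < t -> zval t k = (1 + t) / v * height (xt t) k.
Proof.
by move=> t0; rewrite /zval /height /xt; field; rewrite v0 /= gt_eqF ?addr_gt0.
Qed.

Lemma height00 : height 0 0 = 0. Proof. by rewrite /height; ring. Qed.
Lemma height1N : height 1 N = 0. Proof. by rewrite /height; ring. Qed.

Lemma zval_mean s t u m n : 0 < s -> s < t -> t < u -> (m <= n <= N)%N ->
  \sum_(j < N.+1) bridge (xt s) m (xt t) j (xt u) n * zval t j =
  (u - t) / (u - s) * zval s m + (t - s) / (u - s) * zval u n.
Proof.
move=> s0 st tu mnN; have t0 := lt_trans s0 st; have u0 := lt_trans t0 tu.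
rewrite (eq_bigr (fun j : 'I_N.+1 =>
    (1 + t) / v * (bridge (xt s) m (xt t) j (xt u) n * height (xt t) j))); last first.
  by move=> j _; rewrite zvalE //; ring.
rewrite -mulr_sumr (bridge_mean a_gt c_gt ac_gt) ?xt_lt ?(ltW (xt_gt0 _)) ?(ltW (xt_lt1 _)) //.
rewrite !zvalE // /xt; move: (height _ _) (height _ _) => H K.
have e1 : 1 + s != 0 by rewrite gt_eqF ?addr_gt0.
have e2 : 1 + t != 0 by rewrite gt_eqF ?addr_gt0.
have e3 : 1 + u != 0 by rewrite gt_eqF ?addr_gt0.
have e4 : u - s != 0 by rewrite gt_eqF // subr_gt0 (lt_trans st).
have e5 : u / (1 + u) - s / (1 + s) != 0.
  by rewrite gt_eqF // subr_gt0 xt_lt // (lt_trans st).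
have e6 : u / (1 + u) - s / (1 + s) = (u - s) / ((1 + u) * (1 + s)).
  by field; rewrite e1 e3.
by rewrite e6; field; rewrite v0 e1 e2 e3 e4.
Qed.

(** The right end [x = 1] corresponds to infinite [t], where [zval] has no value; [height] does have
    one there, namely 0 in state [N]. *)
Lemma zval_mean_right s t m : 0 < s -> s < t -> (m <= N)%N ->
  \sum_(j < N.+1) bridge (xt s) m (xt t) j 1 N * zval t j = zval s m.
Proof.
move=> s0 st mN; have t0 := lt_trans s0 st.
rewrite (eq_bigr (fun j : 'I_N.+1 =>
    (1 + t) / v * (bridge (xt s) m (xt t) j 1 N * height (xt t) j))); last first.
  by move=> j _; rewrite zvalE //; ring.
rewrite -mulr_sumr (bridge_mean a_gt c_gt ac_gt) ?mN ?leqnn ?xt_lt ?xt_lt1 ?(ltW (xt_gt0 _)) //.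
rewrite !zvalE // height1N /xt; move: (height _ _) => H.
have e1 : 1 + s != 0 by rewrite gt_eqF ?addr_gt0.
have e2 : 1 + t != 0 by rewrite gt_eqF ?addr_gt0.
have e6 : 1 - s / (1 + s) = (1 + s)^-1 by field.
by rewrite e6; field; rewrite v0 e1 e2.
Qed.

Lemma zval_mean_left t u n : 0 < t -> t < u -> (n <= N)%N ->
  \sum_(j < N.+1) bridge 0 0 (xt t) j (xt u) n * zval t j = t / u * zval u n.
Proof.
move=> t0 tu nN; have u0 := lt_trans t0 tu.
rewrite (eq_bigr (fun j : 'I_N.+1 =>
    (1 + t) / v * (bridge 0 0 (xt t) j (xt u) n * height (xt t) j))); last first.
  by move=> j _; rewrite zvalE //; ring.
rewrite -mulr_sumr (bridge_mean a_gt c_gt ac_gt) ?nN ?xt_gt0 ?xt_lt ?(ltW (xt_lt1 _)) //.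
rewrite !zvalE // height00 /xt; move: (height _ _) => H.
have e2 : 1 + t != 0 by rewrite gt_eqF ?addr_gt0.
have e3 : 1 + u != 0 by rewrite gt_eqF ?addr_gt0.
have e4 : u != 0 by rewrite gt_eqF.
by field; rewrite v0 e2 e3 e4.
Qed.

Lemma zval_mean0 t : 0 < t -> \sum_(j < N.+1) bridge 0 0 (xt t) j 1 N * zval t j = 0.
Proof.
move=> t0; rewrite (eq_bigr (fun j : 'I_N.+1 =>
    (1 + t) / v * (bridge 0 0 (xt t) j 1 N * height (xt t) j))); last first.
  by move=> j _; rewrite zvalE //; ring.
rewrite -mulr_sumr (bridge_mean a_gt c_gt ac_gt) ?leqnn ?xt_gt0 ?xt_lt1 //.
by rewrite height00 height1N; ring.
Qed.

Let var_formE I S : var_form N a c I S =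
  (a + c - 1) * (v ^+ 2 + h_eta * v * I + h_theta * v * S) + (I + S) ^+ 2.
Proof.
have e : a + c - 1 != 0 by have h := ac_gt; rewrite gt_eqF //; lra.
rewrite /var_form -v2 /h_eta /h_theta.
move: ((N%:R - c) * (N%:R - a - c) + N%:R * (N%:R + a)) => X.
move: (a * (N%:R - a - c) + N%:R * (N%:R *+ 2 - a - c *+ 2)) => Y.
by move: (a + c - 1) e => k e; field; rewrite v0 e.
Qed.

(** With [tau = sigma] and [gamma = 1 + 2 * sigma], the three quadratic terms of [harness_var] add
    up to [sigma] times the square of intercept plus slope, which is the square in [var_form]. *)
Lemma zval_var s t u m n : 0 < s -> s < t -> t < u -> (m <= n <= N)%N ->
  \sum_(j < N.+1) bridge (xt s) m (xt t) j (xt u) n *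
    (zval t j - ((u - t) / (u - s) * zval s m + (t - s) / (u - s) * zval u n)) ^+ 2 =
  harness_var h_eta h_theta h_sigma h_sigma (1 + 2 * h_sigma) s t u (zval s m) (zval u n).
Proof.
move=> s0 st tu mnN; have t0 := lt_trans s0 st; have u0 := lt_trans t0 tu.
have e1 : 1 + s != 0 by rewrite gt_eqF ?addr_gt0.
have e2 : 1 + t != 0 by rewrite gt_eqF ?addr_gt0.
have e3 : 1 + u != 0 by rewrite gt_eqF ?addr_gt0.
have e4 : u - s != 0 by rewrite gt_eqF // subr_gt0 (lt_trans st).
have e6 : xt u - xt s = (u - s) / ((1 + u) * (1 + s)).
  by rewrite /xt; field; rewrite e1 e3.
have e7 : a + c - 1 != 0 by have h := ac_gt; rewrite gt_eqF //; lra.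
rewrite (eq_bigr (fun j : 'I_N.+1 => ((1 + t) / v) ^+ 2 *
    (bridge (xt s) m (xt t) j (xt u) n * (height (xt t) j -
      ((xt u - xt t) * height (xt s) m + (xt t - xt s) * height (xt u) n) / (xt u - xt s)) ^+
        2)));
  last first.
  move=> j _; rewrite !zvalE // e6 /xt.
  move: (bridge _ _ _ _ _ _) (height _ _) (height _ _) (height _ _) => b h1 h2 h3.
  by field; rewrite v0 e1 e2 e3 e4.
rewrite -mulr_sumr (bridge_var a_gt c_gt ac_gt) ?xt_lt ?(ltW (xt_gt0 _)) ?(ltW (xt_lt1 _)) //.
have den := lt0r_neq0 (den_gt0 ac_gt (ltW (xt_gt0 s0)) (xt_lt s0 (lt_trans st tu)) (ltW
  (xt_lt1 u0))).
have denE : (a + c) * (xt u - xt s) + (1 - xt s *+ 2) * (1 - xt u *+ 2) =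
   ((a + c) * (u - s) + (1 - s) * (1 - u)) / ((1 + s) * (1 + u)).
  by rewrite /xt; field; rewrite e1 e3.
have den' : (a + c) * (u - s) + (1 - s) * (1 - u) != 0.
  by apply: contraNneq den; rewrite denE => ->; rewrite mul0r.
have denE' : u * (1 + h_sigma * s) + h_sigma - (1 + 2 * h_sigma) * s =
   ((a + c) * (u - s) + (1 - s) * (1 - u)) / (a + c - 1).
  by rewrite /h_sigma; field.
rewrite var_formE denE e6 !zvalE // /harness_var denE' /h_sigma.
move: den' e7; move: ((a + c) * (u - s) + (1 - s) * (1 - u)) => D D0.
move: (a + c - 1) h_eta h_theta (height _ _) (height _ _) => k et th H K k0.
rewrite /xt; field.
by rewrite v0 e1 e2 e3 e4 D0 k0.
Qed.

Lemma zval_var_right s t m : 0 < s -> s < t -> (m <= N)%N ->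
  \sum_(j < N.+1) bridge (xt s) m (xt t) j 1 N * (zval t j - zval s m) ^+ 2 =
  (t - s) / (1 + h_sigma * s) * (h_sigma * zval s m ^+ 2 + h_eta * zval s m + 1).
Proof.
move=> s0 st mN; have t0 := lt_trans s0 st.
have e1 : 1 + s != 0 by rewrite gt_eqF ?addr_gt0.
have e2 : 1 + t != 0 by rewrite gt_eqF ?addr_gt0.
have e6 : 1 - xt s = (1 + s)^-1 by rewrite /xt; field.
have e7 : 0 < a + c - 1 by have h := ac_gt; lra.
rewrite (eq_bigr (fun j : 'I_N.+1 => ((1 + t) / v) ^+ 2 *
    (bridge (xt s) m (xt t) j 1 N * (height (xt t) j -
      ((1 - xt t) * height (xt s) m + (xt t - xt s) * height 1 N) / (1 - xt s)) ^+ 2)));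
  last first.
  move=> j _; rewrite !zvalE // height1N e6 /xt.
  move: (bridge _ _ _ _ _ _) (height _ _) (height _ _) => b h1 h2.
  by field; rewrite v0 e1 e2.
rewrite -mulr_sumr (bridge_var a_gt c_gt ac_gt) ?mN ?leqnn ?xt_lt ?xt_lt1 ?(ltW (xt_gt0 _)) //.
have denE : (a + c) * (1 - xt s) + (1 - xt s *+ 2) * (1 - 1 *+ 2) =
   (a + c - 1 + s) / (1 + s).
  by rewrite /xt; field.
have e8 : a + c - 1 + s != 0 := lt0r_neq0 (addr_gt0 e7 s0).
rewrite var_formE denE e6 !zvalE // /h_sigma height1N.
move: (lt0r_neq0 e7) e8; move: (a + c - 1) h_eta h_theta (height _ _) => k et th H k0 e8.
have e9 : 1 + k^-1 * s = (k + s) / k by field.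
rewrite e9 /xt; field.
by rewrite v0 e1 e2 e8 k0.
Qed.

Lemma zval_var_left t u n : 0 < t -> t < u -> (n <= N)%N ->
  \sum_(j < N.+1) bridge 0 0 (xt t) j (xt u) n * (zval t j - t / u * zval u n) ^+ 2 =
  (t * (u - t)) / (u + h_sigma) *
    (h_sigma * (zval u n ^+ 2 / u ^+ 2) + h_theta * (zval u n / u) + 1).
Proof.
move=> t0 tu nN; have u0 := lt_trans t0 tu.
have e2 : 1 + t != 0 by rewrite gt_eqF ?addr_gt0.
have e3 : 1 + u != 0 by rewrite gt_eqF ?addr_gt0.
have e4 : u != 0 by rewrite gt_eqF.
have e7 : 0 < a + c - 1 by have h := ac_gt; lra.
rewrite (eq_bigr (fun j : 'I_N.+1 => ((1 + t) / v) ^+ 2 *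
    (bridge 0 0 (xt t) j (xt u) n * (height (xt t) j -
      ((xt u - xt t) * height 0 0 + (xt t - 0) * height (xt u) n) / (xt u - 0)) ^+ 2)));
  last first.
  move=> j _; rewrite !zvalE // height00 !subr0 /xt.
  move: (bridge _ _ _ _ _ _) (height _ _) (height _ _) => b h1 h2.
  by field; rewrite v0 e2 e3 e4.
rewrite -mulr_sumr (bridge_var a_gt c_gt ac_gt) ?nN ?xt_gt0 ?xt_lt ?(ltW (xt_lt1 _)) //.
have denE : (a + c) * (xt u - 0) + (1 - 0 *+ 2) * (1 - xt u *+ 2) =
   ((a + c - 1) * u + 1) / (1 + u).
  by rewrite /xt; field.
have e8 : (a + c - 1) * u + 1 != 0 := lt0r_neq0 (addr_gt0 (mulr_gt0 e7 u0) ltr01).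
rewrite var_formE denE !zvalE // /h_sigma height00 !subr0.
move: (lt0r_neq0 e7) e8; move: (a + c - 1) h_eta h_theta (height _ _) => k et th H k0 e8.
have e9 : u + k^-1 = (k * u + 1) / k by field.
rewrite e9 /xt; field.
by rewrite v0 e2 e3 e4 e8 k0.
Qed.

(** This is the normalisation that fixes [v]: with both ends at height 0, [var_form] reduces to its
    constant term. *)
Lemma zval_var0 t : 0 < t -> \sum_(j < N.+1) bridge 0 0 (xt t) j 1 N * zval t j ^+ 2 = t.
Proof.
move=> t0; have e2 : 1 + t != 0 by rewrite gt_eqF ?addr_gt0.
have e7 : a + c - 1 != 0 by have h := ac_gt; rewrite gt_eqF //; lra.
rewrite (eq_bigr (fun j : 'I_N.+1 => ((1 + t) / v) ^+ 2 *
    (bridge 0 0 (xt t) j 1 N * (height (xt t) j -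
      ((1 - xt t) * height 0 0 + (xt t - 0) * height 1 N) / (1 - 0)) ^+ 2))); last first.
  by move=> j _; rewrite !zvalE // height00 height1N !mulr0 addr0 mul0r subr0; ring.
rewrite -mulr_sumr (bridge_var a_gt c_gt ac_gt) ?leqnn ?xt_gt0 ?xt_lt1 //.
have denE : (a + c) * (1 - 0) + (1 - 0 *+ 2) * (1 - 1 *+ 2) = a + c - 1 by ring.
rewrite var_formE denE height00 height1N.
move: (a + c - 1) e7 h_eta h_theta => k k0 et th.
by rewrite /xt; field; rewrite v0 e2 k0.
Qed.

(** The state can be recovered from the value of [Z], which the Markov property of [Z] relies on.
    Two heights differ by [n - m] times [b + e (m + n)], and [pt_gt0] applies as [m + n < 2 N]. *)
Lemma zval_inj t m n : 0 < t -> (m <= N)%N -> (n <= N)%N -> zval t m = zval t n -> m = n.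
Proof.
move=> t0; wlog mn : m n / (m <= n)%N.
  by move=> h mN nN e; case/orP: (leq_total m n) => ?; [apply: h|apply/esym/h].
move=> mN nN; have nz : (1 + t) / v != 0.
  by rewrite mulf_neq0 ?invr_eq0 // gt_eqF // addr_gt0.
rewrite !zvalE // => /(mulfI nz) e; apply/eqP; rewrite eqn_leq mn leqNgt; apply/negP => lt_mn.
have t1 : 0 <= xt t <= 1 by rewrite !ltW ?xt_gt0 ?xt_lt1.
have := @pt_gt0 _ N a c a_gt c_gt (xt t) (m + n) t1 ltac:(clear -lt_mn nN; lia).
have nm : 0 < n%:R - m%:R :> R by rewrite subr_gt0 ltr_nat.
rewrite -(pmulr_rgt0 _ nm) => h.
have : height (xt t) n - height (xt t) m =
    (n%:R - m%:R) * ((pt a c (xt t)).1 + (pt a c (xt t)).2 * (m + n)%:R).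
  by rewrite /height /= natrD; ring.
by rewrite e subrr => h'; rewrite -h' ltxx in h.
Qed.

End HarnessMoments.

Section SigmaProcess.
Context (R : realType) d (Omega : measurableType d) (I : set R) (Z : R -> Omega -> R).

Definition generators := \bigcup_(t in I) preimage_set_system setT (Z t) measurable.

Lemma measurable_generators t : I t ->
  measurable_fun [set: g_sigma_algebraType generators] (Z t).
Proof.
by move=> It _ U mU; apply: sub_sigma_algebra; exists t => //; exists U.
Qed.

Lemma preimage_sigma_process (V : Omega -> R) :
  measurable_fun [set: g_sigma_algebraType generators] V ->
  preimage_set_system setT V measurable `<=` sigma_process I Z.
Proof. by move=> mV _ [U mU <-]; apply: mV. Qed.

Lemma is_cond_exp_id (P : probability Omega R) (X : Omega -> R) :
  P.-integrable setT (EFin \o X) ->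
  preimage_set_system setT X measurable `<=` sigma_process I Z ->
  is_cond_exp P (sigma_process I Z) X X.
Proof. by move=> iX mX; split. Qed.

End SigmaProcess.

Ltac measurable_poly := repeat first
  [ by apply: measurable_generators | exact: measurable_cst
  | apply: measurable_funB | apply: measurable_funD
  | apply: measurable_funX | apply: measurable_funM ].

(** * The harness and Markov properties of [Z] *)

Section HarnessProcess.
Context (R : realType) (N : nat) (a c v : R).
Hypotheses (a_gt : -1 < a) (c_gt : N.*2%:R - 1 < c) (ac_gt : 1 < a + c).
Hypotheses (v0 : v != 0)
  (v2 : v ^+ 2 * (a + c - 1) = N%:R * (N%:R + a) * (N%:R - c) * (N%:R - a - c)).
Context d (Omega : measurableType d) (P : probability Omega R).
Context (W : R -> Omega -> nat) (Z : R -> Omega -> R).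
Local Notation bridge := (bridge a c).
Local Notation qk := (qk a c).
Local Notation path_weight := (path_weight a c).
Local Notation zval := (zval N a c v).
Hypotheses (mW : forall x, measurable_fun setT (W x))
  (W0 : forall w, W 0 w = 0%N) (W1 : forall w, W 1 w = N)
  (W_fdd : forall (s : seq R) k, path <%R 0 (rcons s 1) -> k 0 = 0%N -> k 1 = N ->
    prob P (cylinder W s k) = path_weight k 0 (rcons s 1) / qk 0 0 1 N).
Hypothesis (ZE : forall t, 0 < t -> Z t = zval t \o W (xt t)).

Let T : set R := [set t | 0 < t].

Lemma measurable_fun_state (h : nat -> R) x : measurable_fun setT (h \o W x).
Proof. exact: measurableT_comp. Qed.

Lemma measurable_Z t : 0 < t -> measurable_fun setT (Z t).
Proof. by move=> t0; rewrite ZE //; apply: measurable_fun_state. Qed.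

(** A plain expectation is a conditional one for the process indexed by the empty set, with the
    deterministic ends 0 and 1 as conditioning times. *)
Lemma expect_state (h : nat -> R) x : 0 < x < 1 ->
  P.-integrable setT (EFin \o (h \o W x)) /\
  (\int[P]_w ((h \o W x) w)%:E = (\sum_(j < N.+1) bridge 0 0 x j 1 N * h j)%:E)%E.
Proof.
move=> /andP[x0 x1]; set m := \sum_(j < _) _.
pose Z0 : R -> Omega -> R := fun=> fun=> 0.
have [iX _ _ hE] : is_cond_exp P (sigma_process set0 Z0) (h \o W x) (fun=> m).
  apply: (is_cond_exp_bridge a_gt c_gt ac_gt mW W0 W1 W_fdd (lexx 0) x0 x1 (lexx 1)
    (f := id) (g := fun=> fun=> 0) _ _
    (F := fun _ _ j => h j) (G := fun _ _ => m)) => //.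
  - exact: measurable_fun_state.
  - by apply: preimage_sigma_process; apply: measurable_cst.
  - by move=> w _; rewrite W0 W1.
split=> //; rewrite -hE; first by rewrite integral_cst //= probability_setT mule1.
exact: (@measurableT _ (g_sigma_algebraType (generators set0 Z0))).
Qed.

Section TwoSided.
Variables (s t u : R).
Hypotheses (s0 : 0 < s) (st : s < t) (tu : t < u).
Let F_out := sigma_process [set r | T r /\ (r <= s \/ u <= r)] Z.
Let t0 : 0 < t. Proof. exact: lt_trans st. Qed.
Let u0 : 0 < u. Proof. exact: lt_trans tu. Qed.

Lemma two_sided (F : nat -> nat -> nat -> R) (G : nat -> nat -> R) X V :
  measurable_fun setT X -> preimage_set_system setT V measurable `<=` F_out ->
  (forall w, X w = F (W (xt s) w) (W (xt u) w) (W (xt t) w)) ->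
  (forall w, V w = G (W (xt s) w) (W (xt u) w)) ->
  (forall m n, (m <= n <= N)%N ->
    \sum_(j < N.+1) bridge (xt s) m (xt t) j (xt u) n * F m n j = G m n) ->
  is_cond_exp P F_out X V.
Proof.
move=> mX mV XE VE FG.

apply: (is_cond_exp_bridge a_gt c_gt ac_gt mW W0 W1 W_fdd (ltW (xt_gt0 s0)) (xt_lt s0 st)
  (xt_lt t0 tu) (ltW (xt_lt1 u0)) (f := @xt R) (g := zval) _ _ mX mV XE VE).
- by move=> r [r0 _]; apply: ZE.
- move=> r [r0 h]; rewrite xt_gt0 // xt_lt1 //; split=> //.
  by case: h => h; [left|right]; apply: xt_le.
- by move=> w /FG.
Qed.

Let Is : T s /\ (s <= s \/ u <= s). Proof. by split=> //; left. Qed.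
Let Iu : T u /\ (u <= s \/ u <= u). Proof. by split=> //; right. Qed.

Lemma two_sided_mean : is_cond_exp P F_out (Z t)
  (fun w => (u - t) / (u - s) * Z s w + (t - s) / (u - s) * Z u w).
Proof.
apply: (two_sided (F := fun _ _ j => zval t j)
  (G := fun m n => (u - t) / (u - s) * zval s m + (t - s) / (u - s) * zval u n)).
- exact: measurable_Z.
- by apply: preimage_sigma_process; measurable_poly.
- by move=> w; rewrite ZE.
- by move=> w; rewrite !ZE.
- by move=> m n mn; apply: zval_mean.
Qed.

Lemma two_sided_var : is_cond_var P F_out (Z t)
  (fun w => harness_var (h_eta N a c v) (h_theta N a c v) (h_sigma a c) (h_sigma a c)
     (1 + 2 * h_sigma a c) s t u (Z s w) (Z u w)).
Proof.
exists (fun w => (u - t) / (u - s) * Z s w + (t - s) / (u - s) * Z u w).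
  exact: two_sided_mean.
apply: (two_sided (F := fun m n j => (zval t j - ((u - t) / (u - s) * zval s m +
     (t - s) / (u - s) * zval u n)) ^+ 2)
  (G := fun m n => harness_var (h_eta N a c v) (h_theta N a c v) (h_sigma a c) (h_sigma a c)
     (1 + 2 * h_sigma a c) s t u (zval s m) (zval u n))).
- by measurable_poly; apply: measurable_Z.
- by apply: preimage_sigma_process; rewrite /harness_var; measurable_poly.
- by move=> w; rewrite !ZE.
- by move=> w; rewrite !ZE.
- by move=> m n mn; apply: zval_var.
Qed.

End TwoSided.

Section RightSided.
Variables (s t : R) (I : set R).
Hypotheses (s0 : 0 < s) (st : s < t) (Is : I s) (IT : forall r, I r -> 0 < r <= s).
Let F_le := sigma_process I Z.
Let t0 : 0 < t. Proof. exact: lt_trans st. Qed.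

(** [I] is any set of times up to [s] that contains [s]: the whole past serves the harness, the
    singleton serves the covariance, and the Markov property compares the two. *)
Lemma right_sided (F : nat -> nat -> R) (G : nat -> R) X V :
  measurable_fun setT X -> preimage_set_system setT V measurable `<=` F_le ->
  (forall w, X w = F (W (xt s) w) (W (xt t) w)) -> (forall w, V w = G (W (xt s) w)) ->
  (forall m, (m <= N)%N -> \sum_(j < N.+1) bridge (xt s) m (xt t) j 1 N * F m j = G m) ->
  is_cond_exp P F_le X V.
Proof.
move=> mX mV XE VE FG.
apply: (is_cond_exp_bridge a_gt c_gt ac_gt mW W0 W1 W_fdd (ltW (xt_gt0 s0)) (xt_lt s0 st)
  (xt_lt1 t0) (lexx 1) (f := @xt R) (g := zval) (F := fun m _ j => F m j) (G := fun m _ => G m)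
  _ _ mX mV XE VE).
- by move=> r /IT /andP[r0 _]; apply: ZE.
- move=> r /IT /andP[r0 h]; rewrite xt_gt0 // xt_lt1 //; split=> //.
  by left; apply: xt_le.
- by move=> w; rewrite W1 => /andP[/FG].
Qed.

Lemma right_mean : is_cond_exp P F_le (Z t) (Z s).
Proof.
apply: (right_sided (F := fun _ j => zval t j) (G := fun m => zval s m)).
- exact: measurable_Z.
- by apply: preimage_sigma_process; measurable_poly.
- by move=> w; rewrite ZE.
- by move=> w; rewrite !ZE.
- by move=> m mn; apply: zval_mean_right.
Qed.

Lemma right_var : is_cond_var P F_le (Z t)
  (fun w => (t - s) / (1 + h_sigma a c * s) *
    (h_sigma a c * Z s w ^+ 2 + h_eta N a c v * Z s w + 1)).
Proof.
exists (Z s); first exact: right_mean.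
apply: (right_sided (F := fun m j => (zval t j - zval s m) ^+ 2)
  (G := fun m => (t - s) / (1 + h_sigma a c * s) *
    (h_sigma a c * zval s m ^+ 2 + h_eta N a c v * zval s m + 1))).
- by measurable_poly; apply: measurable_Z.
- by apply: preimage_sigma_process; measurable_poly.
- by move=> w; rewrite !ZE.
- by move=> w; rewrite !ZE.
- by move=> m mn; apply: zval_var_right.
Qed.

(** The version does not depend on [I]. It is a function of [Z s], built from indicators of the
    values [zval s m], which are distinct by [zval_inj]. *)
Lemma right_markov (V : set R) : measurable V ->
  let h m := \sum_(j < N.+1) bridge (xt s) m (xt t) j 1 N * \1_V (zval t j) in
  is_cond_exp P F_le (\1_(Z t @^-1` V))
    (fun w => \sum_(m < N.+1) h m * \1_[set zval s m] (Z s w)).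
Proof.
move=> mV h.
apply: (right_sided (F := fun _ j => \1_V (zval t j))
  (G := fun m => \sum_(m' < N.+1) h m' * \1_[set zval s m'] (zval s m))).
- apply: measurable_indic; rewrite -[X in measurable X]setTI.
  by apply: measurable_Z.
- apply: preimage_sigma_process; apply: measurable_sum => m.
  apply: measurable_funM; first exact: measurable_cst.
  apply: measurableT_comp; last exact: measurable_generators.
  exact: measurable_indic.
- by move=> w; rewrite !indicE /= ZE.
- by move=> w; rewrite ZE.
- move=> m mN; have hm : (m < N.+1)%N by [].
  rewrite [RHS](bigD1 (Ordinal hm)) //= [X in _ + X]big1 ?addr0;
    first by rewrite indicE mem_set ?mulr1.
  move=> i ne; rewrite indicE memNset ?mulr0 //= => e.
  case/negP: ne; apply/eqP/val_inj => /=; apply/esym.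
  by apply: (zval_inj a_gt c_gt v0 s0 _ _ e) => //; rewrite -ltnS.
Qed.

End RightSided.

Section LeftSided.
Variables (t u : R).
Hypotheses (t0 : 0 < t) (tu : t < u).
Let F_ge := sigma_process [set r | T r /\ u <= r] Z.
Let u0 : 0 < u. Proof. exact: lt_trans tu. Qed.
Let Iu : T u /\ u <= u. Proof. by split. Qed.

Lemma left_sided (F : nat -> nat -> R) (G : nat -> R) X V :
  measurable_fun setT X -> preimage_set_system setT V measurable `<=` F_ge ->
  (forall w, X w = F (W (xt u) w) (W (xt t) w)) -> (forall w, V w = G (W (xt u) w)) ->
  (forall n, (n <= N)%N -> \sum_(j < N.+1) bridge 0 0 (xt t) j (xt u) n * F n j = G n) ->
  is_cond_exp P F_ge X V.
Proof.
move=> mX mV XE VE FG.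
apply: (is_cond_exp_bridge a_gt c_gt ac_gt mW W0 W1 W_fdd (lexx 0) (xt_gt0 t0)
  (xt_lt t0 tu) (ltW (xt_lt1 u0)) (f := @xt R) (g := zval) (F := fun _ n j => F n j)
  (G := fun _ n => G n) _ _ mX mV XE VE).
- by move=> r [r0 _]; apply: ZE.
- move=> r [r0 h]; rewrite xt_gt0 // xt_lt1 //; split=> //.
  by right; apply: xt_le.
- by move=> w; rewrite W0 => /andP[_ /FG].
Qed.

Lemma left_mean : is_cond_exp P F_ge (Z t) (fun w => t / u * Z u w).
Proof.
apply: (left_sided (F := fun _ j => zval t j) (G := fun n => t / u * zval u n)).
- exact: measurable_Z.
- by apply: preimage_sigma_process; measurable_poly.
- by move=> w; rewrite ZE.
- by move=> w; rewrite !ZE.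
- by move=> m mn; apply: zval_mean_left.
Qed.

Lemma left_var : is_cond_var P F_ge (Z t)
  (fun w => (t * (u - t)) / (u + h_sigma a c) *
    (h_sigma a c * (Z u w ^+ 2 / u ^+ 2) + h_theta N a c v * (Z u w / u) + 1)).
Proof.
exists (fun w => t / u * Z u w); first exact: left_mean.
apply: (left_sided (F := fun n j => (zval t j - t / u * zval u n) ^+ 2)
  (G := fun n => (t * (u - t)) / (u + h_sigma a c) *
    (h_sigma a c * (zval u n ^+ 2 / u ^+ 2) + h_theta N a c v * (zval u n / u) + 1))).
- by measurable_poly; apply: measurable_Z.
- by apply: preimage_sigma_process; measurable_poly.
- by move=> w; rewrite !ZE.
- by move=> w; rewrite !ZE.
- by move=> m mn; apply: zval_var_left.
Qed.

End LeftSided.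

Lemma xt_itv (t : R) : 0 < t -> 0 < xt t < 1.
Proof. by move=> t0; rewrite xt_gt0 // xt_lt1. Qed.

Lemma Z_mean t : 0 < t -> ('E_P[Z t] = 0%:E)%E.
Proof.
move=> t0; rewrite unlock ZE //; have [_ ->] := expect_state (zval t) (xt_itv t0).
by rewrite (zval_mean0 a_gt c_gt ac_gt v0).
Qed.

Lemma integrable_Z t : 0 < t -> P.-integrable setT (EFin \o Z t).
Proof. by move=> t0; rewrite ZE //; have [] := expect_state (zval t) (xt_itv t0). Qed.

Lemma Z_square t : 0 < t ->
  P.-integrable setT (EFin \o (fun w => Z t w ^+ 2)) /\
  (\int[P]_w (Z t w ^+ 2)%:E = t%:E)%E.
Proof.
move=> t0; rewrite ZE //; have [iZ eZ] := expect_state (fun j => zval t j ^+ 2) (xt_itv t0).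
by split=> //; rewrite eZ (zval_var0 a_gt c_gt ac_gt v0 v2).
Qed.

(** Conditioning on [Z s] replaces [Z t] by [Z s], so the covariance is the second moment at the
    earlier time. *)
Lemma Z_product (s t : R) : 0 < s -> s < t -> (\int[P]_w (Z s w * Z t w)%:E = s%:E)%E.
Proof.
move=> s0 st; have t0 := lt_trans s0 st.
rewrite -(Z_square s0).2.
have [_ _ _ hE] : is_cond_exp P (sigma_process [set s] Z) (fun w => Z s w * Z t w)
    (fun w => Z s w ^+ 2).
  apply: (right_sided (I := [set s]) s0 st _ _ (F := fun m j => zval s m * zval t j)
    (G := fun m => zval s m ^+ 2)).
  - by move=> r ->; rewrite s0 lexx.
  - by apply: measurable_funM; apply: measurable_Z.
  - by apply: preimage_sigma_process; measurable_poly.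
  - by move=> w; rewrite !ZE.
  - by move=> w; rewrite !ZE.
  - move=> m mN; rewrite expr2 -{3}(zval_mean_right a_gt c_gt ac_gt v0 s0 st mN) mulr_sumr.
    by apply: eq_bigr => j _; rewrite mulrCA.
rewrite hE //; exact: (@measurableT _ (g_sigma_algebraType (generators [set s] Z))).
Qed.

Lemma Z_covariance (s t : R) : 0 < s -> 0 < t ->
  ('E_P[(fun w => Z s w * Z t w)%R] = (Num.min s t)%:E)%E.
Proof.
move=> s0 t0; rewrite unlock.
wlog : s t s0 t0 / s <= t.
  move=> h; case/orP: (le_total s t) => st; first exact: h.
  by rewrite minC -(h t s) //; apply: eq_integral => w _; rewrite mulrC.
move=> st; rewrite (min_idPl st); move: st; rewrite le_eqVlt => /orP[/eqP <-|st].
  exact: (Z_square s0).2.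
exact: Z_product.
Qed.

Lemma harness_process : quadratic_harness P T Z (h_eta N a c v) (h_theta N a c v)
  (h_sigma a c) (h_sigma a c) (1 + 2 * h_sigma a c).
Proof.
split.
- split=> //.
  by move=> x y /= x0 _ z /andP[xz _]; apply: lt_le_trans xz.
- split=> t t0; first exact: measurable_Z.
  exact: (Z_square t0).1.
- by split=> [t|s t]; [exact: Z_mean|exact: Z_covariance].
- move=> s t u s0 t0 u0 st tu; split; [exact: two_sided_mean|exact: two_sided_var].
- move=> s t u s0 t0 u0 st tu.
  (* When [t] is one of the conditioning times, [Z t] is known and the prefactor of the variance
     vanishes. *)
  have zero_var I r (k : R) V : 0 < r -> I r -> k = 0 ->
      is_cond_var P (sigma_process I Z) (Z r) (fun w => k * V w).
    move=> r0 Ir ->; exists (Z r).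
      apply: is_cond_exp_id; first exact: integrable_Z.
      by apply: preimage_sigma_process; measurable_poly.
    have e0 (U : Omega -> R) : (forall w, U w = 0) -> U = cst 0 by move=> h; apply/funext.
    rewrite [X in is_cond_exp _ _ X _]e0; last by move=> w; rewrite subrr expr0n.
    rewrite [X in is_cond_exp _ _ _ X]e0; last by move=> w; rewrite mul0r.
    apply: is_cond_exp_id; first exact: integrable0.
    by apply: preimage_sigma_process; measurable_poly.
  split.
  + move: tu; rewrite le_eqVlt => /orP[/eqP <-|tu]; last exact: left_mean.
    rewrite (_ : (fun w => _) = Z t); last first.
      by apply/funext => w; rewrite mulfV ?mul1r // gt_eqF.
    apply: is_cond_exp_id; first exact: integrable_Z.
    by apply: preimage_sigma_process; apply: measurable_generators.
  + move: st; rewrite le_eqVlt => /orP[/eqP <-|st].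
      apply: is_cond_exp_id; first exact: integrable_Z.
      by apply: preimage_sigma_process; apply: measurable_generators.
    by apply: right_mean => // r [r0 rs]; rewrite r0.
  + move: st; rewrite le_eqVlt => /orP[/eqP <-|st].
      by apply: zero_var => //; rewrite subrr mul0r.
    by apply: right_var => // r [r0 rs]; rewrite r0.
  + move: tu; rewrite le_eqVlt => /orP[/eqP <-|tu]; last exact: left_var.
    by apply: zero_var => //; rewrite subrr mulr0 mul0r.
Qed.

Lemma markov_process_Z : markov_process P T Z.
Proof.
move=> s t V s0 t0 st mV.
exists (fun w => \sum_(m < N.+1) (\sum_(j < N.+1) bridge (xt s) m (xt t) j 1 N *
  \1_V (zval t j)) * \1_[set zval s m] (Z s w)).
  by apply: right_markov => // r [r0 rs]; rewrite r0.
by apply: right_markov => // r ->; rewrite lexx s0.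
Qed.

End HarnessProcess.

(** * Translation of the parameters and of the time change *)

Section ModelConstants.
Context (R : realType) (N : nat) (A B C : R).
Hypotheses (hN : (1 <= N)%N) (hB2 : B < A + 1) (hC : C < - A - N%:R + 1)
  (hv : 0 < N%:R - 1 - B - C).
Local Notation a := (A - B).
Local Notation c := (N%:R - C - A).
Local Notation v := (v_const N A B C).

Let N1 : 1 <= N%:R :> R. Proof. by rewrite ler1n. Qed.

Let AC : A + C < 0. Proof. by have h := hC; have h' := N1; lra. Qed.

(** For [N = 1] the bounds on [B] and [C] give only [B + C < 1]; the sign then comes from [hv]. *)
Let BC : B + C < 0.
Proof.
have [N2|N2] := leqP 2 N.
  have h1 : 2 <= N%:R :> R by rewrite ler_nat.
  by have h := hC; have h' := hB2; lra.
have e : N%:R = 1 :> R by have -> : N = 1%N by apply/eqP; rewrite eqn_leq hN -ltnS N2.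
by have h := hv; lra.
Qed.

Let V0 : 0 < N%:R * (N%:R + A - B) * (A + C) * (B + C).
Proof.
rewrite -mulrA; apply: mulr_gt0.
  by apply: mulr_gt0; have h := N1; have h' := hB2; lra.
by rewrite -mulrNN; apply: mulr_gt0; rewrite oppr_gt0.
Qed.

Lemma v_const_gt0 : 0 < v.
Proof. by rewrite /v_const divr_gt0 // sqrtr_gt0. Qed.

Lemma v_const_sqr : v ^+ 2 * (a + c - 1) = N%:R * (N%:R + a) * (N%:R - c) * (N%:R - a - c).
Proof.
rewrite /v_const expr_div_n !sqr_sqrtr ?ltW //.
have -> : a + c - 1 = N%:R - 1 - B - C by ring.
rewrite mulfVK ?gt_eqF //; congr (_ * _ * _ * _); ring.
Qed.

(** The radicand is the numerator of [v ^+ 2] times [a + c - 1], while [v ^+ 2] has that factor as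
    its denominator. *)
Let sqrtE : Num.sqrt (N%:R * (A + C) * (B + C) * (A - B + N%:R) * (N%:R - 1 - B - C)) =
  v * (a + c - 1).
Proof.
have h0 : 0 <= v * (a + c - 1).
  apply: mulr_ge0; first exact/ltW/v_const_gt0.
  by have h := hv; lra.
rewrite -[RHS]ger0_norm // -sqrtr_sqr; congr Num.sqrt.
rewrite exprMn (expr2 (a + c - 1)) mulrA v_const_sqr.
by ring.
Qed.

Lemma eta_parE : eta_par N A B C = h_eta N a c v.
Proof. by rewrite /eta_par /h_eta sqrtE -mulNr; congr (_ / _); ring. Qed.

Lemma theta_parE : theta_par N A B C = h_theta N a c v.
Proof. by rewrite /theta_par /h_theta sqrtE -mulNr; congr (_ / _); ring. Qed.

Lemma sigma_parE : sigma_par N B C = h_sigma a c.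
Proof. by rewrite /sigma_par /h_sigma; congr (_^-1); ring. Qed.

Lemma sqrt_sigma : Num.sqrt (sigma_par N B C * sigma_par N B C) = sigma_par N B C.
Proof. by rewrite -expr2 sqrtr_sqr ger0_norm // invr_ge0 ltW. Qed.

Lemma gammaE : 1 + 2 * sigma_par N B C = (B + C - N%:R - 1) / (B + C - N%:R + 1).
Proof.
have h : N%:R - 1 - B - C != 0 by rewrite gt_eqF.
have h' : B + C - N%:R + 1 != 0.
  by rewrite -oppr_eq0; move: h; congr (_ != 0); ring.
rewrite /sigma_par; field.
by rewrite h'; move: h; congr (_ != 0).
Qed.

Lemma psi_xt t : 0 < t -> t != 1 -> psi N A B C (xt t) = phi N A B C t.
Proof.
move=> t0 t1; rewrite /psi /phi /xt /=.
have e1 : 1 + t != 0 by rewrite gt_eqF ?addr_gt0.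
have e2 : 1 - t != 0 by rewrite subr_eq0 eq_sym.
have -> : 1 - t / (1 + t) *+ 2 = (1 - t) / (1 + t) by field.
by field; rewrite e1 e2.
Qed.

Lemma xt_half : xt 1 = 2^-1 :> R.
Proof. by rewrite /xt; field. Qed.

Lemma xt_lt_half (t : R) : 0 < t -> t < 1 -> xt t < 2^-1.
Proof. by move=> t0 t1; rewrite -xt_half xt_lt. Qed.

Lemma xt_gt_half (t : R) : 1 < t -> 2^-1 < xt t.
Proof. by move=> t1; rewrite -xt_half xt_lt. Qed.

(* [(1 - t)] times the mean of [Y] at the time corresponding to [t]. *)
Definition drift (t : R) : R := - A * B - t * C * (A + N%:R).

Lemma Y_zval t k : t < 1 ->
  (A + phi N A B C t + k%:R) * (A + k%:R) = (v * zval N a c v t k + drift t) / (1 - t).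
Proof.
move=> t1; have e2 : 1 - t != 0 by rewrite gt_eqF // subr_gt0.
have ev : v != 0 by rewrite gt_eqF // v_const_gt0.
rewrite /phi /zval /drift [v * _]mulrC divfK //.
by field.
Qed.

Lemma Y'_zval t k : 1 < t ->
  (phi' N A B C t - A - k%:R) * (A + k%:R) = (v * zval N a c v t k + drift t) / (t - 1).
Proof.
move=> t1; have e2 : t - 1 != 0 by rewrite gt_eqF // subr_gt0.
have e3 : 1 - t != 0 by rewrite lt_eqF // subr_lt0.
have ev : v != 0 by rewrite gt_eqF // v_const_gt0.
rewrite /phi' /phi /zval /drift [v * _]mulrC divfK //.
by field; rewrite e2 e3.
Qed.

End ModelConstants.

(** * Comparison with the Case 1 process *)

Section FiniteLaws.
Context (R : realType) d (Omega : measurableType d) (P : probability Omega R).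
Context (n N : nat) (f : 'I_n -> Omega -> nat).
Hypotheses (mf : forall i, measurable_fun setT (f i))
  (f_out : forall i, prob P (~` (f i @^-1` [set j | (j <= N)%N])) = 0).

Definition law_set (k : 'I_n -> nat) : set Omega := [set w | forall i, f i w = k i].

Lemma measurable_law_set k : measurable (law_set k).
Proof.
have -> : law_set k = \bigcap_(i in [set: 'I_n]) (f i @^-1` [set k i]).
  by apply/seteqP; split=> w /=; [move=> h i _|move=> h i; apply: h].
by apply: fin_bigcap_measurable => // i _; apply: measurable_preimage_nat.
Qed.

(** Reduces the law of finitely many states to its atoms, so that processes on different probability
    spaces are compared through cylinder probabilities alone. *)
Lemma prob_law (B : set ('I_n -> nat)) :
  measurable [set w | B (fun i => f i w)] ->
  prob P [set w | B (fun i => f i w)] =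
  \sum_(k : {ffun 'I_n -> 'I_N.+1})
    (if (fun i => k i : nat) \in B then prob P (law_set (fun i => k i)) else 0).
Proof.
move=> mB; set E := [set w | _] in mB *.
pose Bad := \big[setU/set0]_(i < n) ~` (f i @^-1` [set j | (j <= N)%N]).
have [mBad Bad0] : measurable Bad /\ prob P Bad = 0.
  rewrite /Bad; elim/big_ind: _ => [|S S' [mS S0] [mS' S'0]|i _].
  - by split; [exact: measurable0|rewrite prob_set0].
  - split; first exact: measurableU.
    have := probE P mS'; rewrite S'0 => S'0'.
    by rewrite /prob (measureU0 mS mS' S'0').
  - split; last exact: f_out.
    by apply: measurableC; apply: measurable_preimage_nat.
have XA w : ~ Bad w -> cst 1 w = \sum_(k : {ffun 'I_n -> 'I_N.+1}) 1 *
    \1_(law_set (fun i => k i)) w :> R.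
  move=> nB; have fN i : (f i w < N.+1)%N.
    rewrite ltnS; apply: contrapT => h; apply: nB; rewrite /Bad.
    by rewrite (bigD1 i) //=; left.
  rewrite (bigD1 [ffun i => Ordinal (fN i)]) //= big1 ?addr0; last first.
    move=> k ne; rewrite indicE memNset ?mulr0 //= => h; case/negP: ne; apply/eqP.
    by apply/ffunP => i; rewrite ffunE; apply: val_inj => /=; rewrite h.
  by rewrite indicE mem_set ?mulr1 // => i; rewrite ffunE.
have mA (k : {ffun 'I_n -> 'I_N.+1}) := measurable_law_set (fun i => k i : nat).
have := integral_finite_valued mA (@measurable_cst _ _ Omega R setT 1) mBad Bad0 XA mB.
rewrite /cst /= integral_cst //= mul1e => PE.
apply: EFin_inj; rewrite -(probE P mB) PE; congr EFin; apply: eq_bigr => k _.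
rewrite mul1r; case: ifPn => [/set_mem kB|/negP kB].
  congr prob; apply/seteqP; split=> w /=; first by move=> [].
  by move=> h; split=> //; rewrite /E /= (_ : (fun i => _) = (fun i => k i : nat)) //;
    apply/funext.
rewrite (_ : _ `&` _ = set0) ?prob_set0 // -subset0 => w [Ew h]; apply: kB.
by rewrite inE (_ : (fun i => _) = (fun i => f i w)) //; apply/funext => i; rewrite h.
Qed.

End FiniteLaws.

Lemma expect_nat (R : realType) d (Omega : measurableType d) (P : probability Omega R)
    (f : Omega -> nat) N (h : nat -> R) : measurable_fun setT f ->
  prob P (~` (f @^-1` [set j | (j <= N)%N])) = 0 ->
  ('E_P[h \o f] = (\sum_(j < N.+1) h j * prob P (f @^-1` [set (j : nat)]))%:E)%E.
Proof.
move=> mf f0; have mp S : measurable (f @^-1` S) by apply: measurable_preimage_nat.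
rewrite unlock.
have XA w : ~ (~` (f @^-1` [set j | (j <= N)%N])) w -> (h \o f) w =
    \sum_(j < N.+1) h j * \1_(f @^-1` [set (j : nat)]) w.
  move=> /contrapT /= fN; have fN' : (f w < N.+1)%N by [].
  rewrite (bigD1 (Ordinal fN')) //= big1 ?addr0; last first.
    move=> k ne; rewrite indicE memNset ?mulr0 //= => e; case/negP: ne; apply/eqP.
    by apply: val_inj => /=; rewrite e.
  by rewrite indicE mem_set ?mulr1.
have mhf : measurable_fun setT (h \o f) by apply: measurableT_comp.
rewrite (integral_finite_valued (fun j => mp _) mhf (measurableC (mp _)) f0 XA) //.
by congr EFin; apply: eq_bigr => j _; rewrite setTI.
Qed.

Section CylinderLaws.
Context (R : realType) (N n : nat) (x : 'I_n -> R) (k : 'I_n -> nat).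

Definition time_list : seq R := sort <=%R (undup (codom x)).

(** The default values are the states at the two ends, as the finite-dimensional formula requires
    [k 0 = 0] and [k 1 = N]. *)
Definition time_states (r : R) : nat :=
  if [pick i | x i == r] is Some i then k i else if r == 1 then N else 0%N.

Lemma law_set_cylinder (Omega : Type) (V : R -> Omega -> nat) :
  (forall i j, x i = x j -> k i = k j) ->
  [set w | forall i, V (x i) w = k i] = cylinder V time_list time_states.
Proof.
move=> kx; have e i : time_states (x i) = k i.
  rewrite /time_states; case: pickP => [j /eqP /kx //|/(_ i)]; by rewrite eqxx.
apply/seteqP; split=> w /= h.
  by move=> r; rewrite mem_sort mem_undup => /codomP[i ->]; rewrite h e.
by move=> i; rewrite h ?e // mem_sort mem_undup codom_f.
Qed.

Hypothesis x_itv : forall i, 0 < x i < 2^-1.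

Lemma time_list_path : path <%R 0 (rcons time_list 2^-1).
Proof.
have h r : r \in time_list -> 0 < r < 2^-1.
  by rewrite mem_sort mem_undup => /codomP[i ->].
rewrite (path_pairwise lt_trans) pairwise_cons pairwise_rcons; apply/and3P; split.
- rewrite all_rcons invr_gt0 ltr0n; apply/allP => r /h /andP[] //.
- by apply/allP => r /h /andP[].
- by rewrite -(sorted_pairwise lt_trans) lt_sorted_sort.
Qed.

Lemma time_states0 : time_states 0 = 0%N.
Proof.
rewrite /time_states; case: pickP => [i /eqP xi|_]; last by rewrite eq_sym oner_eq0.
by have := x_itv i; rewrite xi ltxx.
Qed.

Lemma time_states1 : time_states 1 = N.
Proof.
rewrite /time_states; case: pickP => [i /eqP xi|_]; last by rewrite eqxx.
have h : (2^-1 : R) < 1 by lra.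
by have /andP[_] := x_itv i; rewrite xi ltNge (ltW h).
Qed.

End CylinderLaws.

Section Case1Chain.
Context (R : realType) (N : nat) (A B C : R).
Hypotheses (hB2 : B < A + 1) (hC : C < - A - N%:R + 1) (hv : 0 < N%:R - 1 - B - C).
Context d (Omega : measurableType d) (P : probability Omega R) (xi : R -> Omega -> nat).
Hypotheses (mxi : process (T_dom A B) xi) (hxi : case1_chain (prob P) N A B C xi).
Local Notation psi := (psi N A B C).
Local Notation a := (A - B).
Local Notation c := (N%:R - C - A).

Lemma cond_prob_setT : cond_prob P setT = prob P.
Proof. by apply/funext => E; rewrite /cond_prob setIT prob_setT divr1. Qed.

(** Case 1 is a forward chain with trivial conditioning, pinned at 1 in state [N]; it therefore has
    the same closed form as [state_fdd]. *)
Lemma case1_fdd (s : seq R) k : path <%R 0 (rcons s 2^-1) -> k 0 = 0%N -> k 1 = N ->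
  prob P (cylinder (xi \o psi) s k) = path_weight a c k 0 (rcons s 1) / qk a c 0 0 1 N.
Proof.
move=> hp k0 k1; have [h1 h2 h3] := hxi; rewrite -cond_prob_setT.
have half0 : 0 < 2^-1 :> R by lra.
have half1 : 2^-1 <= 1 :> R by lra.
apply: (forward_fdd (par_a hB2) (par_c hC) (par_ac A hv) _ _ half0 half1 (lexx 1) (leqnn N))
  => //;
  rewrite ?cond_prob_setT ?prob_setT ?oner_eq0 //.
- by move=> x hx; apply/mxi/T_dom_psi.
- by move=> x hx; apply/h1/T_dom_psi.
- move=> x j hx jN; rewrite h2 //; last exact: T_dom_psi.
  by have /andP[x0 x1] := hx; rewrite (case1_marginal_bridge hB2 hC hv).
- move=> x y m j s' k' x0 xy y1 mN jN hs'.
  rewrite (h3 (psi x) (psi y)) //.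
  + by rewrite (case1_trans_bridge hB2 hC hv) // ltW.
  + by apply: T_dom_psi => //; rewrite x0 (lt_trans xy).
  + by apply: T_dom_psi => //; rewrite y1 (lt_trans x0).
  + exact: psi_ltl.
  + apply: sigma_process_cylinder => r /hs' /andP[r0 rx] /=.
    split; first by apply: T_dom_psi => //; rewrite r0 (le_lt_trans rx) // (lt_trans xy).
    by move: rx; rewrite le_eqVlt => /orP[/eqP -> //|rx]; apply/ltW/psi_ltl => //;
      apply: lt_trans y1.
Qed.

Lemma case1_out x : 0 < x < 2^-1 -> prob P (~` (xi (psi x) @^-1` [set j | (j <= N)%N])) = 0.
Proof.
move=> hx; have [h1 _ _] := hxi; have Tx := T_dom_psi _ hv hx.
by rewrite prob_setC ?h1 ?subrr //; apply: measurable_preimage_nat; apply: mxi.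
Qed.

Lemma case1_prob x j : 0 < x < 2^-1 -> (j <= N)%N ->
  prob P (xi (psi x) @^-1` [set j]) = bridge a c 0 0 x j 1 N.
Proof.
move=> hx jN; have [_ h2 _] := hxi; rewrite h2 //; last exact: T_dom_psi.
by have /andP[x0 x1] := hx; rewrite (case1_marginal_bridge hB2 hC hv).
Qed.

End Case1Chain.

(** Since [zval] has mean 0, centring [Y] removes exactly [dr / r]. The scale [r] is [1 - t] before
    time 1 and [t - 1] after it. *)
Lemma centered_zval (R : realType) d (Omega : measurableType d) (P : probability Omega R)
    (N : nat) (a c v dr r t : R) (f : Omega -> nat) (Y : Omega -> R) :
  -1 < a -> N.*2%:R - 1 < c -> 1 < a + c -> v != 0 -> r != 0 -> 0 < t ->
  measurable_fun setT f -> prob P (~` (f @^-1` [set j | (j <= N)%N])) = 0 ->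
  (forall j, (j <= N)%N -> prob P (f @^-1` [set j]) = bridge a c 0 0 (xt t) j 1 N) ->
  (forall w, Y w = (v * zval N a c v t (f w) + dr) / r) ->
  forall w, r / v * (Y w - fine ('E_P[Y])%E) = zval N a c v t (f w).
Proof.
move=> ha hc hac v0 r0 t0 mf fN fE YE w.
have -> : Y = (fun k => (v * zval N a c v t k + dr) / r) \o f by apply/funext.
rewrite (expect_nat _ mf fN) /=.
rewrite (eq_bigr (fun j : 'I_N.+1 =>
  v / r * (bridge a c 0 0 (xt t) j 1 N * zval N a c v t j) + dr / r * bridge a c 0 0 (xt t) j
    1 N)).
  rewrite big_split /= -!mulr_sumr (zval_mean0 ha hc hac v0 t0).
  rewrite (bridge_sum ha hc hac (lexx 0) (xt_gt0 t0) (xt_lt1 t0) (lexx 1)) ?leqnn //.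
  by field; rewrite v0 r0.
by move=> j _; rewrite fE; [rewrite /=; ring | rewrite -ltnS ltn_ord].
Qed.

Unset Implicit Arguments.

Theorem theorem4p1 (R : realType) (N : nat) (A B C : R)
    (d : measure_display) (Omega : measurableType d) (P : probability Omega R)
    (Theta : Omega -> nat) (zeta zeta' : R -> Omega -> nat)
    (hN : (1 <= N)%N) (hA : - (1 / 2) < A)
    (hB1 : - A < B) (hB2 : B < A + 1) (hC : C < - A - N%:R + 1)
    (* v is a well-defined positive real; this is automatic when 2 <= N *)
    (hv : 0 < N%:R - 1 - B - C)
    (mTheta : measurable_fun setT Theta)
    (mzeta : process (T_dom A B) zeta)
    (mzeta' : process (T'_dom N A C) zeta')
    (hTheta : forall k : nat, (k <= N)%N ->
       prob P (Theta @^-1` [set k]) = Pi_law N (A + C) (A - B + 1) k)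
    (hindep : cond_independent P N Theta (T_dom A B) (T'_dom N A C) zeta zeta')
    (hzeta : forall K : nat, (K <= N)%N ->
       xi_chain (cond_prob P (Theta @^-1` [set K])) A B K zeta)
    (hzeta' : forall K : nat, (K <= N)%N ->
       xi_dual_chain (cond_prob P (Theta @^-1` [set K])) N A C K zeta') :
  let Z := Z_process P N A B C Theta zeta zeta' in
  let eta := eta_par N A B C in
  let theta := theta_par N A B C in
  let sigma := sigma_par N B C in
  let tau := sigma_par N B C in
  let gamma := 1 + 2 * Num.sqrt (sigma * tau) in
  [/\ markov_process P [set t : R | 0 < t] Z,
      (forall (d' : measure_display) (Omega' : measurableType d')
          (P' : probability Omega' R) (xi : R -> Omega' -> nat),
        process (T_dom A B) xi ->
        case1_chain (prob P') N A B C xi ->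
        same_fdd P P' [set t : R | 0 < t < 1] Z (Z_case1 P' N A B C xi)),
      quadratic_harness P [set t : R | 0 < t] Z eta theta sigma tau gamma
    & gamma = (B + C - N%:R - 1) / (B + C - N%:R + 1)].
Proof.
move=> Z eta theta sigma tau gamma.
set a := A - B; set c := N%:R - C - A; set v := v_const N A B C.
have ha : -1 < a := par_a hB2.
have hc : N.*2%:R - 1 < c := par_c hC.
have hac : 1 < a + c := par_ac A hv.
have v0 : v != 0 by rewrite gt_eqF // v_const_gt0.
have v2 := v_const_sqr hN hB2 hC hv.
pose W := state N A B C Theta zeta zeta'.
have mW : forall x, measurable_fun setT (W x) by move=> x; apply: measurable_state.
have W0 w : W 0 w = 0%N by apply: state0.
have W1 w : W 1 w = N by apply: state1.
have W_fdd := state_fdd hB2 hC hv mTheta mzeta mzeta' hTheta hindep hzeta hzeta'.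
have W_out x := state_out ha hc hac mW W0 W1 W_fdd (x := x).
have W_prob x j := prob_state W_fdd (x := x) j.
have ZE t : 0 < t -> Z t = zval N a c v t \o W (xt t).
  move=> t0; apply/funext => w; rewrite /Z /Z_process /=.
  have xI : 0 < xt t < 1 by rewrite xt_gt0 // xt_lt1.
  have xI' : 0 <= xt t <= 1 by rewrite !ltW // ?xt_gt0 // xt_lt1.
  have [t1|t1|t1] := ltgtP t 1.
  - have E : zeta (phi N A B C t) = W (xt t).
      by rewrite /W state_left ?xt_gt0 ?xt_lt_half //= psi_xt // lt_eqF.
    rewrite /centered; apply: (centered_zval (dr := drift N A B C t) ha hc hac v0 _ t0 (mW
      (xt t))).
    + by rewrite subr_eq0 gt_eqF.
    + exact: W_out.
    + by move=> j _; apply: W_prob.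
    + by move=> w'; rewrite /Y_process E (Y_zval hN hB2 hC hv).
  - have E : zeta' (phi' N A B C t) = W (xt t).
      by rewrite /W state_right ?xt_lt1 ?xt_gt_half //= psi_xt // gt_eqF.
    rewrite /centered; apply: (centered_zval (dr := drift N A B C t) ha hc hac v0 _ t0 (mW
      (xt t))).
    + by rewrite subr_eq0 gt_eqF.
    + exact: W_out.
    + by move=> j _; apply: W_prob.
    + by move=> w'; rewrite /Y'_process E (Y'_zval hN hB2 hC hv).
  (* At [t = 1] the squares of the state cancel in [zval], which leaves the affine function of
     [Theta]. *)
  - subst t; rewrite xt_half /W state_mid /zval /a /c; congr (_ / _); ring.
have gE : gamma = 1 + 2 * h_sigma a c by rewrite /gamma sqrt_sigma // (sigma_parE N A B C).
have harness := harness_process ha hc hac v0 v2 mW W0 W1 W_fdd ZE.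
split.
- exact: (markov_process_Z ha hc hac v0 mW W0 W1 W_fdd ZE).
- move=> d' Omega' P' xi mxi hxi n t U ht mU.
  pose x i := xt (tnth t i).
  have xI i : 0 < x i < 2^-1.
    by have /andP[t0 t1] := ht i; rewrite /x xt_gt0 // xt_lt_half.
  pose f' i := xi (psi N A B C (x i)).
  have mf' i : measurable_fun setT (f' i) by apply/mxi/T_dom_psi.
  have f'_out i := case1_out hv mxi hxi (xI i).
  have ZE' i : Z_case1 P' N A B C xi (tnth t i) = zval N a c v (tnth t i) \o f' i.
    have /andP[t0 t1] := ht i.
    have E : xi (phi N A B C (tnth t i)) = f' i by rewrite /f' /x psi_xt // lt_eqF.
    apply/funext => w; rewrite /Z_case1 /centered.
    apply: (centered_zval (dr := drift N A B C (tnth t i)) ha hc hac v0 _ t0 (mf' i)).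
    + by rewrite subr_eq0 gt_eqF.
    + exact: f'_out.
    + by move=> j jN; apply: (case1_prob hB2 hC hv hxi (xI i)).
    + by move=> w'; rewrite /Y_process E (Y_zval hN hB2 hC hv).
  have W_out' i : prob P (~` (W (x i) @^-1` [set j | (j <= N)%N])) = 0.
    by have /andP[t0 t1] := ht i; rewrite W_out // !ltW // ?xt_gt0 // xt_lt1.
  (* Both processes are images of their states under the same maps [zval], so the events reduce to
     one set of state vectors. *)
  pose S : set ('I_n -> nat) :=
    [set k | U [tuple zval N a c v (tnth t i) (k i) | i < n]].
  have S1 : [set w | U [tuple Z (tnth t i) w | i < n]] = [set w | S (fun i => W (x i) w)].
    apply/seteqP; split=> w /=; rewrite /S /=;
    by congr (U _); apply: eq_mktuple => i; have /andP[t0 _] := ht i; rewrite ZE.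
  have S2 : [set w | U [tuple Z_case1 P' N A B C xi (tnth t i) w | i < n]] =
      [set w | S (fun i => f' i w)].
    apply/seteqP; split=> w /=; rewrite /S /=;
    by congr (U _); apply: eq_mktuple => i; rewrite ZE'.
  have mS1 : measurable [set w | S (fun i => W (x i) w)].
    rewrite -S1 -[X in measurable X]setTI.
    have : measurable_fun setT (fun w => [tuple Z (tnth t i) w | i < n]).
      apply/measurable_fun_tnthP => i; rewrite (_ : _ \o _ = Z (tnth t i)).
        by have /andP[t0 _] := ht i; rewrite ZE //; apply: measurableT_comp.
      by apply/funext => w /=; rewrite tnth_mktuple.
    by apply.
  have mS2 : measurable [set w | S (fun i => f' i w)].
    rewrite -S2 -[X in measurable X]setTI.
    have : measurable_fun setT (fun w => [tuple Z_case1 P' N A B C xi (tnth t i) w | i < n]).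
      apply/measurable_fun_tnthP => i; rewrite (_ : _ \o _ = Z_case1 P' N A B C xi (tnth t i)).
        by rewrite ZE' //; apply: measurableT_comp.
      by apply/funext => w /=; rewrite tnth_mktuple.
    by apply.
  rewrite S1 S2 (probE P mS1) (probE P' mS2); congr EFin.
  rewrite (prob_law (fun i => mW (x i)) W_out' mS1) (prob_law mf' f'_out mS2).
  apply: eq_bigr => k _; case: ifP => // _.
  (* If two equal times carry different states, the atom is empty for both processes; otherwise it
     is a cylinder over the sorted list of times. *)
  have [kx|/existsNP[i /existsNP[j /not_implyP[xij kij]]]] :=
      pselect (forall i j, x i = x j -> (k i : nat) = k j); last first.
    rewrite /law_set [X in prob P X](_ : _ = set0) ?[X in prob P' X](_ : _ = set0) ?prob_set0
      //.
      by rewrite -subset0 => w /= h; apply: kij; rewrite -!h /f' xij.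
    by rewrite -subset0 => w /= h; apply: kij; rewrite -!h xij.
  rewrite /law_set (law_set_cylinder N W kx) (law_set_cylinder N (xi \o psi N A B C) kx).
  have hp := time_list_path xI.
  have k0 := time_states0 N (fun i => k i : nat) xI.
  have k1 := time_states1 N (fun i => k i : nat) xI.
  rewrite (case1_fdd hB2 hC hv mxi hxi hp k0 k1) W_fdd //.
  have half1 : 2^-1 < 1 :> R by lra.
  move: hp; rewrite -!cats1 !cat_path /= !andbT => /andP[-> h] /=.
  exact: lt_trans half1.
- by rewrite /eta /theta /sigma /tau gE eta_parE // theta_parE // (sigma_parE N A B C).
- by rewrite /gamma sqrt_sigma // gammaE.
Qed.
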